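(* Let $\theta_\infty^*=\inf_{d\ge2}\theta_d^*$. (a) If $\mathcal D[f]\ge0$ for every admissible density $f$ on $\mathbb R^d$ in every dimension $d\ge2$, then $0\le\theta_\infty^*<1$. (b) If there exist $d_0\ge1$ and an admissible density $g$ on $\mathbb R^{d_0}$ with $\mathcal D[g]<0$, then $\theta_d^*=-\infty$ for every $d\ge d_0$; in particular $\theta_\infty^*=-\infty$.
   Context: For $d\ge1$, call a probability density $f$ on $\mathbb R^d$ admissible if it is smooth, strictly positive, rapidly decaying, and $\mathcal Q[f]>0$. Define $\theta_d^*=\inf_f \mathcal I[f]\mathcal D[f]/\mathcal Q[f]^2$, the infimum over admissible densities on $\mathbb R^d$ (possibly $-\infty$). Here, writing $f=e^u$ and $\mathsf H_f=-\nabla^2u$: $\mathcal I[f]=\int\operatorname{tr}(\mathsf H_f)f\,dx$, $\mathcal Q[f]=\int\operatorname{tr}(\mathsf H_f^2)f\,dx$, $\mathcal D[f]=\int(|\nabla\mathsf H_f|^2+2\operatorname{tr}(\mathsf H_f^3))f\,dx$, with $|\nabla\mathsf H_f|^2=\sum_{i,j,k}(\partial_k(\mathsf H_f)_{ij})^2$. *)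

(* Defs.v *)
From HB Require Import structures.
From mathcomp Require Import all_boot all_order all_algebra.
From mathcomp Require Import all_classical all_reals all_analysis.
Set Implicit Arguments. Unset Strict Implicit. Unset Printing Implicit Defensive.
Import Order.TTheory GRing.Theory Num.Theory.
Import numFieldNormedType.Exports.
Local Open Scope classical_set_scope.
Local Open Scope ring_scope.

Section Defs.
Variable R : realType.

Definition vcons (n : nat) (x : R) (y : 'rV[R]_n) : 'rV[R]_n.+1 :=
  \row_(j < n.+1) match unlift ord0 j with Some k => y 0 k | None => x end.

(* Lebesgue integral over R^n, as the iterated one-dimensional Lebesgue
   integral (real-valued; for the integrable continuous integrands used
   below this equals the Lebesgue integral on R^n by Fubini). *)
Fixpoint iint (n : nat) : ('rV[R]_n -> R) -> R :=
  match n with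
  | 0 => fun f => f 0
  | n'.+1 => fun f =>
      Rintegral (@lebesgue_measure R) setT (fun x => iint (fun y => f (vcons x y)))
  end.

Fixpoint iint_nn (n : nat) : ('rV[R]_n -> \bar R) -> \bar R :=
  match n with
  | 0 => fun f => f 0
  | n'.+1 => fun f =>
      (\int[@lebesgue_measure R]_x iint_nn (fun y => f (vcons x y)))%E
  end.

(* Lebesgue integrability on R^n (for continuous functions: Tonelli) *)
Definition Rn_integrable (n : nat) (f : 'rV[R]_n -> R) : Prop :=
  (iint_nn (fun x => (`|f x|)%:E) < +oo)%E.

Definition partial (n : nat) (i : 'I_n) (f : 'rV[R]_n -> R) : 'rV[R]_n -> R :=
  fun x => derive f x (delta_mx 0 i).

Definition dparts (n : nat) (s : seq 'I_n) (f : 'rV[R]_n -> R) : 'rV[R]_n -> R :=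
  foldr (@partial n) f s.

Definition smooth (n : nat) (f : 'rV[R]_n -> R) : Prop :=
  forall (s : seq 'I_n) (x : 'rV[R]_n), differentiable (dparts s f) x.

Definition rapidly_decaying (n : nat) (f : 'rV[R]_n -> R) : Prop :=
  forall (s : seq 'I_n) (k : nat), exists C : R,
    forall x : 'rV[R]_n, `|x| ^+ k * `|dparts s f x| <= C.

Definition Hf (n : nat) (f : 'rV[R]_n -> R) (x : 'rV[R]_n) : 'M[R]_n :=
  \matrix_(i < n, j < n) - partial i (partial j (fun y => ln (f y))) x.

Definition I_integrand (n : nat) (f : 'rV[R]_n -> R) (x : 'rV[R]_n) : R :=
  \tr (Hf f x) * f x.

Definition Q_integrand (n : nat) (f : 'rV[R]_n -> R) (x : 'rV[R]_n) : R :=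
  \tr (Hf f x *m Hf f x) * f x.

Definition gradH_sq (n : nat) (f : 'rV[R]_n -> R) (x : 'rV[R]_n) : R :=
  \sum_(i < n) \sum_(j < n) \sum_(k < n) (partial k (fun y => Hf f y i j) x) ^+ 2.

Definition D_integrand (n : nat) (f : 'rV[R]_n -> R) (x : 'rV[R]_n) : R :=
  (gradH_sq f x + 2 * \tr (Hf f x *m Hf f x *m Hf f x)) * f x.

Definition Ifun (n : nat) (f : 'rV[R]_n -> R) : R := iint (I_integrand f).
Definition Qfun (n : nat) (f : 'rV[R]_n -> R) : R := iint (Q_integrand f).
Definition Dfun (n : nat) (f : 'rV[R]_n -> R) : R := iint (D_integrand f).

Definition admissible (n : nat) (f : 'rV[R]_n -> R) : Prop :=
  [/\ smooth f /\ (forall x, 0 < f x), rapidly_decaying f,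
      Rn_integrable f /\ iint f = 1,
      [/\ Rn_integrable (I_integrand f), Rn_integrable (Q_integrand f)
        & Rn_integrable (D_integrand f)]
    & 0 < Qfun f].

Definition theta_star (d : nat) : \bar R :=
  ereal_inf [set ((Ifun f * Dfun f) / (Qfun f) ^+ 2)%:E
            | f in [set f : 'rV[R]_d -> R | admissible f]].

Definition theta_infty : \bar R :=
  ereal_inf [set theta_star d | d in [set d : nat | (2 <= d)%N]].

End Defs.

(* Main.v *)
(** (a) I is the Fisher information, hence nonnegative, so all ratios are nonnegative when D is.
    By AM-GM it suffices for I D < Q^2 that 16 I - 8 Q + D < 0. In dimension 2 take the density
    proportional to exp (e phi - e^6 |x|^2 / 2) with phi = cos 2x + 2 cos x cos (sqrt 3 y) and e
    small: integrals of trigonometric polynomials against the wide Gaussian are close to their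
    means, and those of the orders e and e^2 of the integrand vanish while that of e^3 is -12.

    (b) Tensoring g with a wide one-dimensional Gaussian keeps D < 0, which raises the dimension.
    Multiplying g by the sixth power of a cutoff at large scale also keeps D < 0, the only
    delicate term being handled by integration by parts. To the truncated density add a Gaussian of
    precision b centred far away: both parts being sixth powers, the integrands of the sum stay
    uniformly bounded where they overlap, so by dominated convergence the functionals become
    additive as the centre goes to infinity. For a suitable mass the Gaussian contributes
    1/b to I, 1 to Q and 2 b to D, and the ratio tends to minus infinity as b goes to 0. *)

(* Why these waves: at order e^2 a plane wave of wave vector v contributes to 16 I - 8 Q + D a
   multiple of |v|^2 (|v|^2 - 4)^2. The three wave vectors have length 2, so this order cancels and
   the cubic one decides the sign. The Gaussian has precision k^2 with k = e^3: integrals differ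
   from means by a relative error of size k, which multiplied by e is of order e^4. Why truncate:
   admissibility does not bound the derivatives of ln g, so the integrands of g plus a Gaussian have
   no evident common majorant. After truncation the interaction lives in a fixed ball, but the
   truncated density vanishes at the edge of its support, where the logarithm is singular. Why the
   power 6: if f behaves like s^6 with m-th derivatives of size s^(6 - m), then H has size s^-2, its
   gradient s^-3, and f (|grad H|^2 + 2 tr H^3) has size s^0, the worst of the three integrands.
   With both summands of this form, the single weight s, the cutoff plus the Gaussian before its
   sixth power is taken, controls the whole mixture. *)
Require Import Defs.
From HB Require Import structures.
From mathcomp Require Import all_boot all_order all_algebra.
From mathcomp Require Import all_classical all_reals all_analysis.
From mathcomp Require Import measurable_realfun ring lra.
Import Order.TTheory GRing.Theory Num.Theory.
Import numFieldNormedType.Exports.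
Local Open Scope classical_set_scope.
Local Open Scope ring_scope.

Set Implicit Arguments. Unset Strict Implicit. Unset Printing Implicit Defensive.

(** * Integration over row vectors *)

(* The library has no Lebesgue measure on ['rV[R]_n]: integrals are transported along
   [chart_map] from the iterated product of lines. *)
Record rV_chart (R : realType) (n : nat) := RVChart {
  chart_display : measure_display;
  chart_type :> measurableType chart_display;
  chart_measure : {sigma_finite_measure set chart_type -> \bar R};
  chart_map : chart_type -> 'rV[R]_n }.

Section prod_measure.
Context (R : realType) d1 d2 (T1 : measurableType d1) (T2 : measurableType d2).
Variables (m1 : {sigma_finite_measure set T1 -> \bar R})
  (m2 : {sigma_finite_measure set T2 -> \bar R}).

Definition prod_measure : set (T1 * T2) -> \bar R := (m1 \x m2)%E.

HB.instance Definition _ := Measure.on prod_measure.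

(** The recursion on the dimension rests on this: Tonelli at each new coordinate asks for a
    sigma-finite product of the remaining ones. Rectangles built on two increasing exhaustions
    exhaust the product, a point lying in the rectangle of the larger of its two indices. *)
Lemma prod_measure_sigma_finite : sigma_finite setT prod_measure.
Proof.
have /sigma_finiteP[F [TF ndF Foo]] := sigma_finiteT m1.
have /sigma_finiteP[G [TG ndG Goo]] := sigma_finiteT m2.
exists (fun n => F n `*` G n).
  rewrite -setXTT TF TG predeqE => -[x y]; split.
    move=> [/= [n _ Fnx] [k _ Gky]]; exists (maxn n k) => //; split.
    - by move: x Fnx; exact/subsetPset/ndF/leq_maxl.
    - by move: y Gky; exact/subsetPset/ndG/leq_maxr.
  by move=> [n _ []/= ? ?]; split; exists n.
move=> k; have [? ?] := Foo k; have [? ?] := Goo k.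
split; first exact: measurableX.
by rewrite /prod_measure product_measure1E// lte_mul_pinfty// ge0_fin_numE.
Qed.

HB.instance Definition _ := Measure_isSigmaFinite.Build _ _ _ prod_measure
  prod_measure_sigma_finite.
End prod_measure.

(** A unit mass on one point is the volume in dimension 0, in agreement with [iint], which evaluates
    there at the only row. The successor case follows [vcons], so integrals over the chart unfold
    exactly like [iint] and [iint_nn]. *)
Fixpoint chart (R : realType) (n : nat) : rV_chart R n :=
  match n with
  | 0 => @RVChart R 0 _ unit (dirac tt) (fun _ => 0)
  | n'.+1 => @RVChart R n'.+1 _ _
      (prod_measure (@lebesgue_measure R) (chart_measure (chart R n')))
      (fun z => vcons z.1 (chart_map z.2))
  end.

Definition rV_measurable (R : realType) n (f : 'rV[R]_n -> R) :=
  measurable_fun [set: chart R n] (f \o @chart_map _ _ (chart R n)).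

Section chart_theory.
Variable R : realType.
Notation vol n := (chart_measure (chart R n)).
Notation emb n := (@chart_map _ _ (chart R n)).

Lemma measurable_chart_coord n (i : 'I_n) :
  measurable_fun [set: chart R n] (fun z => emb n z 0 i).
Proof.
elim: n i => [[] //|n IH] i /=.
case: (unliftP ord0 i) => [j ->|->].
- apply: (eq_measurable_fun (fun z => emb n z.2 0 j)).
    by move=> z _; rewrite /vcons mxE liftK.
  exact: (measurableT_comp (IH j)).
- apply: (eq_measurable_fun (fun z => z.1)).
    by move=> z _; rewrite /vcons mxE unlift_none.
  exact: measurable_fst.
Qed.

Lemma iint_nnE n (F : 'rV[R]_n -> \bar R) : (forall x, 0 <= F x)%E ->
  measurable_fun [set: chart R n] (fun z => F (emb n z) : \bar R) ->
  iint_nn F = (\int[vol n]_z F (emb n z))%E.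
Proof.
elim: n F => [|n IH] F F0 mF /=.
  by rewrite integral_dirac// diracT mul1e.
apply: etrans (esym (@fubini_tonelli1 _ _ (measurableTypeR R) (chart R n) R
  (@lebesgue_measure R) (vol n) (fun z => F (vcons z.1 (emb n z.2))) mF _)) => //.
apply: eq_integral => x _; rewrite IH //.
exact: (measurableT_comp mF (pair1_measurable x)).
Qed.

End chart_theory.

Section chart_theory2.
Variable R : realType.
Notation vol n := (chart_measure (chart R n)).
Notation emb n := (@chart_map _ _ (chart R n)).

(** Measurability refers to the chart, where only the coordinates are known to be measurable. The
    preimage of an open ray is open, hence a countable union of rational boxes, and a box is a
    finite intersection of conditions on single coordinates. *)
Lemma continuous_rV_measurable n (f : 'rV[R]_n -> R) :
  continuous f -> rV_measurable f.
Proof.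
move=> fc; apply: (measurability (@RGenOInfty.G R)).
  exact: RGenOInfty.measurableE.
move=> _ -[_ [a ->] <-]; rewrite setTI.
set U := f @^-1` `]a, +oo[%classic.
have oU : open U.
  by apply: open_comp => [x _|]; [exact: fc|exact: itv_open_ends_open].
pose box (p : 'rV[rat]_n * nat) : set 'rV[R]_n :=
  [set x | forall i, `|x 0 i - ratr (p.1 0 i)| < p.2.+1%:R^-1].
(* Boxes that leave [U] are replaced by the empty set, so that the union runs over the whole
   countable type of indices. *)
pose box' p := if pselect (box p `<=` U) then box p else set0.
have -> : (f \o emb n) @^-1` `]a, +oo[%classic =
   \bigcup_p (emb n @^-1` box' p).
  apply/seteqP; split => [z Uz|z [p _]] /=; last first.
    by rewrite /preimage /= /box'; case: pselect => // pU /pU.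
  have : nbhs (emb n z) U by apply: open_nbhs_nbhs.
  rewrite -nbhs_ballE => -[e /= e0 eU].
  have [k /andP[k0 ke]] : exists k, (0 < k.+1%:R^-1 :> R) && (2 * k.+1%:R^-1 < e).
    have [k] := near_infty_natSinv_lt (PosNum (divr_gt0 e0 (ltr0Sn R 1))).
    move=> _ /(_ k (leqnn k)) /= h; exists k; rewrite invr_gt0 ltr0Sn /=.
    by rewrite mulrC -ltr_pdivlMr.
  have /all_sig [q qP] (i : 'I_n) : {q : rat | `|emb n z 0 i - ratr q| < k.+1%:R^-1}.
    have h : emb n z 0 i - k.+1%:R^-1 < emb n z 0 i + k.+1%:R^-1.
      by rewrite ltrD2l gtrN.
    apply: cid; have [q] := rat_in_itvoo h.
    rewrite in_itv /= => /andP[h1 h2]; exists q.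
    by rewrite ltr_distl ltrBlDr h2 -ltrBlDr h1.
  exists (\row_i q i, k) => //=; rewrite /box'.
  case: pselect => /= [?|[]]; first by move=> i; rewrite mxE.
  move=> x bx; apply: eU; rewrite -ball_normE /=.
  rewrite /Num.norm /= mx_normrE.
  apply/bigmax_ltP; split => // -[i j] _ /=; rewrite !mxE ord1.
  move: (bx j) (qP j) => /=; rewrite mxE => h1 h2.
  apply: le_lt_trans ke; rewrite mulr_natl mulr2n.
  rewrite -(subrKA (ratr (q j))) (le_trans (ler_normD _ _))//.
  by rewrite lerD// ltW// distrC.
apply: countable_bigcupT_measurable; [exact: countableP|move=> p].
have [->|->] : box' p = box p \/ box' p = set0.
- by rewrite /box'; case: pselect => ? /=; [left|right].
2: by rewrite preimage_set0.
have -> : emb n @^-1` box p = \bigcap_(i in [set: 'I_n])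
   ((fun z => emb n z 0 i) @^-1` (ball (ratr (p.1 0 i) : R) (p.2.+1%:R^-1))).
  apply/seteqP; split => z /= zp i; first by rewrite /ball /= distrC.
  by rewrite distrC; exact: zp.
apply: fin_bigcap_measurable => // i _.
rewrite -[X in measurable X]setTI; apply: measurable_chart_coord => //.
exact: measurable_ball.
Qed.

(** The integral is by definition the difference of those of the positive and negative parts, and
    Tonelli makes each of them measurable in the parameter. Integrability does not enter, so slices
    with a meaningless integral do no harm. *)
Lemma measurable_Rintegral_param d d' (P : measurableType d)
    (T : measurableType d') (m : {sigma_finite_measure set T -> \bar R})
    (h : P * T -> R) : measurable_fun [set: P * T] h ->
  measurable_fun [set: P] (fun p => \int[m]_y h (p, y)).
Proof.
move=> mh; rewrite /Rintegral.
apply: (@measurableT_comp _ _ _ _ _ _ _ _ (fun p => (\int[m]_y (h (p, y))%:E)%E)) => //.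
have mH : measurable_fun [set: P * T] (EFin \o h) by exact/measurable_EFinP.
have -> : (fun p => (\int[m]_y (h (p, y))%:E)%E) =
  ((fun p => \int[m]_y (EFin \o h)^\+ (p, y)) \- (fun p => \int[m]_y (EFin \o h)^\- (p, y)))%E.
  apply/funext => p; rewrite [LHS]integralE. congr (_ - _)%E; apply: eq_integral => y _; rewrite ?funeposE ?funenegE //.
apply: emeasurable_funB.
  apply: (@measurable_fun_fubini_tonelli_F _ _ _ _ R m (EFin \o h)^\+%E) => //.
  by apply: measurable_funepos; exact: mH.
apply: (@measurable_fun_fubini_tonelli_F _ _ _ _ R m (EFin \o h)^\-%E) => //.
by apply: measurable_funeneg; exact: mH.
Qed.

(** The parameter space is arbitrary because the induction moves the first coordinate of the row
    over to the parameters; [s] is the corresponding reassociation of the product. *)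
Lemma measurable_iint n : forall d (P : measurableType d) (F : P -> 'rV[R]_n -> R),
  measurable_fun [set: P * chart R n] (fun z => F z.1 (emb n z.2)) ->
  measurable_fun [set: P] (fun p => iint (F p)).
Proof.
elim: n => [|n IH] d P F mF /=.
  exact: (measurableT_comp mF (pair2_measurable tt)).
apply: (@measurable_Rintegral_param _ _ _ _ (@lebesgue_measure R)
  (fun z => iint (fun y => F z.1 (vcons z.2 y)))).
apply: (IH _ _ (fun z y => F z.1 (vcons z.2 y))) => /=.
pose s (w : (P * measurableTypeR R) * chart R n) : P * chart R n.+1 :=
  (w.1.1, (w.1.2, w.2)).
have ms : measurable_fun setT s.
  apply/measurable_fun_pairP; split.
    exact: (measurableT_comp measurable_fst measurable_fst).
  apply/measurable_fun_pairP; split; last exact: measurable_snd.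
  exact: (measurableT_comp measurable_snd measurable_fst).
exact: (measurableT_comp mF ms).
Qed.

Lemma Rn_integrableE n (f : 'rV[R]_n -> R) : rV_measurable f ->
  Rn_integrable f <-> (vol n).-integrable setT (EFin \o (f \o emb n)).
Proof.
move=> mf.
have mnf : measurable_fun [set: chart R n]
    (fun z => (`|f (emb n z)|)%:E : \bar R).
  by apply/measurable_EFinP; exact: measurableT_comp.
rewrite /Rn_integrable iint_nnE //.
split => [h|/integrableP[_ //]]; apply/integrableP; split => //.
exact/measurable_EFinP.
Qed.

(** Fubini gives integrable slices only for almost every first coordinate. On the others the two
    sides may be unrelated default values, but these slices form a null set; measurability of [iint]
    in the parameter is what permits a comparison almost everywhere. *)
Lemma iintE n (f : 'rV[R]_n -> R) : rV_measurable f -> Rn_integrable f ->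
  iint f = \int[vol n]_z f (emb n z).
Proof.
elim: n f => [|n IH] f mf /(Rn_integrableE mf) fi /=.
  by rewrite /Rintegral integral_dirac// ?diracT ?mul1e//; exact/measurable_EFinP.
rewrite /Rintegral; congr fine.
rewrite -[RHS](integral12_prod_meas1 fi).
have mfx (x : R) : rV_measurable (fun y => f (vcons x y)).
  exact: (measurableT_comp mf (pair1_measurable x)).
apply: ae_eq_integral => //.
- apply/measurable_EFinP.
  exact: (measurable_iint (P := measurableTypeR R) (F := fun x y => f (vcons x y))).
- exact: measurable_fubini_F fi.
- have := ae_integrable1 fi; apply: filterS => x /= xi _.
  have fxi : Rn_integrable (fun y => f (vcons x y)) by apply/Rn_integrableE.
  rewrite IH // /Rintegral /fubini_F fineK //.
  exact: integrable_fin_num xi.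
Qed.

End chart_theory2.

Definition rV_L1 (R : realType) n (f : 'rV[R]_n -> R) : Prop :=
  (chart_measure (chart R n)).-integrable setT
    (EFin \o (f \o @chart_map _ _ (chart R n))).

Section iint_theory.
Variable R : realType.
Notation vol n := (chart_measure (chart R n)).
Notation emb n := (@chart_map _ _ (chart R n)).

Lemma rV_L1_measurable n (f : 'rV[R]_n -> R) : rV_L1 f -> rV_measurable f.
Proof. by move=> /integrableP[mf _]; exact/measurable_EFinP. Qed.

Lemma continuous_L1P n (f : 'rV[R]_n -> R) : continuous f ->
  Rn_integrable f <-> rV_L1 f.
Proof. by move=> fc; apply: Rn_integrableE; exact: continuous_rV_measurable. Qed.

Lemma rV_L1_integrable n (f : 'rV[R]_n -> R) : rV_L1 f -> Rn_integrable f.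
Proof. by move=> fi; apply/Rn_integrableE => //; exact: rV_L1_measurable. Qed.

Lemma iint_L1 n (f : 'rV[R]_n -> R) : rV_L1 f ->
  iint f = \int[vol n]_z f (emb n z).
Proof.
move=> fi; have mf := rV_L1_measurable fi.
by apply: iintE => //; apply/Rn_integrableE.
Qed.

Lemma rV_L1D n (f g : 'rV[R]_n -> R) : rV_L1 f -> rV_L1 g ->
  rV_L1 (fun x => f x + g x).
Proof. by move=> fi gi; exact: integrableD fi gi. Qed.

Lemma rV_L1Z n (f : 'rV[R]_n -> R) c : rV_L1 f -> rV_L1 (fun x => c * f x).
Proof. by move=> fi; exact: integrableZl fi. Qed.

Lemma rV_L1B n (f g : 'rV[R]_n -> R) : rV_L1 f -> rV_L1 g ->
  rV_L1 (fun x => f x - g x).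
Proof. by move=> fi gi; exact: integrableB fi gi. Qed.

Lemma rV_L1_sum n (I : eqType) (r : seq I) (f : I -> 'rV[R]_n -> R) :
  (forall i, i \in r -> rV_L1 (f i)) -> rV_L1 (fun x => \sum_(i <- r) f i x).
Proof.
elim: r => [|i r IH] fi.
  rewrite /rV_L1 (_ : EFin \o _ = cst 0%E).
    exact: integrable0.
  by apply/funext => x /=; rewrite big_nil.
rewrite (_ : (fun x => _) = fun x => f i x + \sum_(j <- r) f j x); last first.
  by apply/funext => x; rewrite big_cons.
apply: rV_L1D; first by apply: fi; rewrite mem_head.
by apply: IH => j jr; apply: fi; rewrite inE jr orbT.
Qed.

Lemma le_rV_L1 n (f g : 'rV[R]_n -> R) : rV_measurable f ->
  (forall x, `|f x| <= g x) -> rV_L1 g -> rV_L1 f.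
Proof.
move=> mf fg; apply: le_integrable => //; first exact/measurable_EFinP.
by move=> x _ /=; rewrite lee_fin (le_trans (fg _)) ?ler_norm.
Qed.

Lemma iintD n (f g : 'rV[R]_n -> R) : rV_L1 f -> rV_L1 g ->
  iint (fun x => f x + g x) = iint f + iint g.
Proof.
move=> fi gi; rewrite !iint_L1 //; last exact: rV_L1D.
by rewrite RintegralD.
Qed.

Lemma iintB n (f g : 'rV[R]_n -> R) : rV_L1 f -> rV_L1 g ->
  iint (fun x => f x - g x) = iint f - iint g.
Proof.
move=> fi gi; rewrite !iint_L1 //; last exact: rV_L1B.
by rewrite RintegralB.
Qed.

Lemma iintZ n (f : 'rV[R]_n -> R) c : rV_L1 f ->
  iint (fun x => c * f x) = c * iint f.
Proof.
move=> fi; rewrite !iint_L1 //; last exact: rV_L1Z.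
by rewrite RintegralZl.
Qed.

Lemma iint0 n : iint (fun _ : 'rV[R]_n => 0) = 0.
Proof.
elim: n => //= n IH; rewrite /Rintegral IH.
by rewrite integral0.
Qed.

Lemma iint_sum n (I : eqType) (r : seq I) (f : I -> 'rV[R]_n -> R) :
  (forall i, i \in r -> rV_L1 (f i)) ->
  iint (fun x => \sum_(i <- r) f i x) = \sum_(i <- r) iint (f i).
Proof.
elim: r => [|i r IH] fi.
  by rewrite big_nil -[RHS](iint0 n); congr iint; apply/funext => x; rewrite big_nil.
rewrite big_cons -IH => [|j jr]; last by apply: fi; rewrite inE jr orbT.
rewrite -iintD; first by congr iint; apply/funext => x; rewrite big_cons.
  by apply: fi; rewrite mem_head.
by apply: rV_L1_sum => j jr; apply: fi; rewrite inE jr orbT.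
Qed.

Lemma le_iint n (f g : 'rV[R]_n -> R) : rV_L1 f -> rV_L1 g ->
  (forall x, f x <= g x) -> iint f <= iint g.
Proof. by move=> fi gi fg; rewrite !iint_L1 //; exact: le_Rintegral. Qed.

Lemma iint_ge0 n (f : 'rV[R]_n -> R) : (forall x, 0 <= f x) -> 0 <= iint f.
Proof. by elim: n f => [|n IH] f f0 //=; apply: Rintegral_ge0 => x _; exact: IH. Qed.

Lemma normr_iint_le n (f g : 'rV[R]_n -> R) : rV_L1 f -> rV_L1 g ->
  (forall x, `|f x| <= g x) -> `|iint f| <= iint g.
Proof.
move=> fi gi fg; rewrite ler_norml -[X in X <= _ <= _]mulN1r -iintZ //.
by apply/andP; split; apply: le_iint; rewrite //; try exact: rV_L1Z;
  move=> x; have := fg x; rewrite ler_norml ?mulN1r => /andP[].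
Qed.

Lemma iint_dominated_cvg n (f_ : nat -> 'rV[R]_n -> R) (f g : 'rV[R]_n -> R) :
  (forall m, rV_measurable (f_ m)) -> rV_L1 g ->
  (forall m x, `|f_ m x| <= g x) ->
  (forall x, f_ ^~ x @ \oo --> f x) ->
  rV_L1 f /\ (fun m => iint (f_ m)) @ \oo --> iint f.
Proof.
move=> mf_ gi f_g f_f.
have mf : rV_measurable f.
  apply: (measurable_fun_cvg (h := fun m => f_ m \o emb n)) => // x _.
  exact: f_f.
have mF m : measurable_fun setT (EFin \o (f_ m \o emb n)).
  by apply/measurable_EFinP; exact: mf_.
have mFl : measurable_fun setT (EFin \o (f \o emb n)).
  by apply/measurable_EFinP; exact: mf.
have FF : {ae vol n, forall x, setT x ->
    (fun m => (EFin \o (f_ m \o emb n)) x) @ \oo --> (EFin \o (f \o emb n)) x}.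
  apply: aeW => x _ /=; apply: cvg_EFin; last exact: f_f.
  exact: nearW.
have Fg : {ae vol n, forall x m, setT x ->
    (`|(EFin \o (f_ m \o emb n)) x| <= (EFin \o (g \o emb n)) x)%E}.
  by apply: aeW => x m _ /=; rewrite lee_fin f_g.
have [fi _ c] := dominated_convergence measurableT mF mFl FF gi Fg.
split => //.
have f_i m : rV_L1 (f_ m) by apply: le_rV_L1 gi.
rewrite iint_L1 //.
have -> : (fun m => iint (f_ m)) = (fun m => \int[vol n]_z f_ m (emb n z)).
  by apply/funext => m; rewrite iint_L1.
apply: fine_cvg; rewrite fineK //.
exact: (integrable_fin_num measurableT fi).
Qed.

Lemma lebesgue_measure_shift (a : R) (A : set (measurableTypeR R)) : measurable A ->
  pushforward (@lebesgue_measure R) (+%R a : _ -> measurableTypeR R) A = lebesgue_measure A.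
Proof.
move=> mA; have ms : measurable_fun setT (+%R a : measurableTypeR R -> measurableTypeR R).
  by apply: measurable_funD => //; exact: measurable_cst.
apply/esym/lebesgue_measure_unique => //= _ [[b c]] _ <-.
rewrite /pushforward /=.
rewrite (_ : _ @^-1` _ = `]b - a, c - a]%classic).
  rewrite !lebesgue_measure_itv/= !lte_fin ltrD2r.
  by case: ifP => // _; rewrite -!EFinD; congr (_%:E); ring.
by apply/seteqP; split => x /=; rewrite !in_itv /= ltrBlDl lerBrDl.
Qed.

(** The change of variables is made on the positive and negative parts separately, where it needs
    measurability only; in several variables it can then be applied to every slice. *)
Lemma Rintegral_shift (G : R -> R) a : measurable_fun setT (G : measurableTypeR R -> _) ->
  \int[@lebesgue_measure R]_x G (a + x) = \int[@lebesgue_measure R]_x G x.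
Proof.
move=> mG; have mH : measurable_fun setT (EFin \o G : measurableTypeR R -> \bar R).
  exact/measurable_EFinP.
have ms : measurable_fun setT (+%R a : measurableTypeR R -> measurableTypeR R).
  by apply: measurable_funD => //; exact: measurable_cst.
rewrite /Rintegral; congr fine.
have key (h : measurableTypeR R -> \bar R) : measurable_fun setT h ->
    (forall x, 0 <= h x)%E ->
    (\int[@lebesgue_measure R]_x h (a + (x : R))%R = \int[@lebesgue_measure R]_x h x)%E.
  move=> mh h0.
  have := @ge0_integral_pushforward _ _ _ _ R _ ms (@lebesgue_measure R) setT h
    measurableT mh (fun x _ => h0 x).
  rewrite preimage_setT => /= <-.
  by apply: eq_measure_integral => //= A mA _; exact: lebesgue_measure_shift.
rewrite integralE [RHS]integralE; congr (_ - _)%E.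
  rewrite -(key (EFin \o G)^\+%E) //; last exact: measurable_funepos.
  by apply: eq_integral => x _; rewrite !funeposE.
rewrite -(key (EFin \o G)^\-%E) //; last exact: measurable_funeneg.
by apply: eq_integral => x _; rewrite !funenegE.
Qed.

Lemma vconsD n (x y : R) (u v : 'rV[R]_n) : vcons x u + vcons y v = vcons (x + y) (u + v).
Proof. by apply/rowP => j; rewrite !mxE; case: unliftP => [k|] _; rewrite ?mxE. Qed.

Lemma vcons_row n (v : 'rV[R]_n.+1) : v = vcons (v 0 0) (col' 0 v).
Proof. by apply/rowP => j; rewrite mxE; case: unliftP => [k ->|->]; rewrite ?mxE. Qed.

Lemma iint_shift n (f : 'rV[R]_n -> R) v : rV_measurable f ->
  iint (fun x => f (v + x)) = iint f.
Proof.
elim: n f v => [|n IH] f v mf /=; first by congr f; apply/rowP => -[].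
rewrite -[RHS](Rintegral_shift (v 0 0)).
  apply: eq_Rintegral => x _; rewrite -[RHS](IH _ (col' 0 v)).
    by congr iint; apply/funext => y; rewrite -vconsD -vcons_row.
  exact: (measurableT_comp mf (pair1_measurable (v 0 0 + x : measurableTypeR R))).
exact: (measurable_iint (P := measurableTypeR R) (F := fun x y => f (vcons x y))).
Qed.

Lemma iint_nn_iint n (f : 'rV[R]_n -> R) : rV_L1 f -> (forall x, 0 <= f x) ->
  iint_nn (fun x => (`|f x|)%:E) = (iint f)%:E.
Proof.
move=> fi f0; rewrite iint_L1 // iint_nnE //; last first.
  apply/measurable_EFinP; apply: measurableT_comp => //.
  exact: rV_L1_measurable.
rewrite /Rintegral fineK; last exact: (integrable_fin_num measurableT fi).
by apply: eq_integral => x _; rewrite ger0_norm.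
Qed.

(** Serves twice: Cauchy densities provide the integrable majorants of the whole development, and
    indicators of an interval give the volume of a cube. The two conclusions are proved together
    because the inductive step for integrability needs the value of the inner integral. *)
Lemma rV_L1_prod n (k : R -> R) : (forall x, 0 <= k x) ->
  (@lebesgue_measure R).-integrable setT (EFin \o k) ->
  rV_L1 (fun x : 'rV[R]_n => \prod_(i < n) k (x 0 i)) /\
  iint (fun x : 'rV[R]_n => \prod_(i < n) k (x 0 i)) =
    (\int[@lebesgue_measure R]_x k x) ^+ n.
Proof.
move=> k0 ki; have mk : measurable_fun setT (k : measurableTypeR R -> R).
  by move/integrableP : ki => [/measurable_EFinP].
elim: n => [|n [IH1 IH2]].
  split; last by rewrite expr0 /= big_ord0.
  rewrite /rV_L1 (_ : _ \o _ = cst 1%E).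
    apply/integrableP; split; first exact: measurable_cst.
    by rewrite integral_dirac// diracT mul1e gee0_abs// ltry.
  by apply/funext => x /=; rewrite big_ord0.
have E x (y : 'rV_n) : \prod_(i < n.+1) k (vcons x y 0 i) = k x * \prod_(i < n) k (y 0 i).
  rewrite big_ord_recl mxE unlift_none; congr (_ * _); apply: eq_bigr => i _.
  by rewrite mxE liftK.
have p0 m (x : 'rV_m) : 0 <= \prod_(i < m) k (x 0 i) by apply: prodr_ge0.
have mW m : rV_measurable (fun x : 'rV[R]_m => \prod_(i < m) k (x 0 i)).
  apply: measurable_prod => i _.
  exact: (measurableT_comp mk (measurable_chart_coord _)).
split; last first.
  rewrite /=; under eq_Rintegral => x _.
    rewrite (_ : iint _ = (\int[lebesgue_measure]_x k x) ^+ n * k x); last first.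
      by under eq_fun do rewrite E; rewrite iintZ // IH2 mulrC.
    over.
  by rewrite RintegralZl // exprSr.
apply/(Rn_integrableE (mW _)); rewrite /Rn_integrable /=.
under eq_integral => x _.
  rewrite (_ : iint_nn _ = ((\int[lebesgue_measure]_x k x) ^+ n * k x)%:E); last first.
    under eq_fun do rewrite E.
    rewrite iint_nn_iint; first by rewrite iintZ // IH2 mulrC.
      exact: rV_L1Z.
    by move=> y; rewrite mulr_ge0.
  over.
have := @integrableZl _ _ _ _ _ measurableT ((\int[lebesgue_measure]_x k x) ^+ n) _ ki.
move=> /integrableP[_]; apply: le_lt_trans; apply: ge0_le_integral => //.
- move=> x _; rewrite lee_fin mulr_ge0 // exprn_ge0 //.
  by apply: Rintegral_ge0 => y _.
- apply/measurable_EFinP; apply: measurable_funM => //; exact: measurable_cst.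
- apply: measurableT_comp => //; apply/measurable_EFinP.
  by apply: measurable_funM => //; exact: measurable_cst.
- by move=> x _ /=; rewrite lee_fin ler_norm.
Qed.

Lemma cauchy_weight_integrable :
  (@lebesgue_measure R).-integrable setT (EFin \o (fun x : R => (1 + x ^+ 2)^-1)).
Proof.
have mk : measurable_fun setT ((fun x => (1 + x ^+ 2)^-1) : measurableTypeR R -> R).
  by apply: continuous_measurable_fun; exact: continuous_oneDsqrV.
have k0 (x : R) : 0 <= (1 + x ^+ 2)^-1.
  by rewrite invr_ge0 addr_ge0 ?sqr_ge0.
apply/integrableP; split; first exact/measurable_EFinP.
apply/abse_integralP => //=; first exact/measurable_EFinP.
rewrite ge0_symfun_integralT //=; last 2 first.
- exact: continuous_oneDsqrV.
- by move=> x; rewrite /= sqrrN.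
rewrite (_ : [set x | _] = `[0, +oo[%classic); last first.
  by apply/seteqP; split => x/=; rewrite in_itv/= andbT.
by rewrite integral0y_oneDsqr -EFinM ltry.
Qed.

(** Near the origin [f] exceeds [f 0 / 2]. Balls of the norm in use are cubes, so half of [f 0]
    times the indicator of a small cube is a minorant with an explicit positive integral. *)
Lemma iint_gt0 n (f : 'rV[R]_n -> R) : continuous f -> rV_L1 f ->
  (forall x, 0 <= f x) -> 0 < f 0 -> 0 < iint f.
Proof.
move=> fc fi f0 f00.
have : \forall x \near (0 : 'rV[R]_n), f 0 / 2 < f x.
  have h : f 0 / 2 < f 0 by rewrite ltr_pdivrMr // ltr_pMr // ltr1n.
  by have /cvgr_gt := fc 0; apply.
move=> /nbhs_ballP[e /= e0 eP].
pose k : R -> R := \1_(`]-e, e[%classic).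
have k0 x : 0 <= k x by rewrite /k indicE ler0n.
have ki : (@lebesgue_measure R).-integrable setT (EFin \o k).
  exact: integrable_indic_itv.
have [W1 W2] := rV_L1_prod n k0 ki.
have kI : \int[@lebesgue_measure R]_x k x = 2 * e.
  rewrite /Rintegral /k integral_indic//. rewrite setIT.
  apply: (etrans (congr1 fine (@lebesgue_measure_itv R `]- e, e[))).
  rewrite /= lte_fin gtrN//.
  by rewrite -EFinD /=; ring.
apply: (@lt_le_trans _ _ (f 0 / 2 * (2 * e) ^+ n)).
  by rewrite mulr_gt0 ?divr_gt0 // exprn_gt0 // mulr_gt0.
rewrite -kI -W2 -iintZ //; apply: le_iint => // [|x]; first exact: rV_L1Z.
have [xe|xe] := pselect (forall i, `|x 0 i| < e).
  rewrite big1 ?mulr1 => [|i _].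
    apply/ltW/eP; rewrite -ball_normE /= sub0r normrN.
    rewrite /Num.norm /= mx_normrE; apply/bigmax_ltP; split => // -[i j] _ /=.
    by rewrite ord1.
  by rewrite /k indicE mem_set //= in_itv /= -ltr_norml.
have /existsNP[i xi] := xe.
rewrite (bigD1 i) //= /k indicE memNset ?mul0r ?mulr0 //=.
by rewrite /= in_itv /= -ltr_norml => /xi.
Qed.

End iint_theory.

(** * Decay, integrability and integration by parts *)

Section decay.
Variable R : realType.

Definition decays n (f : 'rV[R]_n -> R) :=
  forall k, exists C : R, forall x : 'rV[R]_n, `|x| ^+ k * `|f x| <= C.

(** A tensor product of Cauchy densities, up to a constant: an integrable majorant of whatever
    decays and, unlike a compactly supported one, comparable with its own translates. *)
Definition cauchy_weight n (x : 'rV[R]_n) : R := \prod_(i < n) (1 + x 0 i ^+ 2)^-1.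

Lemma rV_L1_cauchy_weight n : rV_L1 (@cauchy_weight n).
Proof.
by apply: (rV_L1_prod n _ (cauchy_weight_integrable R)).1 => x; rewrite invr_ge0 addr_ge0 ?sqr_ge0.
Qed.

Lemma coord_le_norm n (x : 'rV[R]_n) i : `|x 0 i| <= `|x|.
Proof.
rewrite [leRHS]/Num.norm /= mx_normrE.
exact: (le_bigmax _ (fun i : 'I_1 * 'I_n => `|x i.1 i.2|) (0, i)).
Qed.

Lemma cauchy_weight_gt0 n (x : 'rV[R]_n) : 0 < cauchy_weight x.
Proof. by apply: prodr_gt0 => i _; rewrite invr_gt0 ltr_pwDl ?sqr_ge0. Qed.

Lemma cauchy_weightV_le n (x : 'rV[R]_n) :
  (cauchy_weight x)^-1 <= 2 ^+ n * (1 + `|x| ^+ n.*2).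
Proof.
rewrite /cauchy_weight -prodfV.
apply: (@le_trans _ _ ((1 + `|x| ^+ 2) ^+ n)).
  rewrite (_ : _ ^+ n = \prod_(i < n) (1 + `|x| ^+ 2)); last first.
    by rewrite prodr_const card_ord.
  apply: ler_prod => i _.
  rewrite invrK addr_ge0 ?sqr_ge0 //= lerD2l -(real_normK (num_real _)).
  by rewrite lerXn2r ?nnegrE // coord_le_norm.
rewrite -mul2n exprM; set y := `|x| ^+ 2.
have y0 : 0 <= y by rewrite sqr_ge0.
have [y1|/ltW y1] := leP y 1.
  apply: (@le_trans _ _ (2 ^+ n)); last by rewrite ler_peMr ?exprn_ge0 // lerDl exprn_ge0.
  by rewrite lerXn2r ?nnegrE ?addr_ge0 // -[leRHS]/(1 + 1) lerD2l.
apply: (@le_trans _ _ ((2 * y) ^+ n)).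
  by rewrite lerXn2r ?nnegrE ?addr_ge0 ?mulr_ge0 // mulr_natl mulr2n lerD2r.
by rewrite exprMn ler_wpM2l ?exprn_ge0 // lerDr.
Qed.

(** Two orders of decay suffice, 0 and [2 n]: the inverse of the weight has degree 2 in each
    coordinate, hence is at most a multiple of [1 + |x|^(2n)]. *)
Lemma decays_cauchy n (f : 'rV[R]_n -> R) : decays f ->
  exists2 C, 0 <= C & forall x, `|f x| <= C * cauchy_weight x.
Proof.
move=> fd; have [C0 h0] := fd 0; have [C1 h1] := fd n.*2.
exists (2 ^+ n * (`|C0| + `|C1|)) => [|x].
  by rewrite mulr_ge0 ?exprn_ge0 ?addr_ge0.
rewrite -ler_pdivrMr ?cauchy_weight_gt0 // mulrC.
apply: (le_trans (ler_wpM2r _ (cauchy_weightV_le x))) => //.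
rewrite -mulrA ler_wpM2l ?exprn_ge0 // mulrDl mul1r lerD //.
  by apply: le_trans (ler_norm _); have := h0 x; rewrite expr0 mul1r.
exact: le_trans (h1 x) (ler_norm _).
Qed.

Lemma cauchy_bounded_L1 n (f : 'rV[R]_n -> R) C : continuous f ->
  (forall x, `|f x| <= C * cauchy_weight x) -> rV_L1 f.
Proof.
move=> fc fC; apply: le_rV_L1 fC _; first exact: continuous_rV_measurable.
exact/rV_L1Z/rV_L1_cauchy_weight.
Qed.

Lemma decays_L1 n (f : 'rV[R]_n -> R) : continuous f -> decays f -> rV_L1 f.
Proof. by move=> fc /decays_cauchy[C _ fC]; exact: cauchy_bounded_L1 fC. Qed.

Lemma decaysD n (f g : 'rV[R]_n -> R) : decays f -> decays g ->
  decays (fun x => f x + g x).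
Proof.
move=> fd gd k; have [C fC] := fd k; have [D gD] := gd k; exists (C + D) => x.
apply: le_trans (lerD (fC x) (gD x)); rewrite -mulrDr ler_wpM2l ?exprn_ge0 //.
exact: ler_normD.
Qed.

Lemma le_decays n (f g : 'rV[R]_n -> R) c k : decays g ->
  (forall x, `|f x| <= c * (1 + `|x| ^+ k) * `|g x|) -> decays f.
Proof.
move=> gd fg m; have [C gC] := gd m; have [D gD] := gd (m + k)%N.
exists (`|c| * (C + D)) => x.
apply: (@le_trans _ _ (`|c| * (`|x| ^+ m * `|g x| + `|x| ^+ (m + k) * `|g x|))).
  rewrite exprD -mulrA -mulrDr mulrCA ler_wpM2l ?exprn_ge0 //.
  apply: (le_trans (fg x)); rewrite [leRHS](_ : _ = `|c| * (1 + `|x| ^+ k) * `|g x|); last by ring.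
  apply: ler_wpM2r => //; apply: ler_wpM2r; last exact: ler_norm.
  by rewrite addr_ge0 ?exprn_ge0.
by rewrite ler_wpM2l // lerD.
Qed.

Lemma is_derive_line n (F : 'rV[R]_n -> R) (x v : 'rV[R]_n) (s : R) :
  derivable F (x + s *: v) v ->
  is_derive s 1 (fun t : R => F (x + t *: v)) ('D_v F (x + s *: v)).
Proof.
move=> dF; have E : (fun h : R => h^-1 *: (((fun t : R => F (x + t *: v)) \o shift s) (h *: 1)
    - F (x + s *: v))) =
  (fun h : R => h^-1 *: ((F \o shift (x + s *: v)) (h *: v) - F (x + s *: v))).
  apply/funext => h /=; congr (_ *: (F _ - _)).
  by rewrite [h *: 1]mulr1 scalerDl addrCA addrC -addrA addrC -!addrA.
by apply: DeriveDef; rewrite /derivable /derive ?E.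
Qed.

Lemma line_MVT n (F : 'rV[R]_n -> R) (x v : 'rV[R]_n) (h : R) : 0 < h ->
  (forall y, derivable F y v) ->
  exists2 s, 0 <= s <= h & F (x + h *: v) - F x = h * 'D_v F (x + s *: v).
Proof.
move=> h0 dF.
have D (s : R) : is_derive s 1 (fun t : R => F (x + t *: v)) ('D_v F (x + s *: v)).
  exact/is_derive_line.
have c : {within `[0, h], continuous (fun t : R => F (x + t *: v))}.
  apply: continuous_subspaceT => s; apply: differentiable_continuous.
  by apply/derivable1_diffP; have [] := D s.
have [s si E] := MVT_segment (ltW h0) (fun s _ => D s) c.
exists s; first by move: si; rewrite in_itv.
by move: E; rewrite scale0r addr0 subr0 mulrC.
Qed.

(** In the coordinate that moves, [t^2 <= 2 (t + s)^2 + 2 s^2]. Stability under translations of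
    length at most 1 lets one function dominate all the difference quotients of a decaying
    function. *)
Lemma cauchy_weight_shift n (x : 'rV[R]_n) i s : 0 <= s <= 1 ->
  cauchy_weight (x + s *: delta_mx 0 i) <= 3 * cauchy_weight x.
Proof.
move=> /andP[s0 s1]; rewrite /cauchy_weight (bigD1 i) //= [in leRHS](bigD1 i) //=.
rewrite !mxE !eqxx mulr1 mulrA; under eq_bigr => j ji do
  rewrite !mxE eqxx /= (negbTE ji) mulr0 addr0.
apply: ler_wpM2r.
  by apply: prodr_ge0 => j _; rewrite invr_ge0 addr_ge0 ?sqr_ge0.
set t := x 0 i; have p (u : R) : 0 < 1 + u ^+ 2 by rewrite ltr_pwDl ?sqr_ge0.
rewrite -[leLHS]mul1r ler_pdivrMr // mulrAC ler_pdivlMr // mul1r.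
have := sqr_ge0 (t + 2 * s); have := sqr_ge0 (t + s).
have : s ^+ 2 <= 1 by rewrite expr_le1.
by clearbody t; clear -s; nra.
Qed.

(** By translation invariance every difference quotient has integral zero, and by the mean value
    theorem it is bounded by a nearby value of the decaying derivative; dominated convergence passes
    to the derivative. The direction [i] thus never has to be singled out among the iterated
    integrals. *)
Lemma iint_partial_eq0 n (i : 'I_n) (F : 'rV[R]_n -> R) :
  continuous F -> (forall x, derivable F x (delta_mx 0 i)) -> decays F ->
  decays (partial i F) -> iint (partial i F) = 0.
Proof.
move=> Fc dF Fd /decays_cauchy[C C0 PC].
set v : 'rV[R]_n := delta_mx 0 i.
pose h (m : nat) : R := m.+1%:R^-1.
have h0 m : 0 < h m by rewrite invr_gt0 ltr0n.
have h1 m : h m <= 1 by rewrite invf_le1 ?ltr0n // ler1n.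
pose f_ m x := (h m)^-1 * (F (h m *: v + x) - F x).
have Fi : rV_L1 F by exact: decays_L1.
have Fsc m : continuous (fun x => F (h m *: v + x)).
  move=> x; apply: continuous_comp; last exact: Fc.
  by apply: continuousD; [exact: cst_continuous|exact: cvg_id].
have Fsi m : rV_L1 (fun x => F (h m *: v + x)).
  have [D D0 FD] := decays_cauchy Fd.
  apply: (@cauchy_bounded_L1 _ _ (D * 3)) => // x.
  apply: (le_trans (FD _)); rewrite -mulrA ler_wpM2l // addrC.
  by apply: cauchy_weight_shift; rewrite h1 ltW.
have I0 m : iint (f_ m) = 0.
  rewrite iintZ; last exact: rV_L1B.
  by rewrite iintB // iint_shift ?subrr ?mulr0 //; exact: continuous_rV_measurable.
have [||||_ c] := @iint_dominated_cvg R n f_ (partial i F) (fun x => C * 3 * cauchy_weight x).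
- move=> m; apply: continuous_rV_measurable => x.
  exact: (continuousM (@cst_continuous _ _ _ x) (continuousB (@Fsc m x) (@Fc x))).
- exact/rV_L1Z/rV_L1_cauchy_weight.
- move=> m x; have [s /andP[s0 sh] E] := line_MVT x (h0 m) dF.
  rewrite /f_ [h m *: v + x]addrC E mulKf ?gt_eqF // -/(partial i F _).
  apply: (le_trans (PC _)); rewrite -mulrA ler_wpM2l //.
  by apply: cauchy_weight_shift; rewrite s0 (le_trans sh).
- move=> x; have /cvg_dnbhs_at_right/cvg_at_rightP := dF x; apply.
  by split; [exact: h0|exact: cvg_harmonic].
have : (fun m => iint (f_ m)) @ \oo --> (0 : R).
  by under eq_fun do rewrite I0; exact: cvg_cst.
by move=> c'; exact: (cvg_unique _ c c').
Qed.
End decay.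

(** * Smooth functions *)

Section smooth_theory.
Variables (R : realType) (n : nat).
Implicit Types (f g h : 'rV[R]_n -> R) (i j k : 'I_n).

Definition diffable f := forall x, differentiable f x.

Lemma diffable_continuous f : diffable f -> continuous f.
Proof. by move=> df x; exact: differentiable_continuous. Qed.

Lemma diffable_derivable f x v : diffable f -> derivable f x v.
Proof. by move=> df; exact: diff_derivable. Qed.

Lemma diffable_cst c : diffable (fun _ => c).
Proof. by move=> x; exact: differentiable_cst. Qed.

Lemma diffableD f g : diffable f -> diffable g -> diffable (fun x => f x + g x).
Proof. by move=> df dg x; exact: differentiableD. Qed.

Lemma diffableM f g : diffable f -> diffable g -> diffable (fun x => f x * g x).
Proof. by move=> df dg x; exact: differentiableM. Qed.

Lemma partial_cst i c : partial i (fun _ : 'rV[R]_n => c) = fun _ => 0.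
Proof. by apply/funext => x; exact: derive_cst. Qed.

Lemma partialD i f g : diffable f -> diffable g ->
  partial i (fun x => f x + g x) = fun x => partial i f x + partial i g x.
Proof.
by move=> df dg; apply/funext => x; apply: deriveD; exact: diffable_derivable.
Qed.

Lemma partialM i f g : diffable f -> diffable g ->
  partial i (fun x => f x * g x) = fun x => f x * partial i g x + g x * partial i f x.
Proof.
by move=> df dg; apply/funext => x; apply: deriveM; exact: diffable_derivable.
Qed.

Lemma partialZ i c f : diffable f ->
  partial i (fun x => c * f x) = fun x => c * partial i f x.
Proof.
move=> df; rewrite (partialM i (diffable_cst c) df).
by rewrite partial_cst; apply/funext => x; rewrite mulr0 addr0.
Qed.

Lemma partialV i f : diffable f -> (forall x, f x != 0) ->
  partial i (fun x => (f x)^-1) = fun x => - (f x)^-1 * (f x)^-1 * partial i f x.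
Proof.
move=> df f0; apply/funext => x; rewrite /partial deriveV //; last exact: diffable_derivable.
by rewrite (mulNr (f x)^-1) -invfM -expr2.
Qed.

Lemma diffableV f : diffable f -> (forall x, f x != 0) -> diffable (fun x => (f x)^-1).
Proof. by move=> df f0 x; exact: differentiableV. Qed.

Lemma diffable_comp (phi : R -> R) f : diffable f ->
  (forall x, derivable phi (f x) 1) -> diffable (fun x => phi (f x)).
Proof.
move=> df dphi x; apply: differentiable_comp => //.
exact/derivable1_diffP.
Qed.

Lemma partial_comp i (phi : R -> R) f : diffable f ->
  (forall x, derivable phi (f x) 1) ->
  partial i (fun x => phi (f x)) = fun x => derive1 phi (f x) * partial i f x.
Proof.
move=> df dphi; apply/funext => x; rewrite /partial.
rewrite (@deriveE _ _ _ (fun x => phi (f x))); last exact: diffable_comp.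
rewrite (@diff_comp _ _ _ _ f phi) //; last exact/derivable1_diffP.
rewrite /= deriveE // deriv1E //.
by rewrite mulrC.
Qed.

Lemma diffable_coord i : diffable (fun x : 'rV[R]_n => x 0 i).
Proof. by move=> x; exact: differentiable_coord. Qed.

Lemma partial_coord i j : partial i (fun x : 'rV[R]_n => x 0 j) = fun _ => (i == j)%:R.
Proof.
apply/funext => x; rewrite /partial /derive.
have E (h : R) : h != 0 -> h^-1 *: (((fun x : 'rV[R]_n => x 0 j) \o shift x) (h *: delta_mx 0 i) - x 0 j)
   = (i == j)%:R.
  move=> h0; rewrite /= !mxE eqxx /= addrK eq_sym.
  by rewrite /GRing.scale /= mulrA mulVf // mul1r.
apply: (@lim_near_cst _ _ _ _ _ _ _ _); first by [].
by near=> h; apply: E; near: h; exact: nbhs_dnbhs_neq.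
Unshelve. all: by end_near. Qed.

Lemma smooth_diffable f : smooth f -> diffable f.
Proof. by move=> sf x; exact: (sf [::] x). Qed.

Lemma smooth_continuous f : smooth f -> continuous f.
Proof. by move=> /smooth_diffable/diffable_continuous. Qed.

Lemma dparts_cat s t f : dparts (s ++ t) f = dparts s (dparts t f).
Proof. by rewrite /dparts foldr_cat. Qed.

Lemma smooth_dparts s f : smooth f -> smooth (dparts s f).
Proof. by move=> sf t x; rewrite -dparts_cat; exact: sf. Qed.

Lemma smooth_partial i f : smooth f -> smooth (partial i f).
Proof. exact: (@smooth_dparts [:: i]). Qed.

Lemma smooth_partials f : diffable f -> (forall i, smooth (partial i f)) -> smooth f.
Proof.
move=> df sp s x; case/lastP: s => [|s i]; first exact: df.
by rewrite -cats1 dparts_cat; exact: sp.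
Qed.

Lemma dparts_class (C : ('rV[R]_n -> R) -> Prop) :
  (forall h, C h -> forall i, C (partial i h)) ->
  forall h, C h -> forall s, C (dparts s h).
Proof. by move=> Cp h Ch; elim => [|i s IH] //=; exact: Cp. Qed.

Lemma smooth_class (C : ('rV[R]_n -> R) -> Prop) :
  (forall h, C h -> diffable h) -> (forall h, C h -> forall i, C (partial i h)) ->
  forall h, C h -> smooth h.
Proof. by move=> Cd Cp h Ch s x; apply: Cd; exact: dparts_class. Qed.

(** The algebra of functions generated by [B]. If the generators are differentiable with partial
    derivatives in the algebra, all its members are smooth, and bounds on the generators spread to
    the algebra in the same way. Many proofs of smoothness, growth and boundedness reduce to a
    choice of [B]. *)
Inductive gen (B : ('rV[R]_n -> R) -> Prop) : ('rV[R]_n -> R) -> Prop :=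
| gen_base b : B b -> gen B b
| gen_cst c : gen B (fun _ => c)
| genD f g : gen B f -> gen B g -> gen B (fun x => f x + g x)
| genM f g : gen B f -> gen B g -> gen B (fun x => f x * g x).

Lemma genN B f : gen B f -> gen B (fun x => - f x).
Proof.
move=> gf; rewrite (_ : (fun x => _) = fun x => -1 * f x).
  by apply: genM => //; exact: gen_cst.
by apply/funext => x; rewrite mulN1r.
Qed.

Lemma gen_sum B (I : Type) (r : seq I) (F : I -> 'rV[R]_n -> R) :
  (forall a, gen B (F a)) -> gen B (fun x => \sum_(a <- r) F a x).
Proof.
move=> gF; elim: r => [|a r IH].
  by under eq_fun do rewrite big_nil; exact: gen_cst.
by under eq_fun do rewrite big_cons; exact: genD.
Qed.

Lemma genX B f m : gen B f -> gen B (fun x => f x ^+ m).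
Proof.
move=> gf; elim: m => [|m IH].
  by under eq_fun do rewrite expr0; exact: gen_cst.
by under eq_fun do rewrite exprS; exact: genM.
Qed.

Lemma gen_sub (B B' : ('rV[R]_n -> R) -> Prop) h :
  (forall b, B b -> gen B' b) -> gen B h -> gen B' h.
Proof.
by move=> BB'; elim => [b /BB'//|c|f g _ ? _ ?|f g _ ? _ ?];
  [exact: gen_cst|exact: genD|exact: genM].
Qed.

Section gen_closed.
Variable B : ('rV[R]_n -> R) -> Prop.
Hypothesis Bd : forall b, B b -> diffable b.
Hypothesis Bp : forall b, B b -> forall i, gen B (partial i b).

Lemma gen_diffable h : gen B h -> diffable h.
Proof.
elim => [b /Bd//|c|f g _ df _ dg|f g _ df _ dg].
- exact: diffable_cst.
- exact: diffableD.
- exact: diffableM.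
Qed.

Lemma gen_partial h : gen B h -> forall i, gen B (partial i h).
Proof.
elim => [b Bb i|c i|f g gf IHf gg IHg i|f g gf IHf gg IHg i].
- exact: Bp.
- by rewrite partial_cst; exact: gen_cst.
- by rewrite partialD; [exact: genD|exact: gen_diffable..].
- by rewrite partialM; [apply: genD; exact: genM|exact: gen_diffable..].
Qed.

Lemma gen_closed_smooth h : gen B h -> smooth h.
Proof. by apply: smooth_class; [exact: gen_diffable|exact: gen_partial]. Qed.
End gen_closed.

Lemma gen_smooth h : gen (@smooth R n) h -> smooth h.
Proof.
apply: gen_closed_smooth => b sb; first exact: smooth_diffable.
by move=> i; apply: gen_base; exact: smooth_partial.
Qed.

Lemma smooth_cst c : smooth (fun _ : 'rV[R]_n => c).
Proof. by apply: gen_smooth; exact: gen_cst. Qed.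

Lemma smoothD f g : smooth f -> smooth g -> smooth (fun x => f x + g x).
Proof. by move=> sf sg; apply: gen_smooth; apply: genD; exact: gen_base. Qed.

Lemma smoothM f g : smooth f -> smooth g -> smooth (fun x => f x * g x).
Proof. by move=> sf sg; apply: gen_smooth; apply: genM; exact: gen_base. Qed.

(** Iterated derivatives of a composite bring in those of the outer function, hence a class [P] of
    outer functions closed under derivation. The generators are the smooth functions together with
    the composites by members of [P]. *)
Lemma smooth_comp (P : (R -> R) -> Prop) f :
  (forall phi, P phi -> forall x, derivable phi (f x) 1) ->
  (forall phi, P phi -> P (derive1 phi)) -> smooth f ->
  forall phi, P phi -> smooth (fun x => phi (f x)).
Proof.
move=> Pd Pp sf phi Pphi.
pose B h := smooth h \/ exists2 psi, P psi & h = (fun x => psi (f x)).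
apply: (@gen_closed_smooth B); last by apply: gen_base; right; exists phi.
  move=> b [/smooth_diffable//|[psi Ppsi ->]].
  by apply: diffable_comp; [exact: smooth_diffable|exact: Pd].
move=> b [sb|[psi Ppsi ->]] i; first by apply: gen_base; left; exact: smooth_partial.
rewrite partial_comp; [|exact: smooth_diffable|exact: Pd].
apply: genM; first by apply: gen_base; right; exists (derive1 psi) => //; exact: Pp.
by apply: gen_base; left; exact: smooth_partial.
Qed.

Lemma smooth_expR f : smooth f -> smooth (fun x => expR (f x)).
Proof.
move=> sf; apply: (@smooth_comp (fun phi => phi = @expR R)) => // phi ->.
  by move=> x; exact: derivable_expR.
by apply/funext => x; rewrite derive1E; exact: derive_val.
Qed.

Lemma smoothV f : smooth f -> (forall x, f x != 0) -> smooth (fun x => (f x)^-1).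
Proof.
move=> sf f0.
pose B h := smooth h \/ h = (fun x => (f x)^-1).
apply: (@gen_closed_smooth B); last by apply: gen_base; right.
  by move=> b [/smooth_diffable//|->]; apply: diffableV => //; exact: smooth_diffable.
move=> b [sb|->] i; first by apply: gen_base; left; exact: smooth_partial.
rewrite partialV //; last exact: smooth_diffable.
apply: genM; last by apply: gen_base; left; exact: smooth_partial.
by apply: genM; [apply: genN|]; apply: gen_base; right.
Qed.

Lemma derivable_ln_pos (x : R) : 0 < x -> derivable (@ln R) x 1.
Proof. by move=> x0; have [] := is_derive1_ln x0. Qed.

Lemma partial_ln i f : diffable f -> (forall x, 0 < f x) ->
  partial i (fun x => ln (f x)) = fun x => (f x)^-1 * partial i f x.
Proof.
move=> df f0; rewrite partial_comp //; last by move=> x; exact: derivable_ln_pos.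
apply/funext => x; congr (_ * _); rewrite derive1E.
by have [_ ->] := is_derive1_ln (f0 x).
Qed.

Lemma smooth_ln f : smooth f -> (forall x, 0 < f x) -> smooth (fun x => ln (f x)).
Proof.
move=> sf f0; apply: smooth_partials.
  apply: diffable_comp; first exact: smooth_diffable.
  by move=> x; exact: derivable_ln_pos.
move=> i; rewrite partial_ln //; last exact: smooth_diffable.
apply: smoothM; last exact: smooth_partial.
by apply: smoothV => // x; rewrite gt_eqF.
Qed.

End smooth_theory.

(** * Symmetry of mixed partial derivatives *)

Section schwarz.
Variables (R : realType) (n : nat).
Implicit Types (f g h : 'rV[R]_n -> R) (i j k : 'I_n).

Lemma diffable_shift f c : diffable f -> diffable (fun x => f (x + c)).
Proof.
move=> df x; apply: (@differentiable_comp _ _ _ _ (fun x => x + c) f).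
  by apply: differentiableD.
exact: df.
Qed.

Lemma partial_shift i f c : partial i (fun x => f (x + c)) = fun x => partial i f (x + c).
Proof.
apply/funext => x; rewrite /partial /derive.
by under eq_fun do rewrite /= -addrA.
Qed.

Lemma partial_scale i f (a : R) : diffable f ->
  partial i (fun x => f (a *: x)) = fun x => a * partial i f (a *: x).
Proof.
move=> df; apply/funext => x; rewrite /partial.
have da : differentiable (fun x : 'rV[R]_n => a *: x) x by exact: differentiableZ.
have dfa : differentiable f (a *: x) by exact: df.
rewrite (@deriveE _ _ _ (fun x => f (a *: x))); last exact: differentiable_comp.
rewrite (@diff_comp _ _ _ _ (fun x : 'rV[R]_n => a *: x) f) //= deriveE //.
rewrite (_ : 'd (fun x : 'rV[R]_n => a *: x) x (delta_mx 0 i) = a *: delta_mx 0 i).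
  by rewrite linearZ.
rewrite -deriveE //.
by have := @deriveZ _ _ _ (@id 'rV[R]_n) a x (delta_mx 0 i) (@derivable_id _ _ x _); rewrite derive_id.
Qed.

Lemma partial_eq0_open (U : set 'rV[R]_n) (h : 'rV[R]_n -> R) i : open U ->
  (forall x, U x -> h x = 0) -> forall x, U x -> partial i h x = 0.
Proof.
move=> oU hU x Ux; rewrite /partial -[RHS](@derive_cst _ 'rV[R]_n _ 0 x (delta_mx 0 i)).
apply: near_eq_derive; have : \forall y \near x, U y by exact: open_nbhs_nbhs.
by apply: filterS => y /hU.
Qed.

(** Two mean values in succession: along [i] for the increment of [f] in the direction [j], then
    along [j] for [partial i f]. The second difference is symmetric in the two directions while the
    expression found for it is not. *)
Lemma double_MVT f i j x (h : R) : smooth f -> 0 < h ->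
  exists p, `|p - x| <= 2 * h /\
   f (x + h *: delta_mx 0 i + h *: delta_mx 0 j) - f (x + h *: delta_mx 0 i)
   - (f (x + h *: delta_mx 0 j) - f x) = h * (h * partial j (partial i f) p).
Proof.
move=> sf h0; have df := smooth_diffable sf.
set v : 'rV[R]_n := delta_mx 0 i; set w : 'rV[R]_n := delta_mx 0 j.
pose F y := f (y + h *: w) + (-1) * f y.
have dF : diffable F.
  by apply: diffableD; [exact: diffable_shift|apply: diffableM => //; exact: diffable_cst].
have pF : partial i F = fun y => partial i f (y + h *: w) + (-1) * partial i f y.
  rewrite partialD; [|exact: diffable_shift|apply: diffableM => //; exact: diffable_cst].
  by rewrite partial_shift partialZ.
have [s /andP[s0 sh] E1] := line_MVT x h0 (fun y => @diffable_derivable _ _ _ y v dF).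
have dif := smooth_diffable (smooth_partial i sf).
have [t /andP[t0 th] E2] := line_MVT (x + s *: v) h0 (fun y => @diffable_derivable _ _ _ y w dif).
exists (x + s *: v + t *: w); split.
  rewrite addrC -addrA addKr addrC.
  apply: (le_trans (ler_normD _ _)); rewrite !normrZ !ger0_norm //.
  have d1 k : `|delta_mx 0 k : 'rV[R]_n| <= 1.
    rewrite [leLHS]/Num.norm /= mx_normrE; apply/bigmax_leP; split => // -[a b] _ /=.
    by rewrite mxE; case: (_ && _); rewrite ?normr0 ?normr1.
  rewrite mulr_natl mulr2n; apply: lerD.
    by rewrite (le_trans (ler_wpM2l t0 (d1 j))) // mulr1.
  by rewrite (le_trans (ler_wpM2l s0 (d1 i))) // mulr1.
rewrite -[RHS]/(h * (h * 'D_w (partial i f) (x + s *: v + t *: w))) -E2.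
move: E1; rewrite -/(partial i F _) pF /F => E1.
by rewrite -[- partial i f _]mulN1r -E1 !mulN1r.
Qed.

Lemma mid_point_lt (a b c : R) : `|a - c| < `|a - b| / 2 -> `|b - c| < `|a - b| / 2 -> False.
Proof.
move=> h1 h2; have := ltrD h1 h2; rewrite -splitr [X in _ + X]distrC => h.
by have := le_lt_trans (ler_distD c a b) h; rewrite ltxx.
Qed.

Local Opaque partial.
(** For either order of the directions the same second difference is [h ^+ 2] times a mixed
    derivative at a point near [x]. The two mixed derivatives thus share a value at points
    arbitrarily close to [x], and continuity excludes a discrepancy at [x]. *)
Lemma partialC f i j x : smooth f ->
  partial i (partial j f) x = partial j (partial i f) x.
Proof.
move=> sf; apply/eqP; rewrite -subr_eq0; apply/negPn/negP => ne.
set d := partial i (partial j f) x - partial j (partial i f) x in ne.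
have d0 : 0 < `|d| / 2 by rewrite divr_gt0 // normr_gt0.
have c1 := @smooth_continuous _ _ _ (smooth_partial i (smooth_partial j sf)) x.
have c2 := @smooth_continuous _ _ _ (smooth_partial j (smooth_partial i sf)) x.
have /cvgrPdist_lt/(_ _ d0)/nbhs_ballP[e1 /= e10 P1] := c1.
have /cvgrPdist_lt/(_ _ d0)/nbhs_ballP[e2 /= e20 P2] := c2.
pose h := Num.min e1 e2 / 3.
have m0 : 0 < Num.min e1 e2 by rewrite lt_min e10 e20.
have h0 : 0 < h by rewrite divr_gt0.
have h2 : 2 * h < Num.min e1 e2 by rewrite /h; move: (Num.min e1 e2) m0 => m m0; clear -m0; lra.
have [p [px E1]] := double_MVT i j x sf h0.
have [q [qx E2]] := double_MVT j i x sf h0.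
have E : partial j (partial i f) p = partial i (partial j f) q.
  have hn : h != 0 by rewrite gt_eqF.
  apply: (mulfI hn); apply: (mulfI hn).
  apply: etrans (esym E1) _; apply: etrans _ E2.
  rewrite [x + _ + h *: delta_mx 0 j]addrAC.
  by move: (f _) (f _) (f _) (f _) => a b c e; clear; ring.
have B y e : `|y - x| <= 2 * h -> Num.min e1 e2 <= e -> ball x e y.
  move=> yx me; rewrite -ball_normE /= distrC; apply: (le_lt_trans yx).
  exact: lt_le_trans h2 me.
have me1 : Num.min e1 e2 <= e1 by clear; rewrite ge_min lexx.
have me2 : Num.min e1 e2 <= e2 by clear; rewrite ge_min lexx orbT.
have bq : ball x e1 q := B _ _ qx me1.
have bp : ball x e2 p := B _ _ px me2.
clear E1 E2.
have b1 : `|partial i (partial j f) x - partial i (partial j f) q| < `|d| / 2 := P1 _ bq.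
have b2 : `|partial j (partial i f) x - partial j (partial i f) p| < `|d| / 2 := P2 _ bp.
apply: (mid_point_lt b1).
exact: (eq_ind _ (fun z => `|partial j (partial i f) x - z| < _) b2 _ E).
Qed.
End schwarz.

(** * Logarithmic jets *)

Local Opaque partial.
Section jets.
Variables (R : realType) (n : nat).
Implicit Types (p : 'I_n -> R) (q H : 'I_n -> 'I_n -> R) (r K : 'I_n -> 'I_n -> 'I_n -> R).

(** When [a], [p], [q], [r] are the value, gradient, Hessian and third derivatives of a positive
    function at a point, [hess_jet] and [grad_hess_jet] are the entries of minus the Hessian of its
    logarithm and of the gradient of that matrix. Identities and bounds between such entries become
    statements about rational functions of numbers. *)
Definition hess_jet (a : R) p q i j : R := - (a^-1 * q i j - a^-1 * a^-1 * (p i * p j)).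

Definition grad_hess_jet (a : R) p q r i j k : R :=
  - (a^-1 * r i j k - a^-1 * a^-1 * (q i j * p k + q k i * p j + q k j * p i)
     + 2 * (a^-1 * a^-1 * a^-1 * (p i * p j * p k))).

Definition I_of (H : 'I_n -> 'I_n -> R) (a : R) : R := (\sum_i H i i) * a.
Definition Q_of (H : 'I_n -> 'I_n -> R) (a : R) : R := (\sum_i \sum_j H i j * H j i) * a.
Definition D_of H (K : 'I_n -> 'I_n -> 'I_n -> R) (a : R) : R :=
  (\sum_i \sum_j \sum_k K i j k ^+ 2
   + 2 * \sum_i \sum_j \sum_k H i j * H j k * H k i) * a.

Implicit Types (f g : 'rV[R]_n -> R) (i j k : 'I_n).

Definition hess f x i j : R := Hf f x i j.
Definition grad_hess f x i j k : R := partial k (fun y => Hf f y i j) x.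

Lemma I_integrandE f x : I_integrand f x = I_of (hess f x) (f x).
Proof. by []. Qed.

Lemma Q_integrandE f x : Q_integrand f x = Q_of (hess f x) (f x).
Proof.
by rewrite /Q_integrand /Q_of; congr (_ * _); apply: eq_bigr => i _; rewrite mxE.
Qed.

Lemma D_integrandE f x : D_integrand f x = D_of (hess f x) (grad_hess f x) (f x).
Proof.
rewrite /D_integrand /D_of; congr ((_ + 2 * _) * _).
apply: eq_bigr => i _; rewrite mxE.
under eq_bigr => j _ do rewrite mxE big_distrl /=.
by rewrite exchange_big.
Qed.

Section positive.
Variable f : 'rV[R]_n -> R.
Hypotheses (sf : smooth f) (f0 : forall x, 0 < f x).

Lemma hess_lnE i j : (fun x => hess f x i j) =
  fun x => -1 * partial i (partial j (fun y => ln (f y))) x.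
Proof. by apply/funext => x; rewrite /hess mxE mulN1r. Qed.

Lemma smooth_hess i j : smooth (fun x => hess f x i j).
Proof.
rewrite hess_lnE; apply: smoothM; first exact: smooth_cst.
by apply: smooth_partial; apply: smooth_partial; exact: smooth_ln.
Qed.

Lemma smooth_grad_hess i j k : smooth (fun x => grad_hess f x i j k).
Proof. exact: (smooth_partial k (smooth_hess i j)). Qed.

Lemma hess_sym x i j : hess f x i j = hess f x j i.
Proof.
have /(congr1 (@^~ x)) /= -> := hess_lnE i j.
have /(congr1 (@^~ x)) /= -> := hess_lnE j i.
by rewrite partialC //; exact: smooth_ln.
Qed.

Lemma smooth_I_integrand : smooth (I_integrand f).
Proof.
rewrite (_ : I_integrand f = fun x => (\sum_i hess f x i i) * f x) //.
apply: gen_smooth; apply: genM; last exact: gen_base.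
by apply: gen_sum => i; apply: gen_base; exact: smooth_hess.
Qed.

Lemma smooth_Q_integrand : smooth (Q_integrand f).
Proof.
rewrite (_ : Q_integrand f = fun x => (\sum_i \sum_j hess f x i j * hess f x j i) * f x).
  apply: gen_smooth; apply: genM; last exact: gen_base.
  apply: gen_sum => i; apply: gen_sum => j.
  by apply: genM; apply: gen_base; exact: smooth_hess.
by apply/funext => x; exact: Q_integrandE.
Qed.

Lemma smooth_D_integrand : smooth (D_integrand f).
Proof.
rewrite (_ : D_integrand f = fun x => (\sum_i \sum_j \sum_k grad_hess f x i j k ^+ 2
   + 2 * \sum_i \sum_j \sum_k hess f x i j * hess f x j k * hess f x k i) * f x).
  apply: gen_smooth; apply: genM; last exact: gen_base.
  apply: genD.
    apply: gen_sum => i; apply: gen_sum => j; apply: gen_sum => k.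
    by apply: genX; apply: gen_base; exact: smooth_grad_hess.
  apply: genM; first exact: gen_cst.
  apply: gen_sum => i; apply: gen_sum => j; apply: gen_sum => k.
  by apply: genM; [apply: genM|]; apply: gen_base; exact: smooth_hess.
by apply/funext => x; exact: D_integrandE.
Qed.

Let fn0 x : f x != 0. Proof. by rewrite gt_eqF. Qed.
Let df := smooth_diffable sf.
Let dp i := smooth_diffable (smooth_partial i sf).
Let dpp i j := smooth_diffable (smooth_partial i (smooth_partial j sf)).
Let dV := diffableV df fn0.

Lemma hess_jetE i j : (fun x => hess f x i j) =
  fun x => hess_jet (f x) (fun i => partial i f x)
    (fun i j => partial i (partial j f) x) i j.
Proof.
rewrite hess_lnE partial_ln // partialM // partialV //.
apply/funext => x; rewrite /hess_jet.
by move: (f x)^-1 (partial i (partial j f) x) (partial i f x) (partial j f x) => a b c d; ring.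
Qed.

Lemma grad_hess_jetE x i j k : grad_hess f x i j k =
  grad_hess_jet (f x) (fun i => partial i f x)
    (fun i j => partial i (partial j f) x)
    (fun i j k => partial k (partial i (partial j f)) x) i j k.
Proof.
rewrite /grad_hess -/(hess f) (_ : (fun y => Hf f y i j) = fun y => hess f y i j) //.
rewrite hess_jetE /hess_jet.
rewrite (_ : (fun x => _) = fun x => -1 * ((f x)^-1 * partial i (partial j f) x
   + -1 * ((f x)^-1 * (f x)^-1 * (partial i f x * partial j f x)))); last first.
  by apply/funext => y; rewrite !mulN1r.
have d1 : diffable (fun x => (f x)^-1 * (f x)^-1) by exact: diffableM.
have d2 : diffable (fun x => partial i f x * partial j f x) by exact: diffableM.
have d3 : diffable (fun x => (f x)^-1 * partial i (partial j f) x) by exact: diffableM.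
have d4 : diffable (fun x => (f x)^-1 * (f x)^-1 * (partial i f x * partial j f x)).
  exact: diffableM.
rewrite partialZ; last by apply: diffableD => //; apply: diffableM => //; exact: diffable_cst.
rewrite partialD //; last by apply: diffableM => //; exact: diffable_cst.
rewrite partialZ // !partialM // partialV //.
rewrite /grad_hess_jet.
move: (f x)^-1 (partial k (partial i (partial j f)) x) (partial i (partial j f) x) => a b c.
move: (partial i f x) (partial j f x) (partial k f x) (partial k (partial i f) x) => d e g h.
by move: (partial k (partial j f) x) => l; ring.
Qed.

Lemma fisherE x : I_integrand f x + \sum_i partial i (partial i f) x =
  \sum_i partial i f x ^+ 2 * (f x)^-1.
Proof.
rewrite I_integrandE /I_of big_distrl -big_split /=; apply: eq_bigr => i _.
have /(congr1 (@^~ x)) /= -> := hess_jetE i i; rewrite /hess_jet; move: (fn0 x).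
move: (f x) (partial i (partial i f) x) (partial i f x) => a b c a0.
by field.
Qed.

Hypothesis rf : rapidly_decaying f.

Lemma rapid_decays s : decays (dparts s f).
Proof. by move=> k; exact: rf. Qed.

Lemma iint_laplacian : rV_L1 (fun x => \sum_i partial i (partial i f) x) /\
  iint (fun x => \sum_i partial i (partial i f) x) = 0.
Proof.
have L i : rV_L1 (partial i (partial i f)).
  apply: decays_L1; first exact: smooth_continuous (smooth_partial i (smooth_partial i sf)).
  exact: (@rapid_decays [:: i; i]).
split; first by apply: rV_L1_sum => i _.
rewrite iint_sum // big1 // => i _; apply: iint_partial_eq0.
- exact: smooth_continuous (smooth_partial i sf).
- by move=> x; exact: diffable_derivable.
- exact: (@rapid_decays [:: i]).
- exact: (@rapid_decays [:: i; i]).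
Qed.

(** The Laplacian of [f] is integrable with integral zero, so adding it to the trace integrand costs
    nothing and leaves [|grad f|^2 / f]. The integrability of the latter comes along and is needed
    for the truncation. *)
Lemma fisher_information : rV_L1 (I_integrand f) ->
  rV_L1 (fun x => \sum_i partial i f x ^+ 2 * (f x)^-1) /\
  Ifun f = iint (fun x => \sum_i partial i f x ^+ 2 * (f x)^-1).
Proof.
move=> Ii; have [L1 L2] := iint_laplacian.
rewrite -(_ : (fun x => I_integrand f x + \sum_i partial i (partial i f) x) =
  (fun x => \sum_i partial i f x ^+ 2 * (f x)^-1)); last first.
  by apply/funext => x; exact: fisherE.
split; first exact: rV_L1D.
by rewrite iintD // L2 addr0.
Qed.

Lemma Ifun_ge0 : rV_L1 (I_integrand f) -> 0 <= Ifun f.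
Proof.
move=> /fisher_information[_ ->]; apply: iint_ge0 => x; apply: sumr_ge0 => i _.
by rewrite mulr_ge0 ?sqr_ge0 // invr_ge0 ltW.
Qed.

End positive.
End jets.

(** * Polynomial growth and Gaussian decay *)

Section tame.
Variables (R : realType) (n : nat).
Implicit Types (f g u p : 'rV[R]_n -> R) (i j k : 'I_n).

Definition polygrowth f := exists C m, forall x, `|f x| <= C * (1 + `|x| ^+ m).

(** The multipliers of rapidly decaying functions. For a density [expR u] with [u] tame, the
    integrands of I, Q and D are tame functions times [expR u], so the decay of [expR u] settles all
    questions of integrability. *)
Definition tame f := smooth f /\ forall s, polygrowth (dparts s f).

Lemma expr_le_bound (a : R) m M : 0 <= a -> (m <= M)%N -> a ^+ m <= 1 + a ^+ M.
Proof.
move=> a0 mM; have [a1|/ltW a1] := leP a 1.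
  by rewrite (le_trans (exprn_ile1 m a0 a1)) // lerDl exprn_ge0.
by rewrite (le_trans (ler_weXn2l a1 mM)) // lerDr.
Qed.

Lemma polygrowth_ge0 f : polygrowth f ->
  exists C m, 0 <= C /\ forall x, `|f x| <= C * (1 + `|x| ^+ m).
Proof.
move=> [C [m h]]; exists `|C|, m; split => // x; apply: (le_trans (h x)).
by rewrite ler_wpM2r ?ler_norm // addr_ge0 ?exprn_ge0.
Qed.

Lemma polygrowth_cst c : polygrowth (fun _ => c).
Proof.
by exists `|c|, 0%N => x; rewrite expr0 -[leLHS]mulr1 ler_wpM2l // lerDl.
Qed.

Lemma polygrowthD f g : polygrowth f -> polygrowth g -> polygrowth (fun x => f x + g x).
Proof.
move=> /polygrowth_ge0[C [m [C0 h]]] /polygrowth_ge0[D [l [D0 h']]].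
exists (2 * (C + D)), (m + l)%N => x.
apply: (le_trans (ler_normD _ _)); apply: (le_trans (lerD (h x) (h' x))).
have a0 : 0 <= `|x| by [].
have := expr_le_bound a0 (leq_addr l m); have := expr_le_bound a0 (leq_addl m l).
have := exprn_ge0 (m + l) a0.
move: (`|x| ^+ m) (`|x| ^+ l) (`|x| ^+ (m + l)) => a b c; clear -C0 D0; nra.
Qed.

Lemma polygrowthM f g : polygrowth f -> polygrowth g -> polygrowth (fun x => f x * g x).
Proof.
move=> /polygrowth_ge0[C [m [C0 h]]] /polygrowth_ge0[D [l [D0 h']]].
exists (C * D * 3), (m + l)%N => x; rewrite normrM.
apply: (le_trans (ler_pM (normr_ge0 _) (normr_ge0 _) (h x) (h' x))).
have a0 : 0 <= `|x| by [].
have := expr_le_bound a0 (leq_addr l m); have := expr_le_bound a0 (leq_addl m l).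
have := exprn_ge0 (m + l) a0.
rewrite mulrACA -(mulrA (C * D)); move=> h1 h2 h3; apply: ler_wpM2l; first exact: mulr_ge0.
move: h1 h2 h3.
rewrite mulrDl mul1r mulrDr mulr1 -exprD.
move: (`|x| ^+ m) (`|x| ^+ l) (`|x| ^+ (m + l)) => a b c; clear; lra.
Qed.

Section gen_closed_tame.
Variable B : ('rV[R]_n -> R) -> Prop.
Hypothesis Bd : forall b, B b -> diffable b.
Hypothesis Bg : forall b, B b -> polygrowth b.
Hypothesis Bp : forall b, B b -> forall i, gen B (partial i b).

Lemma gen_closed_tame h : gen B h -> tame h.
Proof.
have gp h' : gen B h' -> polygrowth h'.
  elim => [b /Bg//|c|f g _ df _ dg|f g _ df _ dg].
  - exact: polygrowth_cst.
  - exact: polygrowthD.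
  - exact: polygrowthM.
move=> gh; split; first exact: gen_closed_smooth gh.
by move=> s; apply: gp; apply: dparts_class gh s => *; exact: gen_partial.
Qed.
End gen_closed_tame.

Lemma tame_partial f i : tame f -> tame (partial i f).
Proof.
move=> [sf gf]; split; first exact: smooth_partial.
by move=> s; rewrite -(dparts_cat s [:: i]); exact: gf.
Qed.

Lemma gen_tame h : gen tame h -> tame h.
Proof.
apply: gen_closed_tame => b [sb gb]; [exact: smooth_diffable|exact: (gb [::])|].
by move=> i; apply: gen_base; exact: tame_partial.
Qed.

Lemma tame_coord i : tame (fun x => x 0 i).
Proof.
pose B f := f = (fun x : 'rV[R]_n => x 0 i).
apply: (@gen_closed_tame B) => [b ->|b ->|b -> j|].
- exact: diffable_coord.
- by exists 1, 1%N => x; rewrite mul1r expr1 (le_trans (coord_le_norm _ _)) // lerDr.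
- by rewrite partial_coord; exact: gen_cst.
- exact: gen_base.
Qed.

Lemma tame_expR_class u p : tame u -> decays (fun x => expR (u x)) -> tame p ->
  decays (fun x => p x * expR (u x)).
Proof.
move=> _ du [_ /(_ [::])/polygrowth_ge0[C [m [C0 h]]]].
apply: (le_decays (c := C) (k := m) du) => x.
by rewrite normrM ler_wpM2r // h.
Qed.

(** The products [p * expR u] with [p] tame form a class closed under partial derivatives, so decay
    only has to be checked for [expR u] itself. *)
Lemma rapidly_decaying_expR u : tame u -> decays (fun x => expR (u x)) ->
  rapidly_decaying (fun x => expR (u x)).
Proof.
move=> tu du s; have su := tu.1; have du' := smooth_diffable su.
have de : diffable (fun x => expR (u x)) by exact: smooth_diffable (smooth_expR su).
pose C f := exists2 p, tame p & f = fun x => p x * expR (u x).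
have Cp f : C f -> forall i, C (partial i f).
  move=> [p tp ->] i.
  have tq : tame (fun x => partial i p x + p x * partial i u x).
    apply: gen_tame; apply: genD; first exact/gen_base/tame_partial.
    by apply: genM; apply: gen_base; [exact: tp|exact: tame_partial].
  exists (fun x => partial i p x + p x * partial i u x); first exact: tq.
  have dp := smooth_diffable tp.1.
  rewrite partialM // partial_comp //.
  apply/funext => x; rewrite derive1E derive_val.
  by move: (expR _) (partial i u x) (partial i p x) (p x) => a b c d; ring.
have C0 : C (fun x => expR (u x)).
  exists (fun _ => 1); first by apply: gen_tame; exact: gen_cst.
  by apply/funext => x; rewrite mul1r.
have [p tp E] := dparts_class Cp C0 s.
rewrite E => k; exact: tame_expR_class.
Qed.

Lemma hess_expR u x i j : hess (fun x => expR (u x)) x i j = - partial i (partial j u) x.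
Proof.
rewrite /hess mxE; congr (- partial i (partial j _) x).
by apply/funext => y; rewrite expRK.
Qed.

Lemma grad_hess_expR u x i j k : smooth u ->
  grad_hess (fun x => expR (u x)) x i j k = - partial k (partial i (partial j u)) x.
Proof.
move=> su; rewrite /grad_hess.
rewrite (_ : (fun y => _) = fun y => -1 * partial i (partial j u) y); last first.
  by apply/funext => y; rewrite mulN1r -hess_expR.
rewrite partialZ ?mulN1r //.
exact/smooth_diffable/smooth_partial/smooth_partial.
Qed.

Section expR_density.
Variable u : 'rV[R]_n -> R.
Hypotheses (tu : tame u) (du : decays (fun x => expR (u x))).
Let f x := expR (u x).

Lemma tame_expR_L1 p : tame p -> rV_L1 (fun x => p x * expR (u x)).
Proof.
move=> tp; apply: decays_L1; last exact: tame_expR_class.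
apply: smooth_continuous; apply: smoothM; first exact: tp.1.
exact: smooth_expR tu.1.
Qed.

Lemma expR_L1 : rV_L1 f.
Proof. by apply: decays_L1 => //; exact: smooth_continuous (smooth_expR tu.1). Qed.

Lemma tame_hess i j : tame (fun x => hess f x i j).
Proof.
under eq_fun do rewrite hess_expR.
by apply: gen_tame; apply: genN; apply: gen_base; do 2 apply: tame_partial.
Qed.

Lemma tame_grad_hess i j k : tame (fun x => grad_hess f x i j k).
Proof.
under eq_fun do rewrite (grad_hess_expR _ _ _ _ tu.1).
by apply: gen_tame; apply: genN; apply: gen_base; do 3 apply: tame_partial.
Qed.

Lemma expR_I_L1 : rV_L1 (I_integrand f).
Proof.
rewrite (_ : I_integrand f = fun x => (\sum_i hess f x i i) * expR (u x)) //.
apply: tame_expR_L1; apply: gen_tame; apply: gen_sum => i.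
by apply: gen_base; exact: tame_hess.
Qed.

Lemma expR_Q_L1 : rV_L1 (Q_integrand f).
Proof.
rewrite (_ : Q_integrand f = fun x => (\sum_i \sum_j hess f x i j * hess f x j i) * expR (u x)).
  apply: tame_expR_L1; apply: gen_tame; apply: gen_sum => i; apply: gen_sum => j.
  by apply: genM; apply: gen_base; exact: tame_hess.
by apply/funext => x; exact: Q_integrandE.
Qed.

Lemma expR_D_L1 : rV_L1 (D_integrand f).
Proof.
rewrite (_ : D_integrand f = fun x => (\sum_i \sum_j \sum_k grad_hess f x i j k ^+ 2
   + 2 * \sum_i \sum_j \sum_k hess f x i j * hess f x j k * hess f x k i) * expR (u x)).
  apply: tame_expR_L1; apply: gen_tame; apply: genD.
    apply: gen_sum => i; apply: gen_sum => j; apply: gen_sum => k.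
    by apply: genX; apply: gen_base; exact: tame_grad_hess.
  apply: genM; first exact: gen_cst.
  apply: gen_sum => i; apply: gen_sum => j; apply: gen_sum => k.
  by apply: genM; [apply: genM|]; apply: gen_base; exact: tame_hess.
by apply/funext => x; exact: D_integrandE.
Qed.
End expR_density.

Definition sqnorm (x : 'rV[R]_n) : R := \sum_i x 0 i ^+ 2.

Lemma sqnorm_ge (x : 'rV[R]_n) : `|x| ^+ 2 <= sqnorm x.
Proof.
have [->|x0] := eqVneq x 0.
  by rewrite normr0 expr0n; apply: sumr_ge0 => i _; exact: sqr_ge0.
have xn : `|x| != 0 by rewrite normr_eq0.
have [[a i] /= xi] : exists i : 'I_1 * 'I_n, `|x| = `|x i.1 i.2| := mx_norm_neq0 xn.
rewrite xi (ord1 a) real_normK ?num_real // /sqnorm (bigD1 i) //= lerDl.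
by apply: sumr_ge0 => j _; exact: sqr_ge0.
Qed.

Lemma tame_sqnorm : tame sqnorm.
Proof.
by apply: gen_tame; apply: gen_sum => i; apply: genX; apply: gen_base; exact: tame_coord.
Qed.

Lemma partial_sqnorm i : partial i sqnorm = fun x => 2 * x 0 i.
Proof.
have D (r : seq 'I_n) : uniq r -> diffable (fun x : 'rV[R]_n => \sum_(j <- r) x 0 j ^+ 2) /\
   partial i (fun x : 'rV[R]_n => \sum_(j <- r) x 0 j ^+ 2) = fun x => 2 * (i \in r)%:R * x 0 i.
  elim: r => [_|j r IH /andP[jr /IH[d E]]].
    under eq_fun do rewrite big_nil; split; first exact: diffable_cst.
    by rewrite partial_cst; apply/funext => x; rewrite mulr0 mul0r.
  have dj := @diffable_coord R n j; have djj := diffableM dj dj.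
  under eq_fun do rewrite big_cons expr2; split; first exact: diffableD.
  rewrite partialD // partialM // E partial_coord inE; apply/funext => x.
  have [->|ij] /= := eqVneq i j; last by rewrite !mulr0 !add0r.
  by rewrite (negbTE jr) !mulr1 mulr0 mul0r addr0 mulr_natl mulr2n.
have [_ E] := D (index_enum 'I_n) (index_enum_uniq _).
by rewrite E; apply/funext => x; rewrite mem_index_enum mulr1.
Qed.

Lemma decays_gauss (c k : R) u : 0 < k ->
  (forall x, u x <= c - k * sqnorm x) -> decays (fun x => expR (u x)).
Proof.
move=> k0 h m; exists (expR c * (1 + (m.+1%:R / k) ^+ m)) => x.
rewrite ger0_norm ?expR_ge0 //.
set y := k * `|x| ^+ 2.
have y0 : 0 <= y by rewrite mulr_ge0 ?sqr_ge0 // ltW.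
have e1 : expR (u x) <= expR c * expR (- y).
  rewrite -expRD ler_expR (le_trans (h x)) // lerD2l lerN2 ler_wpM2l ?sqnorm_ge //.
  exact: ltW.
have m0 : 0 < m.+1%:R :> R by rewrite ltr0n.
(* This is [t <= expR t] at [t = y / m.+1%:R], raised to the power [m]. Dividing by [m.+1] rather
   than [m] covers [m = 0] and still leaves an exponent of at most [y]. *)
have e2 : (`|x| ^+ 2) ^+ m <= (m.+1%:R / k) ^+ m * expR y.
  have -> : `|x| ^+ 2 = (m.+1%:R / k) * (y / m.+1%:R).
    by rewrite /y; field; rewrite !gt_eqF.
  rewrite exprMn; apply: ler_wpM2l; first by rewrite exprn_ge0 // divr_ge0 // ltW.
  apply: (@le_trans _ _ (expR (y / m.+1%:R) ^+ m)).
    apply: lerXn2r; rewrite ?nnegrE ?expR_ge0 //; first by rewrite divr_ge0 // ltW.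
    by apply: le_trans (expR_ge1Dx _); rewrite lerDr.
  rewrite -expRM_natl ler_expR mulrCA -[leRHS]mulr1 ler_wpM2l //.
  by rewrite ler_pdivrMr // mul1r ler_nat.
have e3 : `|x| ^+ m <= 1 + (`|x| ^+ 2) ^+ m.
  by rewrite -exprM; apply: expr_le_bound => //; rewrite leq_pmull.
apply: (le_trans (ler_wpM2l _ e1)); first exact: exprn_ge0.
rewrite mulrCA ler_wpM2l ?expR_ge0 //.
apply: (le_trans (ler_wpM2r (expR_ge0 _) e3)).
rewrite mulrDl mul1r lerD //; first by rewrite expR_le1 oppr_le0.
by rewrite expRN ler_pdivrMr ?expR_gt0.
Qed.

End tame.

(** * Normalization *)

Local Opaque partial Hf hess grad_hess I_integrand Q_integrand D_integrand.
Section normalize.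
Variables (R : realType) (n : nat).
Implicit Types (f : 'rV[R]_n -> R).

Lemma eq_I_ofZ (H H' : 'I_n -> 'I_n -> R) a c : (forall i j, H' i j = H i j) ->
  I_of H' (c * a) = c * I_of H a.
Proof.
by move=> E; rewrite /I_of mulrCA; congr (_ * (_ * _)); apply: eq_bigr => i _.
Qed.

Lemma eq_Q_ofZ (H H' : 'I_n -> 'I_n -> R) a c : (forall i j, H' i j = H i j) ->
  Q_of H' (c * a) = c * Q_of H a.
Proof.
move=> E; rewrite /Q_of mulrCA; congr (_ * (_ * _)).
by do 2 (apply: eq_bigr => ? _); rewrite !E.
Qed.

Lemma eq_D_ofZ (H H' : 'I_n -> 'I_n -> R) (K K' : 'I_n -> 'I_n -> 'I_n -> R) a c :
  (forall i j, H' i j = H i j) -> (forall i j k, K' i j k = K i j k) ->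
  D_of H' K' (c * a) = c * D_of H K a.
Proof.
move=> E E'; rewrite /D_of mulrCA; congr (_ * ((_ + 2 * _) * _));
  do 3 (apply: eq_bigr => ? _); first by rewrite E'.
by rewrite !E.
Qed.

Lemma dpartsZ f c s : smooth f ->
  dparts s (fun x => c * f x) = fun x => c * dparts s f x.
Proof.
move=> sf; elim: s => [|i s IH] //=.
by rewrite -/(dparts s _) IH partialZ //; exact: smooth_diffable (smooth_dparts s sf).
Qed.

Lemma rapidly_decayingZ f c : smooth f -> rapidly_decaying f ->
  rapidly_decaying (fun x => c * f x).
Proof.
move=> sf rf s k; have [C h] := rf s k; exists (`|c| * C) => x.
by rewrite dpartsZ // normrM mulrCA ler_wpM2l.
Qed.

Section pre_density.
Variable f : 'rV[R]_n -> R.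
Hypotheses (sf : smooth f) (f0 : forall x, 0 < f x).
Variable c : R.
Hypothesis c0 : 0 < c.

Lemma hessZ x i j : hess (fun y => c * f y) x i j = hess f x i j.
Proof.
have sl := smooth_ln sf f0.
have E : partial j (fun y => ln (c * f y)) = partial j (fun y => ln (f y)).
  rewrite (_ : (fun y => ln (c * f y)) = fun y => ln c + ln (f y)); last first.
    by apply/funext => y; rewrite lnM ?posrE.
  rewrite partialD; [|exact: diffable_cst|exact: smooth_diffable].
  by rewrite partial_cst; apply/funext => y; rewrite add0r.
have h1 := hess_lnE (fun y => c * f y) i j; rewrite E -hess_lnE in h1.
exact: (congr1 (@^~ x) h1).
Qed.

Lemma grad_hessZ x i j k : grad_hess (fun y => c * f y) x i j k = grad_hess f x i j k.
Proof.
have E : (fun y => hess (fun y => c * f y) y i j) = (fun y => hess f y i j).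
  by apply/funext => y; exact: (hessZ y i j).
exact: (congr1 (fun F => partial k F x) E).
Qed.

Lemma I_integrandZ : I_integrand (fun y => c * f y) = fun x => c * I_integrand f x.
Proof.
apply/funext => x; apply: etrans (I_integrandE _ x) _.
exact: (eq_I_ofZ _ _ (hessZ x)).
Qed.

Lemma Q_integrandZ : Q_integrand (fun y => c * f y) = fun x => c * Q_integrand f x.
Proof.
apply/funext => x; apply: etrans (Q_integrandE _ x) _.
apply: etrans (eq_Q_ofZ _ _ (hessZ x)) _.
by rewrite (Q_integrandE f).
Qed.

Lemma D_integrandZ : D_integrand (fun y => c * f y) = fun x => c * D_integrand f x.
Proof.
apply/funext => x; apply: etrans (D_integrandE _ x) _.
apply: etrans (eq_D_ofZ _ _ (hessZ x) (grad_hessZ x)) _.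
by rewrite (D_integrandE f).
Qed.

End pre_density.

(** The matrix H ignores constant factors of [f], so I, Q and D are homogeneous of degree 1: signs,
    and the ratio of I D to Q^2, survive normalization. All constructions can therefore disregard
    the total mass. *)
Lemma normalize_admissible f : smooth f -> (forall x, 0 < f x) -> rapidly_decaying f ->
  rV_L1 (I_integrand f) -> rV_L1 (Q_integrand f) -> rV_L1 (D_integrand f) ->
  0 < Qfun f ->
  exists2 c, 0 < c & [/\ admissible (fun x => c * f x),
    Ifun (fun x => c * f x) = c * Ifun f,
    Qfun (fun x => c * f x) = c * Qfun f &
    Dfun (fun x => c * f x) = c * Dfun f].
Proof.
move=> sf f0 rf LI LQ LD Q0.
have fc := smooth_continuous sf.
have fL : rV_L1 f by apply: decays_L1 => // k; exact: (rf [::]).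
have M0 : 0 < iint f by apply: iint_gt0 => // x; exact: ltW.
have c0 : 0 < (iint f)^-1 by rewrite invr_gt0.
exists (iint f)^-1 => //.
have EI := I_integrandZ sf f0 c0; have EQ := Q_integrandZ sf f0 c0.
have ED := D_integrandZ sf f0 c0.
have I1 : Ifun (fun x => (iint f)^-1 * f x) = (iint f)^-1 * Ifun f by rewrite /Ifun EI iintZ.
have Q1 : Qfun (fun x => (iint f)^-1 * f x) = (iint f)^-1 * Qfun f by rewrite /Qfun EQ iintZ.
have D1 : Dfun (fun x => (iint f)^-1 * f x) = (iint f)^-1 * Dfun f by rewrite /Dfun ED iintZ.
split => //; split.
- split; first by apply: smoothM => //; exact: smooth_cst.
  by move=> x; rewrite mulr_gt0.
- exact: rapidly_decayingZ.
- split; first by apply: rV_L1_integrable; exact: rV_L1Z.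
  by rewrite iintZ // mulVf // gt_eqF.
- by rewrite EI EQ ED; split; apply: rV_L1_integrable; exact: rV_L1Z.
- by rewrite Q1 mulr_gt0.
Qed.

Lemma Q_integrand_ge0 f x : smooth f -> (forall x, 0 < f x) -> 0 <= Q_integrand f x.
Proof.
move=> sf f0; rewrite Q_integrandE mulr_ge0 ?(ltW (f0 x)) //.
apply: sumr_ge0 => i _; apply: sumr_ge0 => j _.
by rewrite [X in _ * X]hess_sym // -expr2 sqr_ge0.
Qed.

End normalize.

(** * The hexagonal example *)

Section gauss_mean.
Variables (R : realType) (n : nat).
Implicit Types (p : 'rV[R]_n -> R) (i j : 'I_n).

Definition cosx (a : R) i (x : 'rV[R]_n) : R := cos (a * x 0 i).
Definition sinx (a : R) i (x : 'rV[R]_n) : R := sin (a * x 0 i).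

Let dax a i : diffable (fun x : 'rV[R]_n => a * x 0 i).
Proof. by apply: diffableM; [exact: diffable_cst|exact: diffable_coord]. Qed.

Lemma diffable_cosx a i : diffable (cosx a i).
Proof. by apply: (@diffable_comp R n (@cos R)) => // x; have [] := is_derive_cos (a * x 0 i). Qed.

Lemma diffable_sinx a i : diffable (sinx a i).
Proof. by apply: (@diffable_comp R n (@sin R)) => // x; have [] := is_derive_sin (a * x 0 i). Qed.

Lemma partial_cosx a i j : partial j (cosx a i) = fun x => - (a * (j == i)%:R) * sinx a i x.
Proof.
rewrite (@partial_comp R n j (@cos R)) //.
rewrite partialZ ?partial_coord; last exact: diffable_coord.
apply/funext => x; rewrite derive1E; have [_ ->] := is_derive_cos (a * x 0 i).
by rewrite mulNr mulrC -mulNr.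
Qed.

Lemma partial_sinx a i j : partial j (sinx a i) = fun x => a * (j == i)%:R * cosx a i x.
Proof.
rewrite (@partial_comp R n j (@sin R)) //.
rewrite partialZ ?partial_coord; last exact: diffable_coord.
apply/funext => x; rewrite derive1E; have [_ ->] := is_derive_sin (a * x 0 i).
by rewrite mulrC.
Qed.

Lemma cosx_le1 a i x : `|cosx a i x| <= 1.
Proof. by rewrite ler_norml cos_geN1 cos_le1. Qed.

Lemma sinx_le1 a i x : `|sinx a i x| <= 1.
Proof. by rewrite ler_norml sin_geN1 sin_le1. Qed.

Let trig f := exists a i, f = cosx a i \/ f = sinx a i.

Lemma tame_trig f : gen trig f -> tame f.
Proof.
apply: gen_closed_tame => b [a [i [->|->]]].
- exact: diffable_cosx.
- exact: diffable_sinx.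
- exists 1, 0%N => x; rewrite (le_trans (cosx_le1 _ _ _)) // mul1r lerDl exprn_ge0 //.
- exists 1, 0%N => x; rewrite (le_trans (sinx_le1 _ _ _)) // mul1r lerDl exprn_ge0 //.
- move=> j; rewrite partial_cosx; apply: genM; first exact: gen_cst.
  by apply: gen_base; exists a, i; right.
- move=> j; rewrite partial_sinx; apply: genM; first exact: gen_cst.
  by apply: gen_base; exists a, i; left.
Qed.

Lemma tame_cosx a i : tame (cosx a i).
Proof. by apply: tame_trig; apply: gen_base; exists a, i; left. Qed.

Lemma tame_sinx a i : tame (sinx a i).
Proof. by apply: tame_trig; apply: gen_base; exists a, i; right. Qed.

Variable k : R.
Hypothesis k0 : 0 < k.

Definition gauss_log (x : 'rV[R]_n) : R := - (k ^+ 2 / 2) * sqnorm x.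

Definition gauss (x : 'rV[R]_n) : R := expR (gauss_log x).

Lemma tame_gauss_log : tame gauss_log.
Proof.
apply: gen_tame; apply: genM; first exact: gen_cst.
exact/gen_base/tame_sqnorm.
Qed.

Lemma decays_gauss_log : decays (fun x => expR (gauss_log x)).
Proof.
apply: (@decays_gauss _ _ 0 (k ^+ 2 / 2)); first by rewrite divr_gt0 // exprn_gt0.
by move=> x; rewrite sub0r /gauss_log mulNr.
Qed.

Lemma partial_gauss_log i : partial i gauss_log = fun x => - k ^+ 2 * x 0 i.
Proof.
rewrite partialZ ?partial_sqnorm; last exact: smooth_diffable (tame_sqnorm R n).1.
by apply/funext => x; field.
Qed.

Lemma tame_gauss_L1 p : tame p -> rV_L1 (fun x => p x * gauss x).
Proof. by apply: tame_expR_L1; [exact: tame_gauss_log|exact: decays_gauss_log]. Qed.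

Lemma gauss_ibp i p : tame p ->
  iint (fun x => partial i p x * gauss x) = k ^+ 2 * iint (fun x => p x * x 0 i * gauss x).
Proof.
move=> tp; have dp := smooth_diffable tp.1.
have dl := smooth_diffable tame_gauss_log.1.
have tpx : tame (fun x => p x * x 0 i).
  by apply: gen_tame; apply: genM; apply: gen_base => //; exact: tame_coord.
have tpp := tame_partial i tp.
have E : partial i (fun x => p x * gauss x) =
   fun x => partial i p x * gauss x - k ^+ 2 * (p x * x 0 i * gauss x).
  have dg : diffable gauss by exact: smooth_diffable (smooth_expR tame_gauss_log.1).
  rewrite partialM // /gauss partial_comp // partial_gauss_log.
  apply/funext => x; rewrite derive1E derive_val.
  by move: (expR _) (partial i p x) (p x) (x 0 i) => a b c d; ring.
apply/eqP; rewrite -subr_eq0 -iintZ; last exact: tame_gauss_L1.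
rewrite -iintB; [|exact: tame_gauss_L1|by apply: rV_L1Z; exact: tame_gauss_L1].
rewrite -E iint_partial_eq0 //.
- apply: smooth_continuous; apply: smoothM; first exact: tp.1.
  exact: smooth_expR tame_gauss_log.1.
- move=> x; apply: diffable_derivable; apply: diffableM => //.
  exact: smooth_diffable (smooth_expR tame_gauss_log.1).
- by apply: tame_expR_class => //; [exact: tame_gauss_log|exact: decays_gauss_log].
- rewrite E (_ : (fun x => _) =
     fun x => (partial i p x + - k ^+ 2 * (p x * x 0 i)) * expR (gauss_log x)).
    apply: tame_expR_class; [exact: tame_gauss_log|exact: decays_gauss_log|].
    apply: gen_tame; apply: genD; first exact: gen_base.
    by apply: genM; [exact: gen_cst|exact: gen_base].
  apply/funext => x; rewrite /gauss.
  by move: (expR _) (partial i p x) (p x) (x 0 i) => a b c d; ring.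
Qed.

(** Derivatives of bounded functions have small means under a wide Gaussian: integration by parts
    replaces the derivative by the factor [k ^+ 2 * x 0 i], and a coordinate of standard deviation
    [1 / k] has mean absolute value at most [1 / k]. *)
Lemma gauss_mean_le i p : tame p -> (forall x, `|p x| <= 1) ->
  `|iint (fun x => partial i p x * gauss x)| <= k * iint gauss.
Proof.
move=> tp p1; rewrite gauss_ibp //.
have g0 x : 0 <= gauss x by exact: expR_ge0.
have tx := tame_coord R i.
(* The variance, by the same integration by parts applied to the coordinate itself. *)
have M2 : k ^+ 2 * iint (fun x => x 0 i * x 0 i * gauss x) = iint gauss.
  rewrite -gauss_ibp // partial_coord.
  by congr iint; apply/funext => x; rewrite eqxx mul1r.
have L1 : rV_L1 gauss by apply: expR_L1; [exact: tame_gauss_log|exact: decays_gauss_log].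
have L2 : rV_L1 (fun x : 'rV[R]_n => x 0 i * x 0 i * gauss x).
  by apply: tame_gauss_L1; apply: gen_tame; apply: genM; exact: gen_base.
have kn : k != 0 by rewrite gt_eqF.
(* From [|t| <= (1/k + k t^2) / 2], balanced so that both terms have the same integral by [M2]. *)
pose m x := k^-1 / 2 * gauss x + k / 2 * (x 0 i * x 0 i * gauss x).
have mL : rV_L1 m by apply: rV_L1D; exact: rV_L1Z.
rewrite normrM (ger0_norm (sqr_ge0 k)).
have le1 : `|iint (fun x => p x * x 0 i * gauss x)| <= iint m.
  apply: normr_iint_le => //.
    by apply: tame_gauss_L1; apply: gen_tame; apply: genM; exact: gen_base.
  move=> x; rewrite normrM (ger0_norm (g0 x)) /m mulrA -mulrDl ler_wpM2r // normrM.
  apply: (@le_trans _ _ `|x 0 i|); first by rewrite ler_piMl.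
  rewrite -expr2 -(real_normK (num_real (x 0 i))).
  have := sqr_ge0 (k * `|x 0 i| - 1); move: `|x 0 i| => t h.
  rewrite -(ler_pM2l k0) -subr_ge0.
  by rewrite (_ : _ - _ = (k * t - 1) ^+ 2 / 2) ?divr_ge0 //; field.
apply: (le_trans (ler_wpM2l (sqr_ge0 k) le1)).
rewrite iintD ?iintZ //; try exact: rV_L1Z.
rewrite (_ : k ^+ 2 * _ = k / 2 * iint gauss +
  k / 2 * (k ^+ 2 * iint (fun x => x 0 i * x 0 i * gauss x))).
  by rewrite M2 -mulrDl -splitr.
by move: (iint _) (iint _) => a b; field.
Qed.

End gauss_mean.

(** * Trigonometric waves in the plane and the perturbed Gaussian *)

Section trig_waves.
Variable R : realType.

Let i0 : 'I_2 := ord0.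
Let i1 : 'I_2 := lift ord0 ord0.
Let V := 'rV[R]_2.

Definition wave (F G : R -> 'I_2 -> V -> R) (a b : R) (x : V) : R := F a i0 x * G b i1 x.
Definition wcc := wave (@cosx R 2) (@cosx R 2).
Definition wsc := wave (@sinx R 2) (@cosx R 2).
Definition wcs := wave (@cosx R 2) (@sinx R 2).
Definition wss := wave (@sinx R 2) (@sinx R 2).
(** [phi3] and its derivatives all combine one product of frequencies [(2, 0)] with one of
    frequencies [(1, sqrt 3)], of the same type (sine or cosine in each variable). Differentiation
    then acts on the two coefficients and on the type alone; some of the coefficients are 0 and are
    kept for the sake of uniformity. *)
Definition lc2 (al : R) (F : V -> R) (be : R) (G : V -> R) (x : V) : R := al * F x + be * G x.

Let dc := @diffable_cosx R 2. Let ds := @diffable_sinx R 2.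

Lemma diffable_waves a b :
  [/\ diffable (wcc a b), diffable (wsc a b), diffable (wcs a b) & diffable (wss a b)].
Proof. by split; apply: diffableM. Qed.

Lemma tame_waves a b : [/\ tame (wcc a b), tame (wsc a b), tame (wcs a b) & tame (wss a b)].
Proof.
have tc := @tame_cosx R 2; have ts := @tame_sinx R 2.
by split; apply: gen_tame; apply: genM; exact: gen_base.
Qed.

Lemma partial_waves a b :
  [/\ partial i0 (wcc a b) = fun x => - a * wsc a b x,
      partial i0 (wsc a b) = fun x => a * wcc a b x,
      partial i0 (wcs a b) = fun x => - a * wss a b x &
      partial i0 (wss a b) = fun x => a * wcs a b x] /\
  [/\ partial i1 (wcc a b) = fun x => - b * wcs a b x,
      partial i1 (wsc a b) = fun x => - b * wss a b x,
      partial i1 (wcs a b) = fun x => b * wcc a b x &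
      partial i1 (wss a b) = fun x => b * wsc a b x].
Proof.
rewrite /wcc /wsc /wcs /wss /wave.
by split; split; rewrite partialM // ?partial_cosx ?partial_sinx; apply/funext => x;
  rewrite /= ?(mulr1, mulr0); ring.
Qed.

Lemma partial_lc2 i al F be G : diffable F -> diffable G ->
  partial i (lc2 al F be G) = lc2 al (partial i F) be (partial i G).
Proof.
move=> dF dG; rewrite /lc2 partialD; [|by apply: diffableM => //; exact: diffable_cst..].
by rewrite !partialZ.
Qed.

Lemma lc2Z al F a be G b :
  lc2 al (fun x => a * F x) be (fun x => b * G x) = lc2 (al * a) F (be * b) G.
Proof. by apply/funext => x; rewrite /lc2 !mulrA. Qed.

Definition sqrt3 : R := Num.sqrt 3.
Lemma sqr_sqrt3 : sqrt3 ^+ 2 = 3. Proof. by rewrite sqr_sqrtr. Qed.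
Lemma sqrt3_ge1 : 1 <= sqrt3.
Proof. by rewrite -[leLHS]sqrtr1 ler_wsqrtr // ler1n. Qed.

(* [cos 2x + 2 cos x cos (sqrt 3 y)]: three plane waves whose wave vectors have equal length and
   sum to zero. This resonance gives the cube of the Hessian a nonzero mean. *)
Definition phi3 : V -> R := lc2 1 (wcc 2 0) 2 (wcc 1 sqrt3).

Lemma tame_phi3 : tame phi3.
Proof.
have [t1 _ _ _] := tame_waves 2 0; have [t2 _ _ _] := tame_waves 1 sqrt3.
apply: gen_tame; apply: genD; (apply: genM; [exact: gen_cst|exact: gen_base]).
Qed.

Let dW := diffable_waves.

Let D0 al be :
  [/\ partial i0 (lc2 al (wcc 2 0) be (wcc 1 sqrt3)) =
     lc2 (al * - 2) (wsc 2 0) (be * - 1) (wsc 1 sqrt3),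
   partial i0 (lc2 al (wsc 2 0) be (wsc 1 sqrt3)) =
     lc2 (al * 2) (wcc 2 0) (be * 1) (wcc 1 sqrt3),
   partial i0 (lc2 al (wcs 2 0) be (wcs 1 sqrt3)) =
     lc2 (al * - 2) (wss 2 0) (be * - 1) (wss 1 sqrt3) &
   partial i0 (lc2 al (wss 2 0) be (wss 1 sqrt3)) =
     lc2 (al * 2) (wcs 2 0) (be * 1) (wcs 1 sqrt3)].
Proof.
have [[e1 e2 e3 e4] _] := partial_waves 2 0; have [[f1 f2 f3 f4] _] := partial_waves 1 sqrt3.
have [d1 d2 d3 d4] := dW 2 0; have [g1 g2 g3 g4] := dW 1 sqrt3.
by split; rewrite partial_lc2 // ?e1 ?e2 ?e3 ?e4 ?f1 ?f2 ?f3 ?f4 lc2Z.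
Qed.

Let D1 al be :
  [/\ partial i1 (lc2 al (wcc 2 0) be (wcc 1 sqrt3)) =
     lc2 (al * - 0) (wcs 2 0) (be * - sqrt3) (wcs 1 sqrt3),
   partial i1 (lc2 al (wsc 2 0) be (wsc 1 sqrt3)) =
     lc2 (al * - 0) (wss 2 0) (be * - sqrt3) (wss 1 sqrt3),
   partial i1 (lc2 al (wcs 2 0) be (wcs 1 sqrt3)) =
     lc2 (al * 0) (wcc 2 0) (be * sqrt3) (wcc 1 sqrt3) &
   partial i1 (lc2 al (wss 2 0) be (wss 1 sqrt3)) =
     lc2 (al * 0) (wsc 2 0) (be * sqrt3) (wsc 1 sqrt3)].
Proof.
have [_ [e1 e2 e3 e4]] := partial_waves 2 0; have [_ [f1 f2 f3 f4]] := partial_waves 1 sqrt3.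
have [d1 d2 d3 d4] := dW 2 0; have [g1 g2 g3 g4] := dW 1 sqrt3.
by split; rewrite partial_lc2 // ?e1 ?e2 ?e3 ?e4 ?f1 ?f2 ?f3 ?f4 lc2Z.
Qed.

Let lc2_eq a a' F b b' G : a = a' -> b = b' -> lc2 a F b G = lc2 a' F b' G.
Proof. by move=> -> ->. Qed.

Lemma phi3_hess :
  [/\ partial i0 (partial i0 phi3) = lc2 (- 4) (wcc 2 0) (- 2) (wcc 1 sqrt3),
      partial i0 (partial i1 phi3) = lc2 0 (wss 2 0) (2 * sqrt3) (wss 1 sqrt3),
      partial i1 (partial i0 phi3) = lc2 0 (wss 2 0) (2 * sqrt3) (wss 1 sqrt3) &
      partial i1 (partial i1 phi3) = lc2 0 (wcc 2 0) (- 6) (wcc 1 sqrt3)].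
Proof.
have [e0 _ _ _] := D0 1 2; have [f0 _ _ _] := D1 1 2.
rewrite /phi3 e0 f0; split.
- have [_ -> _ _] := D0 (1 * - 2) (2 * - 1); apply: lc2_eq; ring.
- have [_ _ -> _] := D0 (1 * - 0) (2 * - sqrt3); apply: lc2_eq; ring.
- have [_ -> _ _] := D1 (1 * - 2) (2 * - 1); apply: lc2_eq; ring.
- have [_ _ -> _] := D1 (1 * - 0) (2 * - sqrt3); apply: lc2_eq; first by ring.
  by rewrite -mulrA mulNr -expr2 sqr_sqrt3; ring.
Qed.

Lemma phi3_third :
  [/\ partial i0 (partial i0 (partial i0 phi3)) = lc2 8 (wsc 2 0) 2 (wsc 1 sqrt3),
      partial i1 (partial i0 (partial i0 phi3)) = lc2 0 (wcs 2 0) (2 * sqrt3) (wcs 1 sqrt3),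
      partial i0 (partial i0 (partial i1 phi3)) = lc2 0 (wcs 2 0) (2 * sqrt3) (wcs 1 sqrt3) &
      partial i1 (partial i0 (partial i1 phi3)) = lc2 0 (wsc 2 0) 6 (wsc 1 sqrt3)] /\
  [/\ partial i0 (partial i1 (partial i0 phi3)) = lc2 0 (wcs 2 0) (2 * sqrt3) (wcs 1 sqrt3),
      partial i1 (partial i1 (partial i0 phi3)) = lc2 0 (wsc 2 0) 6 (wsc 1 sqrt3),
      partial i0 (partial i1 (partial i1 phi3)) = lc2 0 (wsc 2 0) 6 (wsc 1 sqrt3) &
      partial i1 (partial i1 (partial i1 phi3)) = lc2 0 (wcs 2 0) (6 * sqrt3) (wcs 1 sqrt3)].
Proof.
have [h1 h2 h3 h4] := phi3_hess; rewrite h1 h2 h3 h4.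
have [e1 _ _ _] := D0 (- 4) (- 2); have [e2 _ _ _] := D0 0 (- 6).
have [_ _ _ e3] := D0 0 (2 * sqrt3).
have [f1 _ _ _] := D1 (- 4) (- 2); have [f2 _ _ _] := D1 0 (- 6).
have [_ _ _ f3] := D1 0 (2 * sqrt3).
have E : 2 * sqrt3 * sqrt3 = 6 by rewrite -mulrA -expr2 sqr_sqrt3; ring.
rewrite e1 e2 e3 f1 f2 f3 E.
by split; split; apply: lc2_eq; ring.
Qed.

Section perturbed_gauss.
Variables e k : R.

Definition wave_log (x : V) : R := e * phi3 x + gauss_log k x.

Lemma tame_wave_log : tame wave_log.
Proof.
apply: gen_tame; apply: genD.
  by apply: genM; [exact: gen_cst|exact: gen_base tame_phi3].
exact: gen_base (@tame_gauss_log R 2 k).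
Qed.

Lemma wave_log_hess i j : partial i (partial j wave_log) =
  fun x => e * partial i (partial j phi3) x - k ^+ 2 * (i == j)%:R.
Proof.
have sp := tame_phi3.1; have sg := (@tame_gauss_log R 2 k).1.
have dp := smooth_diffable sp; have dg := smooth_diffable sg.
have dpj := smooth_diffable (smooth_partial j sp).
have dco := @diffable_coord R 2 j.
have z1 : diffable (fun x : V => e * phi3 x) by apply: diffableM => //; exact: diffable_cst.
have z2 : diffable (fun x : V => e * partial j phi3 x).
  by apply: diffableM => //; exact: diffable_cst.
have z3 : diffable (fun x : V => - k ^+ 2 * x 0 j).
  by apply: diffableM => //; exact: diffable_cst.
rewrite /wave_log (partialD _ z1 dg) (partialZ _ _ dp) partial_gauss_log (partialD _ z2 z3).
rewrite (partialZ _ _ dpj) (partialZ _ _ dco) partial_coord.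
by apply/funext => x; rewrite mulNr.
Qed.

Lemma wave_log_third i j l : partial l (partial i (partial j wave_log)) =
  fun x => e * partial l (partial i (partial j phi3)) x.
Proof.
have dpj := smooth_diffable (smooth_partial i (smooth_partial j tame_phi3.1)).
rewrite wave_log_hess (_ : (fun x => _ - _) =
  fun x => e * partial i (partial j phi3) x + (fun _ => - (k ^+ 2 * (i == j)%:R)) x) //.
rewrite partialD; [|by apply: diffableM => //; exact: diffable_cst|exact: diffable_cst].
by rewrite partialZ // partial_cst; apply/funext => x; rewrite addr0.
Qed.

End perturbed_gauss.
End trig_waves.

(** * Real estimates for the expansion in powers of [e] *)

Section real_estimates.
Variable R : realType.

Lemma normr_mul_le (x y X Y : R) : `|x| <= X -> `|y| <= Y -> `|x * y| <= X * Y.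
Proof. by move=> hx hy; rewrite normrM ler_pM. Qed.

Lemma normr_add_le (x y X Y : R) : `|x| <= X -> `|y| <= Y -> `|x + y| <= X + Y.
Proof. by move=> hx hy; rewrite (le_trans (ler_normD _ _)) // lerD. Qed.

Lemma MVT_origin (F dF : R -> R) t : (forall x : R, is_derive x 1 F (dF x)) -> F 0 = 0 ->
  exists2 xi, `|xi| <= `|t| & F t = t * dF xi.
Proof.
move=> dFP F0.
have Fc a b : {within `[a, b], continuous F}.
  apply: continuous_subspaceT => s; apply: differentiable_continuous.
  by apply/derivable1_diffP; have [] := dFP s.
have [t0|/ltW t0] := leP 0 t.
  have [xi] := MVT_segment t0 (fun s _ => dFP s) (Fc _ _).
  rewrite in_itv /= F0 !subr0 mulrC => /andP[x0 xt] ->; exists xi => //.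
  by rewrite !ger0_norm.
have [xi] := MVT_segment t0 (fun s _ => dFP s) (Fc _ _).
rewrite in_itv /= F0 !sub0r => /andP[xt x0] E; exists xi.
  by rewrite !ler0_norm // lerN2.
by apply: oppr_inj; rewrite E mulrN mulrC.
Qed.

Lemma expR_taylor1 (t : R) : `|t| <= 1 / 2 -> `|expR t - 1| <= 2 * `|t|.
Proof.
move=> t2; have := t2; rewrite ler_norml => /andP[h1 h2].
have p0 := expR_gt0 t.
have e1 := expR_ge1Dx t; have := expR_ge1Dx (- t); rewrite expRN => e2.
have e3 : expR t * (1 - t) <= 1 by rewrite -ler_pdivlMl // mulr1.
have [t0|t0] := leP 0 t.
  rewrite (ger0_norm t0) ger0_norm; first by nra.
  by lra.
rewrite (ltr0_norm t0) ler0_norm; first by nra.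
by nra.
Qed.

(** Each Taylor remainder vanishes at 0 and has the preceding remainder as derivative, so the mean
    value theorem gains one factor [|t|] per step and keeps the constant 2. *)
Lemma expR_taylor2 (t : R) : `|t| <= 1 / 2 ->
  `|expR t - (1 + t + t ^+ 2 / 2)| <= 2 * `|t| ^+ 3.
Proof.
move=> t2.
have B (s : R) : `|s| <= 1 / 2 -> `|expR s - 1 - s| <= 2 * `|s| ^+ 2.
  move=> s2.
  have D (x : R) : is_derive x 1 (fun x => expR x - 1 - x) (expR x - 1).
    by apply: is_derive_eq; rewrite subr0.
  have Z : expR 0 - 1 - 0 = 0 :> R by rewrite expR0 !subrr.
  have [xi xs ->] := MVT_origin s D Z.
  rewrite normrM expr2 mulrCA ler_wpM2l //.
  apply: (le_trans (expR_taylor1 (le_trans xs s2))).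
  by rewrite ler_wpM2l.
have D (x : R) : is_derive x 1 (fun x => expR x - (1 + x + x ^+ 2 / 2)) (expR x - 1 - x).
  by apply: is_derive_eq; rewrite /GRing.scale /=; field.
have Z : expR 0 - (1 + 0 + 0 ^+ 2 / 2) = 0 :> R by rewrite expR0 expr0n mul0r !addr0 subrr.
have [xi xs E] := MVT_origin t D Z.
rewrite E normrM exprS mulrCA ler_wpM2l //.
apply: (le_trans (B _ (le_trans xs t2))).
by rewrite ler_wpM2l // lerXn2r.
Qed.

(** [E] stands for [expR (e * F)], [k2] for the precision of the Gaussian, and the factor in front
    of [E] for the integrand of 16 I - 8 Q + D divided by the density. Multiplied out, the terms of
    orders 1, 2 and 3 in [e] are those displayed; the rest has order at least 4, with coefficients
    whose sum stays below 40 * 1000 when [e <= 1 / 10]. *)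
Lemma wave_remainder (e k2 F A B rest E : R) :
  0 < e -> e <= 1 / 10 -> 0 <= k2 -> k2 <= e ^+ 6 ->
  `|F| <= 3 -> `|A| <= 2000 -> `|B| <= 1000 -> `|rest| <= 1000 ->
  `|E - (1 + e * F + (e * F) ^+ 2 / 2)| <= 2 * `|e * F| ^+ 3 ->
  (64 * e * F + e ^+ 2 * A - 2 * e ^+ 3 * B + k2 * rest) * E <=
  e * (64 * F) + e ^+ 2 * (64 * F ^+ 2 + A) + e ^+ 3 * (32 * F ^+ 3 + F * A - 2 * B)
  + 40 * 1000 * e ^+ 4.
Proof.
move=> e0 e1 k0 k1 F3 A1 B1 r1; set r := E - _ => rE.
have e0' := ltW e0.
have ne : `|e| <= e by rewrite ger0_norm.
have tF : `|e * F| <= e * 3 by exact: normr_mul_le.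
have r3 : `|r| <= e ^+ 3 * 54.
  apply: (le_trans rE); rewrite (_ : e ^+ 3 * 54 = 2 * (e * 3) ^+ 3); last by ring.
  by rewrite ler_wpM2l // lerXn2r ?nnegrE // (le_trans _ tF).
have EE : E = 1 + e * F + (e * F) ^+ 2 / 2 + r by rewrite /r; ring.
set t := e * F in tF EE.
have h2 : `|2^-1 : R| <= 2^-1 by rewrite ger0_norm.
have t2 : `|t ^+ 2 / 2| <= (e * 3) ^+ 2 / 2.
  by apply: normr_mul_le => //; rewrite normrX lerXn2r ?nnegrE // (le_trans _ tF).
have n64 : `|64 : R| <= 64 by rewrite ger0_norm.
have n2 : `|2 : R| <= 2 by rewrite ger0_norm.
have ne2 : `|e ^+ 2| <= e ^+ 2 by rewrite ger0_norm // exprn_ge0.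
have ne3 : `|e ^+ 3| <= e ^+ 3 by rewrite ger0_norm // exprn_ge0.
have nk : `|k2| <= e ^+ 6 by rewrite ger0_norm.
have n1 : `|1 : R| <= 1 by rewrite normr1.
have b1 := normr_mul_le n64 (normr_mul_le tF r3).
have b2 := normr_mul_le (normr_mul_le ne2 A1) (normr_add_le t2 r3).
have b3 := normr_mul_le (normr_mul_le (normr_mul_le n2 ne3) B1)
   (normr_add_le (normr_add_le tF t2) r3).
have b4 := normr_mul_le (normr_mul_le nk r1)
   (normr_add_le (normr_add_le (normr_add_le n1 tF) t2) r3).
have := ler_norm (64 * (t * r)).
have := ler_norm (e ^+ 2 * A * (t ^+ 2 / 2 + r)).
have : - (2 * e ^+ 3 * B * (t + t ^+ 2 / 2 + r)) <= `|2 * e ^+ 3 * B * (t + t ^+ 2 / 2 + r)|.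
  by rewrite -normrN ler_norm.
have := ler_norm (k2 * rest * (1 + t + t ^+ 2 / 2 + r)).
move=> g4 g3 g2 g1.
rewrite -subr_ge0 [X in 0 <= X](_ : _ = 40 * 1000 * e ^+ 4
  - (64 * (t * r) + e ^+ 2 * A * (t ^+ 2 / 2 + r)
     + - (2 * e ^+ 3 * B * (t + t ^+ 2 / 2 + r))
     + k2 * rest * (1 + t + t ^+ 2 / 2 + r))); last by rewrite EE /t; field.
rewrite subr_ge0.
apply: (@le_trans _ _ (64 * (e * 3 * (e ^+ 3 * 54)) +
  e ^+ 2 * 2000 * ((e * 3) ^+ 2 / 2 + e ^+ 3 * 54) +
  2 * e ^+ 3 * 1000 * (e * 3 + (e * 3) ^+ 2 / 2 + e ^+ 3 * 54) +
  e ^+ 6 * 1000 * (1 + e * 3 + (e * 3) ^+ 2 / 2 + e ^+ 3 * 54))).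
  by repeat apply: lerD; apply: le_trans; eassumption.
clear -e0 e0' e1.
rewrite (_ : 40 * 1000 * e ^+ 4 = e ^+ 4 * (40 * 1000)); last by ring.
rewrite [leLHS](_ : _ = e ^+ 4 * (64 * 162 + 2000 * (9 / 2 + e * 54) +
  2000 * (3 + e * 9 / 2 + e ^+ 2 * 54) + e * e * 1000 * (1 + e * 3 + e ^+ 2 * 9 / 2 + e ^+ 3 * 54))); last by field.
rewrite ler_wpM2l ?exprn_ge0 //.
have q2 : e ^+ 2 <= 1 / 100 by rewrite expr2; nra.
have q3 : e ^+ 3 <= 1 / 1000 by rewrite exprS; nra.
have q4 : e * e <= 1 / 100 by nra.
have q5 : 0 <= 1 + e * 3 + e ^+ 2 * 9 / 2 + e ^+ 3 * 54.
  by rewrite !addr_ge0 ?mulr_ge0 ?divr_ge0 ?exprn_ge0.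
move: q5; set S := (1 + e * 3 + _ + _) => q5.
have S2 : S <= 2 by rewrite /S; lra.
have ee0 : 0 <= e * e by rewrite mulr_ge0.
have q6 : e * e * S <= 1 / 100 * 2 := ler_pM ee0 q5 q4 S2.
rewrite (_ : e * e * 1000 * S = 1000 * (e * e * S)); last by ring.
move: q6; move: (e * e * S) => z q6.
by clear -q6 q2 e1; lra.
Qed.

End real_estimates.

(** * Lattice waves and their Gaussian means *)

Section cheb.
Variable R : realType.

(** Pairs of consecutive Chebyshev polynomials of the first kind. They turn identities between sums
    of waves into polynomial identities in two cosines, which [ring] decides. *)
Fixpoint cheb2 (n : nat) (t : R) : R * R :=
  match n with
  | 0 => (1, t)
  | n'.+1 => let p := cheb2 n' t in (p.2, 2 * t * p.2 - p.1)
  end.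
Definition cheb n t := (cheb2 n t).1.

Lemma cos_cheb n y : cos (n%:R * y) = cheb n (cos y).
Proof.
have H m : cheb2 m (cos y) = (cos (m%:R * y), cos (m.+1%:R * y)).
  elim: m => [|m IH] /=; first by rewrite mul0r cos0 mul1r.
  have e1 : m.+2%:R * y = m.+1%:R * y + y by rewrite -[m.+2%:R]natr1 mulrDl mul1r.
  have e2 : m%:R * y = m.+1%:R * y - y by rewrite -[m.+1%:R]natr1 mulrDl mul1r addrK.
  by rewrite IH /= e1 e2 cosB cosD; congr pair; ring.
by rewrite /cheb H.
Qed.
End cheb.

Section example.
Variable R : realType.
Let i0 : 'I_2 := ord0.
Let i1 : 'I_2 := lift ord0 ord0.
Let V := 'rV[R]_2.
Let s3 : R := sqrt3 R.

Definition hexwave (t : nat * nat) (x : V) : R :=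
  cosx t.1%:R i0 x * cosx (t.2%:R * s3) i1 x.

Lemma tame_hexwave t : tame (hexwave t).
Proof. by apply: gen_tame; apply: genM; apply: gen_base; exact: tame_cosx. Qed.

Lemma hexwave_cheb t x :
  hexwave t x = cheb t.1 (cosx 1 i0 x) * cheb t.2 (cosx s3 i1 x).
Proof.
rewrite /hexwave /cosx -!cos_cheb mul1r mulrA; congr (_ * cos _).
Qed.

(** A nonconstant wave, multiplied by its frequency in a variable where it oscillates, is the
    derivative of a product of sines and cosines bounded by 1. That frequency is at least 1, so
    [gauss_mean_le] applies; the first variable is used unless its frequency is 0. *)
Lemma hexwave_mean k t : 0 < k -> t != (0, 0)%N ->
  `|iint (fun x => hexwave t x * gauss k x)| <= k * iint (@gauss R 2 k).
Proof.
move=> k0; case: t => a b t0.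
have tc := @tame_cosx R 2; have ts := @tame_sinx R 2.
have dc := @diffable_cosx R 2; have ds := @diffable_sinx R 2.
have key c i (p : V -> R) : 1 <= c -> tame p -> (forall x, `|p x| <= 1) ->
   partial i p = (fun x => c * hexwave (a, b) x) ->
   `|iint (fun x => hexwave (a, b) x * gauss k x)| <= k * iint (@gauss R 2 k).
  move=> c1 tp p1 E; have := gauss_mean_le k0 i tp p1.
  have -> : (fun x => partial i p x * gauss k x) = fun x => c * (hexwave (a, b) x * gauss k x).
    by apply/funext => x; rewrite E -mulrA.
  rewrite iintZ; last by apply: tame_gauss_L1 => //; exact: tame_hexwave.
  apply: le_trans; rewrite normrM ler_peMl // ger0_norm // (le_trans _ c1) //.
case: a t0 key => [|a] t0 key; last first.
  apply: (key a.+1%:R i0 (fun x => sinx a.+1%:R i0 x * cosx (b%:R * s3) i1 x)).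
  - by rewrite ler1n.
  - by apply: gen_tame; apply: genM; exact: gen_base.
  - by move=> x; rewrite normrM mulr_ile1 ?sinx_le1 ?cosx_le1.
  - rewrite partialM // partial_sinx partial_cosx; apply/funext => x.
    rewrite /hexwave /= ?(mulr1, mulr0).
    by move: (cosx _ _ _) (cosx _ _ _) (sinx _ _ _) (sinx _ _ _) => c1 c2 c3 c4; ring.
case: b t0 key => [|b] // t0 key.
apply: (key (b.+1%:R * s3) i1 (sinx (b.+1%:R * s3) i1)) => //.
- rewrite -[leLHS]mulr1; apply: ler_pM => //; first by rewrite ler1n.
  exact: sqrt3_ge1.
- by move=> x; exact: sinx_le1.
- rewrite partial_sinx; apply/funext => x; rewrite /hexwave /= mulr1; congr (_ * _).
  by rewrite /cosx !mul0r cos0 mul1r.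
Qed.

Definition hexsum (l : seq (int * (nat * nat))) (x : V) : R :=
  \sum_(t <- l) t.1%:~R * hexwave t.2 x.

Lemma tame_hexsum l : tame (hexsum l).
Proof.
apply: gen_tame; apply: gen_sum => t; apply: genM; first exact: gen_cst.
exact/gen_base/tame_hexwave.
Qed.

Lemma hexsum_mean k l : 0 < k -> all (fun t => t.2 != (0, 0)%N) l ->
  iint (fun x => hexsum l x * gauss k x) <=
  (sumn [seq absz t.1 | t <- l])%:R * (k * iint (@gauss R 2 k)).
Proof.
move=> k0; elim: l => [_|t l IH /andP[t0 /IH h]].
  rewrite mul0r /hexsum; under eq_fun do rewrite big_nil mul0r.
  by rewrite iint0.
rewrite /hexsum; under eq_fun do rewrite big_cons mulrDl -mulrA.
have L := tame_gauss_L1 k0 (tame_hexwave t.2).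
rewrite iintD; [|exact: rV_L1Z|exact: tame_gauss_L1 (tame_hexsum l)].
rewrite iintZ //= natrD mulrDl; apply: lerD => //.
apply: (le_trans (ler_norm _)); rewrite normrM natr_absz intr_norm.
by rewrite ler_wpM2l // hexwave_mean.
Qed.

End example.

(** * The combination 16 I - 8 Q + D as a polynomial in two cosines *)

Section example2.
Variable R : realType.
Let i0 : 'I_2 := ord0.
Let i1 : 'I_2 := lift ord0 ord0.
Let V := 'rV[R]_2.

(** [A], [B], [C] are the second derivatives of the logarithm of the density and [t1] to [t4] the
    third ones, grouped by symmetry: a third derivative in mixed directions occurs three times. *)
Lemma log_convexity_defect (H : 'I_2 -> 'I_2 -> R) (K : 'I_2 -> 'I_2 -> 'I_2 -> R)
    (w A B C t1 t2 t3 t4 : R) :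
  H i0 i0 = - A -> H i0 i1 = - B -> H i1 i0 = - B -> H i1 i1 = - C ->
  K i0 i0 i0 = - t1 -> K i0 i0 i1 = - t2 -> K i0 i1 i0 = - t2 -> K i0 i1 i1 = - t3 ->
  K i1 i0 i0 = - t2 -> K i1 i0 i1 = - t3 -> K i1 i1 i0 = - t3 -> K i1 i1 i1 = - t4 ->
  16 * I_of H w - 8 * Q_of H w + D_of H K w =
  (- 16 * (A + C) - 8 * (A ^+ 2 + 2 * B ^+ 2 + C ^+ 2)
   + (t1 ^+ 2 + 3 * t2 ^+ 2 + 3 * t3 ^+ 2 + t4 ^+ 2)
   - 2 * (A ^+ 3 + 3 * A * B ^+ 2 + 3 * C * B ^+ 2 + C ^+ 3)) * w.
Proof.
move=> h1 h2 h3 h4 k1 k2 k3 k4 k5 k6 k7 k8.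
rewrite /I_of /Q_of /D_of !big_ord_recl !big_ord0 -/i0 -/i1.
rewrite h1 h2 h3 h4 k1 k2 k3 k4 k5 k6 k7 k8; ring.
Qed.

(* With [a = cos x] and [c = cos (sqrt 3 y)], F is [phi3], p and q are its pure second
   derivatives and h is the square of the mixed one. *)
Definition defect_F (a c : R) := 2 * a ^+ 2 - 1 + 2 * (a * c).
Definition defect_p (a c : R) := - 4 * (2 * a ^+ 2 - 1) - 2 * (a * c).
Definition defect_q (a c : R) := - 6 * (a * c).
Definition defect_h (a c : R) := 12 * (1 - a ^+ 2) * (1 - c ^+ 2).
Definition defect_Psi (a c : R) :=
  defect_p a c ^+ 2 + 2 * defect_h a c + defect_q a c ^+ 2.
Definition defect_A (a c : R) := - 8 * defect_Psi a c +
  ((1 - a ^+ 2) * (16 * a + 2 * c) ^+ 2 + 36 * a ^+ 2 * (1 - c ^+ 2)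
   + 108 * (1 - a ^+ 2) * c ^+ 2 + 108 * a ^+ 2 * (1 - c ^+ 2)).
Definition defect_B (a c : R) := defect_p a c ^+ 3 +
  3 * (defect_p a c + defect_q a c) * defect_h a c + defect_q a c ^+ 3.
Definition defect_rest (e k2 a c : R) := 32 - 64 * e * defect_F a c - 16 * k2
  + 6 * e ^+ 2 * defect_Psi a c + 24 * k2 * e * defect_F a c + 4 * k2 ^+ 2.

(** The sines [b], [d] and the root [s] of 3 enter only through their squares, which leaves
    polynomials in the cosines [a] and [c]. Everything due to the Gaussian carries a factor [k2] and
    is collected in [defect_rest]. *)
Lemma defect_poly (e k2 a b c d s : R) : b ^+ 2 = 1 - a ^+ 2 -> d ^+ 2 = 1 - c ^+ 2 ->
  s ^+ 2 = 3 ->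
  - 16 * ((e * defect_p a c - k2) + (e * defect_q a c - k2))
  - 8 * ((e * defect_p a c - k2) ^+ 2 + 2 * (e * (2 * s * (b * d))) ^+ 2
         + (e * defect_q a c - k2) ^+ 2)
  + ((e * (8 * (2 * a * b) + 2 * (b * c))) ^+ 2 + 3 * (e * (2 * s * (a * d))) ^+ 2
     + 3 * (e * (6 * (b * c))) ^+ 2 + (e * (6 * s * (a * d))) ^+ 2)
  - 2 * ((e * defect_p a c - k2) ^+ 3
         + 3 * (e * defect_p a c - k2) * (e * (2 * s * (b * d))) ^+ 2
         + 3 * (e * defect_q a c - k2) * (e * (2 * s * (b * d))) ^+ 2
         + (e * defect_q a c - k2) ^+ 3) =
  64 * e * defect_F a c + e ^+ 2 * defect_A a c - 2 * e ^+ 3 * defect_B a c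
  + k2 * defect_rest e k2 a c.
Proof.
move=> hb hd hs.
have E1 : (e * (2 * s * (b * d))) ^+ 2 = e ^+ 2 * defect_h a c.
  rewrite (_ : _ ^+ 2 = e ^+ 2 * (4 * s ^+ 2 * b ^+ 2 * d ^+ 2)); last by ring.
  by rewrite hb hd hs /defect_h; ring.
have E2 : (e * (8 * (2 * a * b) + 2 * (b * c))) ^+ 2 =
    e ^+ 2 * ((1 - a ^+ 2) * (16 * a + 2 * c) ^+ 2) by rewrite -hb; ring.
have E3 : (e * (2 * s * (a * d))) ^+ 2 = e ^+ 2 * (12 * a ^+ 2 * (1 - c ^+ 2)).
  rewrite -hd (_ : _ ^+ 2 = e ^+ 2 * (4 * s ^+ 2 * a ^+ 2 * d ^+ 2)); last by ring.
  by rewrite hs; ring.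
have E4 : (e * (6 * (b * c))) ^+ 2 = e ^+ 2 * (36 * (1 - a ^+ 2) * c ^+ 2).
  by rewrite -hb; ring.
have E5 : (e * (6 * s * (a * d))) ^+ 2 = e ^+ 2 * (108 * a ^+ 2 * (1 - c ^+ 2)).
  rewrite -hd (_ : _ ^+ 2 = e ^+ 2 * (36 * s ^+ 2 * a ^+ 2 * d ^+ 2)); last by ring.
  by rewrite hs; ring.
rewrite E1 E2 E3 E4 E5 /defect_rest /defect_A /defect_B /defect_Psi /defect_F.
rewrite /defect_p /defect_q /defect_h.
ring.
Qed.

(** Cosine expansions of the terms of orders 1, 2 and 3 in [e], as coefficients with frequencies.
    The frequency [(0, 0)], which carries the mean, is absent from all three lists; its coefficient
    at order 3 is kept apart. *)
Definition hexlist1 : seq (int * (nat * nat)) := [:: (128, (1, 1)%N); (64, (2, 0)%N)]%R.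
Definition hexlist2 : seq (int * (nat * nat)) :=
  [:: (24, (0, 2)%N); (80, (1, 1)%N); (40, (2, 0)%N); (-128, (2, 2)%N); (48, (3, 1)%N);
      (-64, (4, 0)%N)]%R.
Definition hexlist3 : seq (int * (nat * nat)) :=
  [:: (-24, (0, 2)%N); (208, (1, 1)%N); (-40, (1, 3)%N); (104, (2, 0)%N); (-56, (2, 2)%N);
      (-48, (3, 1)%N); (-16, (3, 3)%N); (-28, (4, 0)%N); (-40, (4, 2)%N); (-40, (5, 1)%N);
      (-8, (6, 0)%N)]%R.

(* Grouping by powers of e after expanding [expR (e * F)] to third order: only the coefficient of
   e^3 has a nonzero mean, namely -12. *)
Lemma hexsum_defect (x : V) : let a := cosx 1 i0 x in let c := cosx (sqrt3 R) i1 x in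
  [/\ 64 * defect_F a c = hexsum hexlist1 x,
      64 * defect_F a c ^+ 2 + defect_A a c = hexsum hexlist2 x &
      32 * defect_F a c ^+ 3 + defect_F a c * defect_A a c - 2 * defect_B a c =
        - 12 + hexsum hexlist3 x].
Proof.
move=> a c; rewrite /hexsum /hexlist1 /hexlist2 /hexlist3 !big_cons !big_nil.
rewrite !hexwave_cheb /= -/i0 -/i1 -/a -/c /cheb /=.
rewrite /defect_A /defect_B /defect_Psi /defect_F /defect_p /defect_q /defect_h.
move: a c => a c.
split; ring.
Qed.

Lemma defect_bounds (e k2 a c : R) : 0 < e -> e <= 1 / 10 -> 0 <= k2 -> k2 <= 1 ->
  `|a| <= 1 -> `|c| <= 1 ->
  [/\ `|defect_F a c| <= 3, `|defect_A a c| <= 2000, `|defect_B a c| <= 1000 &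
      `|defect_rest e k2 a c| <= 1000].
Proof.
move=> e0 e1 k0 k1 a1 c1.
have a2 : 0 <= a ^+ 2 <= 1 by rewrite sqr_ge0 -[leLHS]ger0_norm ?sqr_ge0 // normrX exprn_ile1.
have c2 : 0 <= c ^+ 2 <= 1 by rewrite sqr_ge0 -[leLHS]ger0_norm ?sqr_ge0 // normrX exprn_ile1.
have ac : `|a * c| <= 1 by rewrite normrM mulr_ile1.
move: a2 c2 => /andP[a20 a21] /andP[c20 c21].
move: (ac); rewrite ler_norml => /andP[ac1 ac2].
have F3 : `|defect_F a c| <= 3 by rewrite /defect_F ler_norml; lra.
have p6 : `|defect_p a c| <= 6 by rewrite /defect_p ler_norml; lra.
have q6 : `|defect_q a c| <= 6 by rewrite /defect_q ler_norml; lra.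
have h0 : 0 <= defect_h a c by rewrite /defect_h !mulr_ge0 // subr_ge0.
have h12 : defect_h a c <= 12.
  rewrite /defect_h -mulrA -[leRHS]mulr1 ler_wpM2l // mulr_ile1 ?subr_ge0 //; lra.
have hn : `|defect_h a c| <= 12 by rewrite ger0_norm.
have sq (x X : R) : 0 <= X -> `|x| <= X -> 0 <= x ^+ 2 <= X ^+ 2.
  by move=> X0 hx; rewrite sqr_ge0 -(real_normK (num_real x)) lerXn2r ?nnegrE.
have /andP[p20 p21] := sq _ 6 ltac:(by []) p6.
have /andP[q20 q21] := sq _ 6 ltac:(by []) q6.
have P0 : 0 <= defect_Psi a c by rewrite /defect_Psi; lra.
have P1 : defect_Psi a c <= 96 by rewrite /defect_Psi; lra.
have t1 : `|16 * a + 2 * c| <= 18.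
  move: a1 c1; rewrite !ler_norml => /andP[? ?] /andP[? ?]; lra.
have /andP[t10 t11] := sq _ 18 ltac:(by []) t1.
have T1 : 0 <= (1 - a ^+ 2) * (16 * a + 2 * c) ^+ 2 <= 18 ^+ 2.
  rewrite mulr_ge0 ?subr_ge0 //= -[leRHS]mul1r ler_pM ?subr_ge0 //; lra.
have T2 : 0 <= a ^+ 2 * (1 - c ^+ 2) <= 1.
  rewrite mulr_ge0 ?subr_ge0 //= mulr_ile1 ?subr_ge0 //; lra.
have T3 : 0 <= (1 - a ^+ 2) * c ^+ 2 <= 1.
  rewrite mulr_ge0 ?subr_ge0 //= mulr_ile1 ?subr_ge0 //; lra.
split => //.
- rewrite /defect_A -!(mulrA 36) -!(mulrA 108) ler_norml.
  move: T1 T2 T3 => /andP[? ?] /andP[? ?] /andP[? ?]; lra.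
- have n3 : `|3 : R| <= 3 by rewrite ger0_norm.
  have c3 (x : R) : `|x| <= 6 -> `|x ^+ 3| <= 6 ^+ 3 by move=> hx; rewrite normrX lerXn2r ?nnegrE.
  have := normr_add_le (normr_add_le (c3 _ p6)
    (normr_mul_le (normr_mul_le n3 (normr_add_le p6 q6)) hn)) (c3 _ q6).
  move=> /le_trans; apply; lra.
- rewrite /defect_rest ler_norml.
  move: F3; rewrite ler_norml => /andP[f1 f2].
  have eF : `|e * defect_F a c| <= 1 / 10 * 3.
    by apply: normr_mul_le; [rewrite ger0_norm // ltW|rewrite ler_norml f1].
  have kF : `|k2 * (e * defect_F a c)| <= 1 * (1 / 10 * 3).
    by apply: normr_mul_le => //; rewrite ger0_norm.
  have eP : 0 <= e ^+ 2 * defect_Psi a c <= 1 * 96.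
    rewrite mulr_ge0 ?sqr_ge0 //= ler_pM ?sqr_ge0 // expr_le1 //; lra.
  have kk : 0 <= k2 ^+ 2 <= 1 by rewrite sqr_ge0 expr_le1.
  rewrite -!mulrA in eF kF *.
  move: eF kF eP kk; rewrite !ler_norml => /andP[? ?] /andP[? ?] /andP[? ?] /andP[? ?].
  lra.
Qed.

End example2.

(** 192, 384 and 612 are the sums of the absolute values of the coefficients in the three lists;
    together they make 1188, rounded up to 1200. Since [k] is [e ^+ 3], the errors of the means are
    of order [e ^+ 4] like the Taylor remainder, and both have to be beaten by [12 * e ^+ 3]. *)
Lemma defect_sum_lt0 (R : realType) (e M z1 z2 z3 : R) : 0 < e -> e <= 1 / 10 -> 0 < M ->
  z1 <= 192%:R * (e ^+ 3 * M) -> z2 <= 384%:R * (e ^+ 3 * M) -> z3 <= 612%:R * (e ^+ 3 * M) ->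
  e * (40 * 1000 + 1200) < 12 ->
  e * z1 + e ^+ 2 * z2 + e ^+ 3 * z3 + (40 * 1000 * e ^+ 4 - 12 * e ^+ 3) * M < 0.
Proof.
move=> e0 e1 M0 h1 h2 h3 small.
have W0 : 0 < e ^+ 3 * M by rewrite mulr_gt0 // exprn_gt0.
have e2 : e ^+ 2 <= e by rewrite expr2 ger_pMr //; apply: (le_trans e1); rewrite ler_pdivrMr // mul1r ler1n.
have e3 : e ^+ 3 <= e by rewrite exprS ger_pMr // (le_trans e2) //; apply: (le_trans e1); rewrite ler_pdivrMr // mul1r ler1n.
set W := e ^+ 3 * M in W0 h1 h2 h3.
have nW n : 0 <= n%:R * W by apply: mulr_ge0; [exact: ler0n|exact: ltW].
have g1 : e * z1 <= e * (192%:R * W) by rewrite ler_wpM2l // ltW.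
have g2 : e ^+ 2 * z2 <= e * (384%:R * W).
  apply: (@le_trans _ _ (e ^+ 2 * (384%:R * W))); first by apply: ler_wpM2l; [rewrite exprn_ge0 // ltW|].
  by apply: ler_wpM2r; [exact: nW|exact: e2].
have g3 : e ^+ 3 * z3 <= e * (612%:R * W).
  apply: (@le_trans _ _ (e ^+ 3 * (612%:R * W))); first by apply: ler_wpM2l; [rewrite exprn_ge0 // ltW|].
  by apply: ler_wpM2r; [exact: nW|exact: e3].
rewrite (_ : (40 * 1000 * e ^+ 4 - 12 * e ^+ 3) * M = 40 * 1000 * (e * W) - 12 * W); last first.
  by rewrite /W; ring.
have g4 : e * (40 * 1000 + 1200) * W < 12 * W by rewrite ltr_pM2r.
have eW : 0 < e * W by rewrite mulr_gt0.
move: (e * z1) (e ^+ 2 * z2) (e ^+ 3 * z3) g1 g2 g3 => y1 y2 y3 g1 g2 g3.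
have E1 n : e * (n%:R * W) = n%:R * (e * W) by ring.
have E2 : e * (40 * 1000 + 1200) * W = 40 * 1000 * (e * W) + 1200 * (e * W) by ring.
move: g1 g2 g3 g4; rewrite !E1 E2; move: (e * W) eW W0 => Z Z0 W0; clear -Z0 W0; clearbody W; lra.
Qed.

(** * Negativity of 16 I - 8 Q + D for the perturbed Gaussian *)

Section example3.
Variable R : realType.
Let i0 : 'I_2 := ord0.
Let i1 : 'I_2 := lift ord0 ord0.
Let V := 'rV[R]_2.
Let s3 : R := sqrt3 R.

Lemma wave_values (x : V) : let a := cosx 1 i0 x in let b := sinx 1 i0 x in
  let c := cosx s3 i1 x in let d := sinx s3 i1 x in
  [/\ cosx 2 i0 x = 2 * a ^+ 2 - 1, cosx 0 i1 x = 1, sinx 2 i0 x = 2 * a * b &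
      sinx 0 i1 x = 0] /\ [/\ b ^+ 2 = 1 - a ^+ 2 & d ^+ 2 = 1 - c ^+ 2].
Proof.
have h (y : R) : sin y ^+ 2 = 1 - cos y ^+ 2 by rewrite -(cos2Dsin2 y) addrC addKr.
rewrite /cosx /sinx /=; split; split; rewrite ?mul0r ?cos0 ?sin0 ?mul1r //.
- rewrite mulrC mulr_natr mulr2n cosD -!expr2 h; ring.
- rewrite mulrC mulr_natr mulr2n sinD; ring.
Qed.

Lemma phi3E (x : V) : phi3 x = defect_F (cosx 1 i0 x) (cosx s3 i1 x).
Proof.
have [[v1 v2 _ _] _] := wave_values x.
have -> : phi3 x = 1 * (cosx 2 i0 x * cosx 0 i1 x) + 2 * (cosx 1 i0 x * cosx s3 i1 x) by [].
by rewrite v1 v2 mulr1 mul1r.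
Qed.

Variables (e k : R).
Hypotheses (e0 : 0 < e) (e1 : e <= 1 / 10) (k0 : 0 < k) (ke : k = e ^+ 3).

Let u := wave_log e k.
Let f (x : V) := expR (u x).

Let k2le : k ^+ 2 <= e ^+ 6. Proof. by rewrite ke -exprM. Qed.
Let k21 : k ^+ 2 <= 1.
Proof.
have e11 : e <= 1 by apply: (le_trans e1); rewrite ler_pdivrMr // mul1r ler1n.
exact: le_trans k2le (exprn_ile1 6 (ltW e0) e11).
Qed.

Let bounds (x : V) := defect_bounds e0 e1 (sqr_ge0 k) k21
  (@cosx_le1 _ _ 1 i0 x) (@cosx_le1 _ _ s3 i1 x).

Lemma decays_wave : decays f.
Proof.
apply: (@decays_gauss _ _ (e * 3) (k ^+ 2 / 2)); first by rewrite divr_gt0 // exprn_gt0.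
move=> x; rewrite /u /wave_log /gauss_log mulNr lerD2r ler_wpM2l ?(ltW e0) //.
by rewrite phi3E; have [F3 _ _ _] := bounds x; apply: le_trans F3; exact: ler_norm.
Qed.

Let tu : tame u := tame_wave_log e k.

Let hessE i j F x : partial i (partial j (@phi3 R)) = F ->
  hess f x i j = - (e * F x - k ^+ 2 * (i == j)%:R).
Proof.
move=> E; apply: etrans (hess_expR u x i j) _.
by rewrite /u wave_log_hess E.
Qed.

Let gradE i j l F x : partial l (partial i (partial j (@phi3 R))) = F ->
  grad_hess f x i j l = - (e * F x).
Proof.
move=> E; apply: etrans (grad_hess_expR x i j l tu.1) _.
by rewrite /u wave_log_third E.
Qed.

Lemma wave_hess_values (x : V) : let a := cosx 1 i0 x in let b := sinx 1 i0 x in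
  let c := cosx s3 i1 x in let d := sinx s3 i1 x in
  [/\ hess f x i0 i0 = - (e * defect_p a c - k ^+ 2),
      hess f x i0 i1 = - (e * (2 * s3 * (b * d))),
      hess f x i1 i0 = - (e * (2 * s3 * (b * d))) &
      hess f x i1 i1 = - (e * defect_q a c - k ^+ 2)].
Proof.
move=> a b c d; have [[v1 v2 v3 v4] _] := wave_values x.
have [g1 g2 g3 g4] := phi3_hess R.
rewrite (hessE x g1) (hessE x g2) (hessE x g3) (hessE x g4) /=.
rewrite /lc2 /wcc /wss /wave -/i0 -/i1 v1 v2 v3 v4 -/s3 -/a -/b -/c -/d.
rewrite /defect_p /defect_q.
move: (s3) a b c d => s a b c d; split; ring.
Qed.

Lemma defect_integrandE (x : V) : let a := cosx 1 i0 x in let c := cosx s3 i1 x in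
  16 * I_integrand f x - 8 * Q_integrand f x + D_integrand f x =
  (64 * e * defect_F a c + e ^+ 2 * defect_A a c - 2 * e ^+ 3 * defect_B a c
   + k ^+ 2 * defect_rest e (k ^+ 2) a c) * f x.
Proof.
move=> a c; rewrite (I_integrandE f x) (Q_integrandE f x) (D_integrandE f x).
have [h1 h2 h3 h4] := wave_hess_values x.
have [[v1 v2 v3 v4] [vb vd]] := wave_values x.
have [[t1 t2 t3 t4] [t5 t6 t7 t8]] := phi3_third R.
have T1 := gradE x t1; have T2 := gradE x t2; have T3 := gradE x t3; have T4 := gradE x t4.
have T5 := gradE x t5; have T6 := gradE x t6; have T7 := gradE x t7; have T8 := gradE x t8.
rewrite (log_convexity_defect _ h1 h2 h3 h4 T1 T2 T3 T4 T5 T6 T7 T8).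
congr (_ * _).
rewrite -(defect_poly e (k ^+ 2) vb vd (sqr_sqrt3 R)).
rewrite /lc2 /wsc /wcs /wave -/i0 -/i1 v1 v2 v3 v4 -/s3.
move: (defect_p _ _) (defect_q _ _) (k ^+ 2) => p q k2.
rewrite -/a -/c; move: (sinx 1 i0 x) (sinx s3 i1 x) s3 a c => b d s a c.
ring.
Qed.

Lemma defect_integrand_le (x : V) :
  16 * I_integrand f x - 8 * Q_integrand f x + D_integrand f x <=
  (e * hexsum hexlist1 x + e ^+ 2 * hexsum hexlist2 x
   + e ^+ 3 * (- 12 + hexsum hexlist3 x) + 40 * 1000 * e ^+ 4) * gauss k x.
Proof.
rewrite defect_integrandE.
have [F3 A1 B1 r1] := bounds x.
have [p1 p2 p3] := hexsum_defect x.
have -> : f x = expR (e * defect_F (cosx 1 i0 x) (cosx s3 i1 x)) * gauss k x.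
  by rewrite /f /u /wave_log expRD phi3E.
rewrite mulrA ler_wpM2r ?expR_ge0 //.
rewrite -p1 -p2 -p3; apply: wave_remainder => //; first exact: sqr_ge0.
apply: expR_taylor2; rewrite normrM (ger0_norm (ltW e0)).
apply: (@le_trans _ _ (1 / 10 * 3)); last by lra.
by rewrite ler_pM // ltW.
Qed.

Let du := decays_wave.

Lemma defect_lt0 : e * (40 * 1000 + 1200) < 12 ->
  16 * Ifun f - 8 * Qfun f + Dfun f < 0.
Proof.
move=> small.
have LI := expR_I_L1 tu du; have LQ := expR_Q_L1 tu du; have LD := expR_D_L1 tu du.
have Lg : rV_L1 (@gauss R 2 k) by apply: expR_L1; [exact: tame_gauss_log|exact: decays_gauss_log].
have M0 : 0 < iint (@gauss R 2 k).
  apply: iint_gt0 => //; last exact: expR_gt0.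
    exact: smooth_continuous (smooth_expR (tame_gauss_log _ k).1).
  by move=> x; exact: expR_ge0.
pose h l (x : V) := hexsum l x * gauss k x.
have Lh l : rV_L1 (h l) by apply: tame_gauss_L1 => //; exact: tame_hexsum.
have E : 16 * Ifun f - 8 * Qfun f + Dfun f =
   iint (fun x => 16 * I_integrand f x - 8 * Q_integrand f x + D_integrand f x).
  rewrite iintD //; last by apply: rV_L1B; exact: rV_L1Z.
  by rewrite iintB ?iintZ //; exact: rV_L1Z.
rewrite E.
apply: (@le_lt_trans _ _ (iint (fun x => e * h hexlist1 x + e ^+ 2 * h hexlist2 x
   + e ^+ 3 * h hexlist3 x + (40 * 1000 * e ^+ 4 - 12 * e ^+ 3) * gauss k x))).
  apply: le_iint.
  - apply: rV_L1D => //; apply: rV_L1B; exact: rV_L1Z.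
  - by do 3 (apply: rV_L1D; last exact: rV_L1Z); exact: rV_L1Z.
  move=> x; apply: (le_trans (defect_integrand_le x)); rewrite /h.
  by move: (hexsum _ _) (hexsum _ _) (hexsum _ _) (gauss _ _) => z1 z2 z3 z4;
    rewrite le_eqVlt; apply/orP; left; apply/eqP; ring.
rewrite iintD; [|by do 2 (apply: rV_L1D; last exact: rV_L1Z); exact: rV_L1Z|exact: rV_L1Z].
rewrite iintD; [|by apply: rV_L1D; exact: rV_L1Z|exact: rV_L1Z].
rewrite iintD; [|exact: rV_L1Z|exact: rV_L1Z].
rewrite (iintZ e (Lh hexlist1)) (iintZ (e ^+ 2) (Lh hexlist2)) (iintZ (e ^+ 3) (Lh hexlist3)).
rewrite (iintZ _ Lg).
have g1 := @hexsum_mean R k hexlist1 k0 isT.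
have g2 := @hexsum_mean R k hexlist2 k0 isT.
have g3 := @hexsum_mean R k hexlist3 k0 isT.
apply: (defect_sum_lt0 e0 e1 M0 _ _ _ small); rewrite -ke.
- exact: g1.
- exact: g2.
- exact: g3.
Qed.

Lemma wave_Qfun_gt0 : 0 < Qfun f.
Proof.
have sf : smooth f := smooth_expR tu.1.
have fp (x : V) : 0 < f x by exact: expR_gt0.
apply: iint_gt0.
- exact: smooth_continuous (smooth_Q_integrand sf fp).
- exact: expR_Q_L1 tu du.
- by move=> x; exact: Q_integrand_ge0.
- rewrite (Q_integrandE f 0); have [h1 h2 h3 h4] := wave_hess_values 0.
  rewrite /Q_of !big_ord_recl !big_ord0 -/i0 -/i1 h1 h2 h3 h4.
  apply: mulr_gt0; last exact: fp.
  have a1 : cosx 1 i0 (0 : V) = 1 by rewrite /cosx mxE mulr0 cos0.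
  have c1 : cosx s3 i1 (0 : V) = 1 by rewrite /cosx mxE mulr0 cos0.
  rewrite a1 c1.
  have A0 : 0 < 6 * e + k ^+ 2 by rewrite addr_gt0 ?mulr_gt0 // exprn_gt0.
  have -> : - (e * defect_p 1 1 - k ^+ 2) = 6 * e + k ^+ 2 by rewrite /defect_p; ring.
  have A1 : 0 < (6 * e + k ^+ 2) * (6 * e + k ^+ 2) by rewrite mulr_gt0.
  rewrite !addr0 -addrA ltr_pwDl // -!expr2.
  by rewrite !addr_ge0 ?sqr_ge0.
Qed.

End example3.

Lemma log_convexity_counterexample (R : realType) :
  exists2 f : 'rV[R]_2 -> R, admissible f & 16 * Ifun f - 8 * Qfun f + Dfun f < 0.
Proof.
(* Any [e] with [41200 * e < 12] will do, besides [e <= 1 / 10]. *)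
pose e : R := (100 * 100)^-1.
have e0 : 0 < e by rewrite invr_gt0 mulr_gt0.
have he : e * (100 * 100) = 1 by rewrite mulVf // mulf_neq0.
have e1 : e <= 1 / 10 by lra.
have small : e * (40 * 1000 + 1200) < 12 by lra.
have k0 : 0 < e ^+ 3 by rewrite exprn_gt0.
have tu := tame_wave_log e (e ^+ 3).
have du := decays_wave e0 e1 k0 erefl.
have J := defect_lt0 e0 e1 k0 erefl small.
have Q0 := wave_Qfun_gt0 e0 e1 k0 erefl.
have [c c0 [ad EI EQ ED]] := @normalize_admissible R 2 _ (smooth_expR tu.1) (fun x => expR_gt0 _)
  (rapidly_decaying_expR tu du) (expR_I_L1 tu du) (expR_Q_L1 tu du) (expR_D_L1 tu du) Q0.
exists (fun x => c * expR (wave_log e (e ^+ 3) x)); first exact: ad.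
rewrite EI EQ ED.
move: (Ifun _) (Qfun _) (Dfun _) J => a b d J.
rewrite (_ : _ + _ = c * (16 * a - 8 * b + d)); last by ring.
by rewrite pmulr_rlt0.
Qed.

(** * Raising the dimension *)

Section tail_coordinates.
Variables (R : realType) (n : nat).
Notation V := 'rV[R]_n.+1.

Definition tailv (x : V) : 'rV[R]_n := @rsubmx R 1 1 n x.

Lemma tailvE x j : tailv x 0 j = x 0 (lift ord0 j).
Proof. by rewrite mxE; congr (x 0 _); exact: val_inj. Qed.

Lemma tailv_vcons (t : R) y : tailv (vcons t y) = y.
Proof. by apply/rowP => j; rewrite tailvE mxE liftK. Qed.

Lemma headv_vcons (t : R) (y : 'rV[R]_n) : vcons t y 0 ord0 = t.
Proof. by rewrite mxE unlift_none. Qed.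

Lemma tailv_line (h : R) i (x : V) :
  tailv (h *: delta_mx 0 i + x) = h *: tailv (delta_mx 0 i) + tailv x.
Proof. by apply/rowP => j; rewrite !mxE. Qed.

Lemma tailv_delta0 : tailv (delta_mx 0 ord0) = 0.
Proof. by apply/rowP => j; rewrite tailvE !mxE. Qed.

Lemma tailv_delta j : tailv (delta_mx 0 (lift ord0 j)) = delta_mx 0 j.
Proof. by apply/rowP => k; rewrite tailvE !mxE (inj_eq lift_inj). Qed.

Lemma diffable_tailv (f : 'rV[R]_n -> R) : diffable f -> diffable (fun x => f (tailv x)).
Proof.
move=> df x; apply: (@differentiable_comp _ _ _ _ tailv f); last exact: df.
exact: (@differentiable_rsubmx _ _ 1 n x).
Qed.

Local Transparent partial.
Lemma partial_tailv i (f : 'rV[R]_n -> R) :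
  partial (lift ord0 i) (fun x => f (tailv x)) = fun x => partial i f (tailv x).
Proof.
apply/funext => x; rewrite /partial /derive.
by under eq_fun do rewrite /= tailv_line tailv_delta.
Qed.

Lemma partial0_tailv (f : 'rV[R]_n -> R) : partial ord0 (fun x => f (tailv x)) = fun _ => 0.
Proof.
apply/funext => x; rewrite /partial /derive.
under eq_fun do rewrite /= tailv_line tailv_delta0 scaler0 add0r subrr scaler0.
exact: lim_cst.
Qed.
Local Opaque partial.

Lemma norm_tailv (x : V) : `|x| <= `|x 0 ord0| + `|tailv x|.
Proof.
rewrite [leLHS]/Num.norm /= mx_normrE; apply/bigmax_leP; split => [|[a i] _ /=].
  by rewrite addr_ge0.
rewrite (ord1 a); case: (unliftP ord0 i) => [j ->|->]; last by rewrite lerDl.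
by rewrite -tailvE (le_trans (coord_le_norm _ _)) // lerDr.
Qed.

Lemma rV_L1_tensor (A : 'rV[R]_n -> R) (B : R -> R) : rV_L1 A ->
  (@lebesgue_measure R).-integrable setT (EFin \o B) ->
  rV_L1 (fun x : V => A (tailv x) * B (x 0 ord0)) /\
  iint (fun x : V => A (tailv x) * B (x 0 ord0)) =
   iint A * \int[@lebesgue_measure R]_t B t.
Proof.
move=> LA LB.
have mB : measurable_fun setT (B : measurableTypeR R -> R).
  by move/integrableP : LB => [/measurable_EFinP].
have mA := rV_L1_measurable LA.
split; last first.
  rewrite /= -(RintegralZl (iint A)) //; apply: eq_Rintegral => t _.
  by under eq_fun do rewrite tailv_vcons headv_vcons mulrC; rewrite iintZ // mulrC.
have mF : rV_measurable (fun x : V => A (tailv x) * B (x 0 ord0)).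
  apply: (@eq_measurable_fun _ _ _ _ _ (fun z : chart R n.+1 =>
    A (chart_map z.2) * B z.1)).
    by move=> z _ /=; rewrite tailv_vcons headv_vcons.
  apply: measurable_funM; first exact: (measurableT_comp mA measurable_snd).
  exact: (measurableT_comp mB measurable_fst).
apply/(Rn_integrableE mF); rewrite /Rn_integrable /=.
have LnA : rV_L1 (fun y => `|A y|) by exact: integrable_norm LA.
under eq_integral => t _.
  rewrite (_ : iint_nn _ = (iint (fun y => `|A y|) * `|B t|)%:E); last first.
    under eq_fun do rewrite tailv_vcons headv_vcons normrM mulrC -[_ * _]ger0_norm ?mulr_ge0 //.
    rewrite iint_nn_iint; first by rewrite iintZ // mulrC.
      exact: rV_L1Z.
    by move=> y; rewrite mulr_ge0.
  over.
have LnB : (@lebesgue_measure R).-integrable setT (EFin \o (fun t => `|B t|)).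
  exact: integrable_norm LB.
have := @integrableZl _ _ _ _ _ measurableT (iint (fun y => `|A y|)) _ LnB.
move=> /integrableP[_]; apply: le_lt_trans; apply: ge0_le_integral => //.
- by move=> t _; rewrite lee_fin mulr_ge0 // iint_ge0.
- apply/measurable_EFinP; apply: measurable_funM; first exact: measurable_cst.
  exact: measurableT_comp.
- apply: measurableT_comp => //; apply/measurable_EFinP.
  apply: measurable_funM; first exact: measurable_cst.
  exact: measurableT_comp.
- by move=> t _ /=; rewrite lee_fin ler_norm.
Qed.

End tail_coordinates.

Section gauss1.
Variable R : realType.
Variable b : R.
Hypothesis b0 : 0 < b.

Definition gauss1 (t : R) : R := expR (- (b / 2) * t ^+ 2).

Lemma sqnorm1 (x : 'rV[R]_1) : sqnorm x = x 0 0 ^+ 2.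
Proof. by rewrite /sqnorm big_ord_recl big_ord0 addr0. Qed.

Let u (x : 'rV[R]_1) : R := - (b / 2) * sqnorm x.

Let du : decays (fun x => expR (u x)).
Proof.
apply: (@decays_gauss _ _ 0 (b / 2)); first by rewrite divr_gt0.
by move=> x; rewrite /u sub0r mulNr.
Qed.

Lemma gauss1_bound k : exists C, forall t, `|t| ^+ k * gauss1 t <= C.
Proof.
have [C h] := du k; exists C => t; have := h (const_mx t); rewrite /u sqnorm1 mxE -/(gauss1 t).
apply: le_trans; rewrite [X in _ <= _ * X]ger0_norm ?expR_ge0 // ler_wpM2r ?expR_ge0 //.
rewrite lerXn2r ?nnegrE //.
by have := coord_le_norm (const_mx t : 'rV[R]_1) 0; rewrite mxE.
Qed.

Lemma gauss1_integrable : (@lebesgue_measure R).-integrable setT (EFin \o gauss1).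
Proof.
have [C0 h0] := gauss1_bound 0; have [C2 h2] := gauss1_bound 2.
have mg : measurable_fun setT (gauss1 : measurableTypeR R -> R).
  apply: measurable_funTS; apply: measurableT_comp => //.
  by apply: measurable_funM => //; apply: measurable_funX.
have L : (@lebesgue_measure R).-integrable setT
    (fun t => (C0 + C2)%:E * (EFin \o (fun t : R => (1 + t ^+ 2)^-1)%R) t)%E.
  by apply: (integrableZl measurableT); exact: cauchy_weight_integrable.
apply: le_integrable L => //; first exact/measurable_EFinP.
move=> t _ /=; rewrite lee_fin ger0_norm ?expR_ge0 // (le_trans _ (ler_norm _)) //.
rewrite ler_pdivlMr ?ltr_pwDl ?sqr_ge0 // mulrDr mulr1 lerD //.
  by have := h0 t; rewrite expr0 mul1r.
by have := h2 t; rewrite real_normK ?num_real // mulrC.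
Qed.

Lemma gauss1_int_gt0 : 0 < \int[@lebesgue_measure R]_t gauss1 t.
Proof.
have E : iint (fun x : 'rV[R]_1 => expR (u x)) = \int[@lebesgue_measure R]_t gauss1 t.
  by apply: eq_Rintegral => t _ /=; rewrite /u sqnorm1 headv_vcons.
rewrite -E; apply: iint_gt0.
- apply: smooth_continuous; apply: smooth_expR; apply: smoothM; first exact: smooth_cst.
  exact: (tame_sqnorm R 1).1.
- apply: decays_L1 => //; apply: smooth_continuous; apply: smooth_expR.
  apply: smoothM; first exact: smooth_cst.
  exact: (tame_sqnorm R 1).1.
- by move=> x; exact: expR_ge0.
- exact: expR_gt0.
Qed.
End gauss1.

(** * Tensor product with a one-dimensional Gaussian *)

Section tensor.
Variables (R : realType) (n : nat).
Notation V := 'rV[R]_n.+1.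
Variables (g : 'rV[R]_n -> R) (b : R).
Hypotheses (sg : smooth g) (g0 : forall y, 0 < g y) (rg : rapidly_decaying g).
Hypothesis b0 : 0 < b.

Let gl (x : V) : R := - (b / 2) * (x 0 ord0 ^+ 2).

Let tgl : tame gl.
Proof.
apply: gen_tame; apply: genM; first exact: gen_cst.
by apply: genX; apply: gen_base; exact: tame_coord.
Qed.

Let dgl := smooth_diffable tgl.1.

Let partial_gl j : partial j gl = fun x => - b * (j == ord0)%:R * x 0 ord0.
Proof.
have dc := @diffable_coord R n.+1 ord0.
rewrite (_ : gl = fun x => - (b / 2) * (x 0 ord0 * x 0 ord0)); last first.
  by apply/funext => x; rewrite /gl expr2.
rewrite partialZ; last exact: diffableM.
rewrite partialM // partial_coord; apply/funext => x.
by move: (_ == _)%:R (x 0 ord0) => a c; field.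
Qed.

Definition tensor_gauss (x : V) : R := g (tailv x) * gauss1 b (x 0 ord0).

Let w (x : V) : R := expR (gl x).

Let dw : diffable w. Proof. exact: smooth_diffable (smooth_expR tgl.1). Qed.

Lemma decays_tensor (G : 'rV[R]_n -> R) : decays G -> decays (fun x => G (tailv x) * w x).
Proof.
move=> dG k.
have [C0 h0] := dG 0; have [Ck hk] := dG k.
have [D0 e0] := gauss1_bound b0 0; have [Dk ek] := gauss1_bound b0 k.
exists (2 ^+ k * ((D0 + Dk) * (C0 + Ck))) => x.
set y := tailv x; set t := x 0 ord0.
have w0 : 0 <= w x by exact: expR_ge0.
rewrite normrM (ger0_norm w0).
have n1 : `|x| ^+ k <= 2 ^+ k * ((1 + `|t| ^+ k) * (1 + `|y| ^+ k)).
  have p (a c : R) : 0 <= a -> 0 <= c -> (a + c) ^+ k <= 2 ^+ k * ((1 + a ^+ k) * (1 + c ^+ k)).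
    move=> a0 c0; have ak : 0 <= a ^+ k by rewrite exprn_ge0.
    have ck : 0 <= c ^+ k by rewrite exprn_ge0.
    have [ac|/ltW ac] := leP a c.
      apply: (@le_trans _ _ ((2 * c) ^+ k)).
        by rewrite lerXn2r ?nnegrE ?addr_ge0 ?mulr_ge0 // mulr_natl mulr2n lerD2r.
      rewrite exprMn ler_wpM2l ?exprn_ge0 // -[leLHS]mul1r ler_pM // ?lerDl ?lerDr //.
    apply: (@le_trans _ _ ((2 * a) ^+ k)).
      by rewrite lerXn2r ?nnegrE ?addr_ge0 ?mulr_ge0 // mulr_natl mulr2n lerD2l.
    by rewrite exprMn ler_wpM2l ?exprn_ge0 // -[leLHS]mulr1 ler_pM // ?lerDl ?lerDr.
  apply: le_trans (p _ _ (normr_ge0 t) (normr_ge0 y)).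
  by rewrite lerXn2r ?nnegrE ?addr_ge0 // norm_tailv.
have n2 : (1 + `|t| ^+ k) * w x <= D0 + Dk.
  rewrite mulrDl mul1r; apply: lerD; last exact: (ek t).
  by have := e0 t; rewrite expr0 mul1r.
have n3 : (1 + `|y| ^+ k) * `|G y| <= C0 + Ck.
  rewrite mulrDl mul1r lerD //.
  by have := h0 y; rewrite expr0 mul1r.
have z1 : 0 <= `|G y| * w x by rewrite mulr_ge0.
apply: (le_trans (ler_wpM2r z1 n1)).
rewrite -mulrA ler_wpM2l ?exprn_ge0 //.
rewrite [leLHS](_ : _ = ((1 + `|t| ^+ k) * w x) * ((1 + `|y| ^+ k) * `|G y|)); last by ring.
by apply: ler_pM => //; rewrite mulr_ge0 // addr_ge0 ?exprn_ge0.
Qed.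

(** A class that contains the tensor product, is closed under partial derivatives and consists of
    decaying functions. The first factor runs through the derivatives of [g], whose decay is
    assumed; the polynomials that the Gaussian produces are absorbed by [q]. *)
Inductive tensor_class : (V -> R) -> Prop :=
| tensor_base s q : tame q -> tensor_class (fun x => dparts s g (tailv x) * w x * q x)
| tensor_add h h' : tensor_class h -> tensor_class h' -> tensor_class (fun x => h x + h' x).

Let dg s : diffable (fun x => dparts s g (tailv x)).
Proof. exact/diffable_tailv/smooth_diffable/smooth_dparts. Qed.

Let tensor_diffable h : tensor_class h -> diffable h.
Proof.
elim => [s q [sq _]|? ? _ ? _ ?]; last exact: diffableD.
by apply: diffableM; [exact: diffableM|exact: smooth_diffable].
Qed.

Let tensor_decays h : tensor_class h -> decays h.
Proof.
elim => [s q tq|? ? _ ? _ ?]; last exact: decaysD.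
have [C [m [C0 h1]]] := polygrowth_ge0 (tq.2 [::]).
have dG : decays (dparts s g) by move=> k; exact: rg.
apply: (le_decays (c := C) (k := m) (decays_tensor dG)) => x.
by rewrite normrM mulrC ler_wpM2r // h1.
Qed.

Let tensor_partial h : tensor_class h -> forall i, tensor_class (partial i h).
Proof.
elim => [s q tq|h1 h2 t1 IH1 t2 IH2] i; last first.
  by rewrite partialD; [exact: tensor_add|exact: tensor_diffable..].
have dq := smooth_diffable tq.1.
have dGw : diffable (fun x => dparts s g (tailv x) * w x) by exact: diffableM.
rewrite partialM // partialM // (partial_comp i dgl) //.
have T : tame (fun x => partial i q x + q x * (- b * (i == ord0)%:R * x 0 ord0)).
  apply: gen_tame; apply: genD; first exact/gen_base/tame_partial.
  apply: genM; first exact: gen_base.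
  by apply: genM; [exact: gen_cst|exact/gen_base/tame_coord].
have E : (fun x => dparts s g (tailv x) * w x * (partial i q x + q x * (- b * (i == ord0)%:R * x 0 ord0))
     + w x * partial i (fun x => dparts s g (tailv x)) x * q x) =
  (fun x => dparts s g (tailv x) * w x * partial i q x +
   q x * (dparts s g (tailv x) * (derive1 (@expR R) (gl x) * partial i gl x) +
     w x * partial i (fun x0 : V => dparts s g (tailv x0)) x)).
  apply/funext => x; rewrite derive1E derive_val partial_gl -/(w x).
  by move: (dparts s g _) (w x) (partial i q x) (q x) (x 0 ord0)
    (partial i (fun x => dparts s g (tailv x)) x) => ? ? ? ? ? ?; ring.
rewrite -E; apply: tensor_add; first exact: tensor_base.
(* For the direction of the new coordinate: the factor in the remaining coordinates is constant
   along it, and the resulting zero function is put into the class through a zero multiplier. *)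
have T2 : tame (fun x : V => 0 * q x).
  by apply: gen_tame; apply: genM; [exact: gen_cst|exact: gen_base].
case: (unliftP ord0 i) => [j ->|->].
  rewrite partial_tailv.
  have := @tensor_base (j :: s) q tq.
  rewrite (_ : (fun x => _) = fun x => w x * partial j (dparts s g) (tailv x) * q x) //.
  by apply/funext => x; rewrite /= [w x * _]mulrC.
rewrite partial0_tailv; have := @tensor_base s _ T2.
rewrite (_ : (fun x => _) = fun x => w x * 0 * q x) //.
by apply/funext => x; rewrite mulr0 mul0r mulr0.
Qed.

Let tensor0 : tensor_class tensor_gauss.
Proof.
have T : tame (fun _ : V => 1 : R) by apply: gen_tame; exact: gen_cst.
have := @tensor_base [::] _ T.
rewrite (_ : (fun x => _) = tensor_gauss) //.
by apply/funext => x; rewrite mulr1.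
Qed.

Lemma smooth_tensor : smooth tensor_gauss.
Proof. exact: smooth_class tensor_diffable tensor_partial _ tensor0. Qed.

Lemma rapidly_decaying_tensor : rapidly_decaying tensor_gauss.
Proof. by move=> s; exact: tensor_decays (dparts_class tensor_partial tensor0 s). Qed.

Lemma tensor_gt0 x : 0 < tensor_gauss x.
Proof. by rewrite mulr_gt0 // expR_gt0. Qed.

End tensor.

Section block_sums.
Variables (R : realType) (n : nat).
Variables (H : 'I_n.+1 -> 'I_n.+1 -> R) (H' : 'I_n -> 'I_n -> R) (b : R).
Variables (K : 'I_n.+1 -> 'I_n.+1 -> 'I_n.+1 -> R) (K' : 'I_n -> 'I_n -> 'I_n -> R).
Let l := lift (@ord0 n).
Hypotheses (Hll : forall i j, H (l i) (l j) = H' i j) (H0l : forall j, H ord0 (l j) = 0)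
  (Hl0 : forall i, H (l i) ord0 = 0) (H00 : H ord0 ord0 = b).
Hypotheses (Klll : forall i j k, K (l i) (l j) (l k) = K' i j k)
  (Kll0 : forall i j, K (l i) (l j) ord0 = 0)
  (Kl0 : forall i k, K (l i) ord0 k = 0) (K0 : forall j k, K ord0 j k = 0).

Lemma I_of_block a c : I_of H (a * c) = I_of H' a * c + b * a * c.
Proof.
rewrite /I_of big_ord_recl H00 (eq_bigr (fun i => H' i i)); last by move=> i _; exact: Hll.
ring.
Qed.

Lemma Q_of_block a c : Q_of H (a * c) = Q_of H' a * c + b ^+ 2 * a * c.
Proof.
rewrite /Q_of big_ord_recl big_ord_recl H00 big1 => [|j _]; last by rewrite H0l mul0r.
rewrite (eq_bigr (fun i => \sum_j H' i j * H' j i)) => [|i _]; first by ring.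
rewrite big_ord_recl Hl0 mul0r add0r; apply: eq_bigr => j _.
by rewrite -/l !Hll.
Qed.

Lemma D_of_block a c : D_of H K (a * c) = D_of H' K' a * c + 2 * b ^+ 3 * a * c.
Proof.
rewrite /D_of.
have -> : \sum_i \sum_j \sum_k K i j k ^+ 2 = \sum_i \sum_j \sum_k K' i j k ^+ 2.
  rewrite big_ord_recl big1 ?add0r => [|j _]; last first.
    by apply: big1 => k _; rewrite K0 expr0n.
  apply: eq_bigr => i _; rewrite big_ord_recl big1 ?add0r => [|k _]; last by rewrite Kl0 expr0n.
  apply: eq_bigr => j _; rewrite big_ord_recl -/l Kll0 expr0n add0r.
  by apply: eq_bigr => k _; rewrite Klll.
have -> : \sum_i \sum_j \sum_k H i j * H j k * H k i =
    b ^+ 3 + \sum_i \sum_j \sum_k H' i j * H' j k * H' k i.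
  rewrite big_ord_recl; congr (_ + _).
    rewrite big_ord_recl big_ord_recl H00 big1 => [|k _]; last by rewrite H0l mulr0 mul0r.
    rewrite big1 ?addr0 => [|j _]; first by ring.
    by apply: big1 => k _; rewrite H0l !mul0r.
  apply: eq_bigr => i _; rewrite big_ord_recl big1 ?add0r => [|k _]; last first.
    by rewrite Hl0 !mul0r.
  apply: eq_bigr => j _; rewrite big_ord_recl -/l Hl0 mulr0 mul0r add0r.
  by apply: eq_bigr => k _; rewrite !Hll.
ring.
Qed.
End block_sums.

Section tensor_hess.
Variables (R : realType) (n : nat).
Notation V := 'rV[R]_n.+1.
Variables (g : 'rV[R]_n -> R) (b : R).
Hypotheses (sg : smooth g) (g0 : forall y, 0 < g y) (rg : rapidly_decaying g).
Hypothesis b0 : 0 < b.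
Let l := lift (@ord0 n).
Let f := tensor_gauss g b.
Let lg y := ln (g y).
Let slg : smooth lg := smooth_ln sg g0.
Let dlg := smooth_diffable slg.

Let ln_tensor : (fun x => ln (f x)) = fun x : V => lg (tailv x) + - (b / 2) * (x 0 ord0 * x 0 ord0).
Proof.
by apply/funext => x; rewrite /f /tensor_gauss lnM ?posrE ?expR_gt0 // expRK expr2.
Qed.

Let dc : diffable (fun x : V => x 0 ord0) := @diffable_coord R n.+1 ord0.

Let partial_ln_tensor j : partial j (fun x => ln (f x)) =
  fun x => partial j (fun x : V => lg (tailv x)) x + (- b * (j == ord0)%:R) * x 0 ord0.
Proof.
have d1 : diffable (fun x : V => lg (tailv x)) by exact: diffable_tailv.
have d2 : diffable (fun x : V => x 0 ord0 * x 0 ord0) by exact: diffableM.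
have d3 : diffable (fun x : V => - (b / 2) * (x 0 ord0 * x 0 ord0)).
  by apply: diffableM => //; exact: diffable_cst.
rewrite ln_tensor (partialD _ d1 d3) (partialZ _ _ d2) (partialM _ dc dc) partial_coord.
apply/funext => x.
by move: (_ == _)%:R (x 0 ord0) (partial j _ x) => a c d; field.
Qed.

Let hess_add (i j : 'I_n.+1) (F : V -> R) : diffable F ->
  partial i (fun x => F x + (- b * (j == ord0)%:R) * x 0 ord0) =
  fun x => partial i F x + - b * (j == ord0)%:R * (i == ord0)%:R.
Proof.
move=> dF; have d2 : diffable (fun x : V => (- b * (j == ord0)%:R) * x 0 ord0).
  by apply: diffableM => //; exact: diffable_cst.
by rewrite (partialD _ dF d2) (partialZ _ _ dc) partial_coord.
Qed.

Let dF0 : diffable (fun _ : V => 0 : R) := @diffable_cst R n.+1 0.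

Lemma tensor_hess :
  [/\ forall i j, (fun x => hess f x (l i) (l j)) = (fun x => hess g (tailv x) i j),
      forall j, (fun x => hess f x ord0 (l j)) = (fun _ => 0),
      forall i, (fun x => hess f x (l i) ord0) = (fun _ => 0) &
      (fun x => hess f x ord0 ord0) = (fun _ => b)].
Proof.
have dj j : diffable (fun x : V => partial j lg (tailv x)).
  exact/diffable_tailv/smooth_diffable/smooth_partial.
split.
- move=> i j; rewrite hess_lnE partial_ln_tensor partial_tailv (hess_add _ _ (dj j)).
  rewrite partial_tailv; apply/funext => x.
  have /(congr1 (@^~ (tailv x))) /= -> := hess_lnE g i j.
  by rewrite /= !(mulr0, mul0r) addr0.
- move=> j; rewrite hess_lnE partial_ln_tensor partial_tailv (hess_add _ _ (dj j)).
  by rewrite partial0_tailv; apply/funext => x; rewrite /= !(mulr0, mul0r, addr0).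
- move=> i; rewrite hess_lnE partial_ln_tensor partial0_tailv (hess_add _ _ dF0).
  by rewrite partial_cst; apply/funext => x; rewrite /= !(mulr0, mul0r, addr0).
- rewrite hess_lnE partial_ln_tensor partial0_tailv (hess_add _ _ dF0).
  by rewrite partial_cst; apply/funext => x; rewrite /= !mulr1 add0r mulN1r opprK.
Qed.

Lemma tensor_hess_at x :
  [/\ forall i j, hess f x (l i) (l j) = hess g (tailv x) i j,
      forall j, hess f x ord0 (l j) = 0,
      forall i, hess f x (l i) ord0 = 0 &
      hess f x ord0 ord0 = b].
Proof.
have [h1 h2 h3 h4] := tensor_hess.
split => [i j|j|i|].
- exact: (congr1 (@^~ x) (h1 i j)).
- exact: (congr1 (@^~ x) (h2 j)).
- exact: (congr1 (@^~ x) (h3 i)).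
- exact: (congr1 (@^~ x) h4).
Qed.

Let grad_of i j k F x : (fun x => hess f x i j) = F -> grad_hess f x i j k = partial k F x.
Proof. by move=> <-. Qed.

Lemma tensor_grad_hess_at x :
  [/\ forall i j k, grad_hess f x (l i) (l j) (l k) = grad_hess g (tailv x) i j k,
      forall i j, grad_hess f x (l i) (l j) ord0 = 0,
      forall i k, grad_hess f x (l i) ord0 k = 0 &
      forall j k, grad_hess f x ord0 j k = 0].
Proof.
have [h1 h2 h3 h4] := tensor_hess.
split => [i j k|i j|i k|j k].
- by rewrite (grad_of _ _ (h1 i j)) (partial_tailv k (fun y => hess g y i j)).
- by rewrite (grad_of _ _ (h1 i j)) (partial0_tailv (fun y => hess g y i j)).
- by rewrite (grad_of _ _ (h3 i)) partial_cst.
- case: (unliftP ord0 j) => [j' ->|->].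
    by rewrite (grad_of _ _ (h2 j')) partial_cst.
  by rewrite (grad_of _ _ h4) partial_cst.
Qed.

(** The matrix H of the tensor product is block diagonal, with the constant entry [b] in the new
    direction. That entry adds its first, second and third powers to the traces and nothing to the
    gradient. *)
Lemma tensor_integrands x :
  [/\ I_integrand f x = I_integrand g (tailv x) * gauss1 b (x 0 ord0) + b * g (tailv x) * gauss1 b (x 0 ord0),
      Q_integrand f x = Q_integrand g (tailv x) * gauss1 b (x 0 ord0) + b ^+ 2 * g (tailv x) * gauss1 b (x 0 ord0) &
      D_integrand f x = D_integrand g (tailv x) * gauss1 b (x 0 ord0) + 2 * b ^+ 3 * g (tailv x) * gauss1 b (x 0 ord0)].
Proof.
have [h1 h2 h3 h4] := tensor_hess_at x; have [k1 k2 k3 k4] := tensor_grad_hess_at x.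
rewrite (I_integrandE f x) (Q_integrandE f x) (D_integrandE f x).
rewrite (I_integrandE g (tailv x)) (Q_integrandE g (tailv x)) (D_integrandE g (tailv x)).
split.
- exact: (I_of_block h1 h4).
- exact: (Q_of_block h1 h2 h3 h4).
- exact: (D_of_block h1 h2 h3 h4 k1 k2 k3 k4).
Qed.

Hypotheses (LI : rV_L1 (I_integrand g)) (LQ : rV_L1 (Q_integrand g)) (LD : rV_L1 (D_integrand g)).

Let Lg : rV_L1 g.
Proof. by apply: decays_L1; [exact: smooth_continuous|move=> k; exact: (rg [::])]. Qed.

Let W := \int[@lebesgue_measure R]_t gauss1 b t.

Let tensor_int (A : 'rV[R]_n -> R) c (F : V -> R) : rV_L1 A ->
  (forall x, F x = A (tailv x) * gauss1 b (x 0 ord0) + c * g (tailv x) * gauss1 b (x 0 ord0)) ->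
  rV_L1 F /\ iint F = (iint A + c * iint g) * W.
Proof.
move=> LA FE.
have LB : rV_L1 (fun y => A y + c * g y) by apply: rV_L1D => //; exact: rV_L1Z.
have [L E] := rV_L1_tensor LB (gauss1_integrable b0).
have -> : F = fun x : V => (fun y => A y + c * g y) (tailv x) * gauss1 b (x 0 ord0).
  by apply/funext => x; rewrite FE mulrDl.
split => //; rewrite E iintD ?iintZ //; exact: rV_L1Z.
Qed.

Lemma tensor_functionals :
  [/\ rV_L1 (I_integrand f), rV_L1 (Q_integrand f) & rV_L1 (D_integrand f)] /\
  [/\ Qfun f = (Qfun g + b ^+ 2 * iint g) * W &
      Dfun f = (Dfun g + 2 * b ^+ 3 * iint g) * W].
Proof.
have [L1 E1] := tensor_int LI (fun x => let: And3 e _ _ := tensor_integrands x in e).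
have [L2 E2] := tensor_int LQ (fun x => let: And3 _ e _ := tensor_integrands x in e).
have [L3 E3] := tensor_int LD (fun x => let: And3 _ _ e := tensor_integrands x in e).
by split.
Qed.
End tensor_hess.

Lemma admissible_dim_succ (R : realType) n (g : 'rV[R]_n -> R) :
  admissible g -> Dfun g < 0 ->
  exists2 h : 'rV[R]_n.+1 -> R, admissible h & Dfun h < 0.
Proof.
move=> [[sg g0] rg [Ig1 Ig2] [RI RQ RD] Q0] D0.
have LI := (continuous_L1P (smooth_continuous (smooth_I_integrand sg g0))).1 RI.
have LQ := (continuous_L1P (smooth_continuous (smooth_Q_integrand sg g0))).1 RQ.
have LD := (continuous_L1P (smooth_continuous (smooth_D_integrand sg g0))).1 RD.
(* Up to a positive factor, D of the tensor product is [Dfun g + 2 * b ^+ 3]; with this [b],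
   [2 * b ^+ 3 <= 2 * b <= - Dfun g / 2]. *)
pose b : R := Num.min 1 (- Dfun g / 4).
have b0 : 0 < b by rewrite lt_min ltr01 divr_gt0 // oppr_gt0.
have b1 : b <= 1 by rewrite ge_min lexx.
have b2 : b <= - Dfun g / 4 by rewrite ge_min lexx orbT.
have [[L1 L2 L3] [EQ ED]] := tensor_functionals sg g0 rg b0 LI LQ LD.
have W0 := gauss1_int_gt0 b0.
have Qf0 : 0 < Qfun (tensor_gauss g b).
  by rewrite EQ Ig2 mulr1 mulr_gt0 // addr_gt0 // exprn_gt0.
have Df0 : Dfun (tensor_gauss g b) < 0.
  rewrite ED Ig2 mulr1 pmulr_llt0 //.
  have b3 : b ^+ 3 <= b by rewrite exprS ler_piMr ?(ltW b0) // exprn_ile1 // ltW.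
  by move: (Dfun g) D0 b2 => d d0 b2; lra.
have [c c0 [ad _ _ ED']] := normalize_admissible (smooth_tensor b sg) (tensor_gt0 b g0)
  (rapidly_decaying_tensor sg rg b0) L1 L2 L3 Qf0.
exists (fun x => c * tensor_gauss g b x); first exact: ad.
by rewrite ED' pmulr_rlt0.
Qed.

(** * Truncation *)

Section bump.
Variable R : realType.

(** Only the case [m = 0] is wanted, the standard flat function; the powers of [t^-1] are there
    because derivatives produce them, and with them the family spans a space stable under
    derivation. *)
Definition bump (m : nat) (t : R) : R := if 0 < t then t^-1 ^+ m * expR (- t^-1) else 0.

Lemma bump_ge0 m t : 0 <= bump m t.
Proof.
rewrite /bump; case: ifP => // t0; rewrite mulr_ge0 ?expR_ge0 // exprn_ge0 // invr_ge0.
exact: ltW.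
Qed.

(** With [s] the square root of [1 / t] this is the bound on [s^(2m) exp(- s^2)], already known for
    the one-dimensional Gaussian of precision 2. *)
Lemma bump_bounded m : exists C, forall t, bump m t <= C.
Proof.
have [C h] := @gauss1_bound R 2 (ltr0Sn _ 1) m.*2.
have C0 : 0 <= C by apply: le_trans (h 0); rewrite mulr_ge0 ?exprn_ge0 ?expR_ge0.
exists C => t; rewrite /bump; case: ifP => // t0.
have s0 : 0 <= t^-1 by rewrite invr_ge0 ltW.
apply: le_trans (h (Num.sqrt t^-1)).
rewrite ger0_norm ?sqrtr_ge0 // /gauss1 -mul2n exprM sqr_sqrtr // divff ?mulN1r //.
Qed.

(** The bound for [m + 2], multiplied by [t^2]. Vanishing to second order is what gives derivative 0
    at the junction of the two branches. *)
Lemma bump_quadratic m : exists2 C, 0 <= C & forall t, bump m t <= C * t ^+ 2.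
Proof.
have [C h] := bump_bounded m.+2; exists `|C| => // t.
have := h t; rewrite /bump; case: ifP => t0; last by rewrite mulr_ge0 ?sqr_ge0.
rewrite -addn2 exprD mulrAC => h'.
apply: (@le_trans _ _ (C * t ^+ 2)); last by rewrite ler_wpM2r ?sqr_ge0 // ler_norm.
by rewrite -ler_pdivrMr ?exprn_gt0 // -exprVn.
Qed.

Lemma is_derive_bump m (t : R) :
  is_derive t 1 (bump m) (bump m.+2 t - m%:R * bump m.+1 t).
Proof.
have [t0|t0|->] := ltgtP t 0.
- apply: (@near_eq_is_derive _ _ _ (fun _ => 0)).
    near=> s; rewrite /bump ifF //; apply/negbTE; rewrite -leNgt ltW //.
    by near: s; exact: lt_nbhsl.
  by rewrite /bump !ifF ?mulr0 ?subrr ?(lt_gtF t0) //; exact: is_derive_cst.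
- have D k : is_derive t 1 (fun s : R => s^-1 ^+ k * expR (- s^-1))
    (t^-1 ^+ k.+2 * expR (- t^-1) - k%:R * (t^-1 ^+ k.+1 * expR (- t^-1))).
    have tn0 : t != 0 by rewrite gt_eqF.
    have V : is_derive t 1 (fun s : R => s^-1) (- t ^- 2).
      by have := is_deriveV tn0 (is_derive_id t 1); rewrite /GRing.scale /= mulr1.
    elim: k => [|k IH].
      rewrite (_ : (fun s : R => _) = fun s : R => expR (- s^-1)); last first.
        by apply/funext => s; rewrite expr0 mul1r.
      apply: (is_derive_eq (@is_derive1_comp R (@expR R) (fun s : R => - s^-1) t _ _
        (is_derive_expR _) (is_deriveN V))); rewrite opprK mul0r subr0 exprVn mulrC //.
    rewrite (_ : (fun s : R => _) = fun s : R => s^-1 * (s^-1 ^+ k * expR (- s^-1))); last first.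
      by apply/funext => s; rewrite exprS mulrA.
    apply: (is_derive_eq (is_deriveM V IH)); rewrite /GRing.scale /= -exprVn -natr1.
    set w := expR (- t^-1); set y := t^-1; clearbody w y.
    rewrite !exprS; ring.
  rewrite /bump t0.
  apply: near_eq_is_derive (D m).
  near=> s; rewrite ifT //.
  by near: s; exact: lt_nbhsr.
- have [C C0 h] := bump_quadratic m.
  have b0 k : bump k 0 = 0 by rewrite /bump ltxx.
  rewrite !b0 mulr0 subr0.
  have c : (fun s : R => s^-1 *: ((bump m \o shift 0) (s *: (1 : R)) - bump m 0)) @ 0^' --> (0 : R).
    apply/cvgrPdist_le => e e0; near=> s.
    have s0 : s != 0 by near: s; exact: nbhs_dnbhs_neq.
    have se : `|s| <= e / (C + 1) by near: s; apply: dnbhs0_le; rewrite divr_gt0 // ltr_wpDl.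
    rewrite sub0r normrN b0 subr0 /= addr0 [s *: 1]mulr1 normrM normfV.
    rewrite mulrC ler_pdivrMr ?normr_gt0 // (ger0_norm (bump_ge0 _ _)).
    apply: (le_trans (h s)); rewrite -(real_normK (num_real s)) expr2 mulrA ler_wpM2r //.
    apply: (@le_trans _ _ ((C + 1) * `|s|)); first by rewrite ler_wpM2r // lerDl.
    by rewrite mulrC -ler_pdivlMr // ltr_wpDl.
  by apply: DeriveDef; [exact: (cvgP 0 c)|exact: (cvg_lim _ c)].
Unshelve. all: by end_near. Qed.

End bump.

(** * The cutoff function *)

Section cutoff.
Variables (R : realType) (n : nat).
Notation V := 'rV[R]_n.

Lemma continuous_bounded_ball (f : V -> R) r : continuous f ->
  exists2 M, 0 <= M & forall x, `|x| <= r -> `|f x| <= M.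
Proof.
move=> fc.
have cA : compact [set x : V | `|x| <= r].
  apply: bounded_closed_compact.
    by exists r; split; [exact: num_real|move=> M rM x /= xr; exact: le_trans xr (ltW rM)].
  rewrite (_ : [set x : V | _] = (fun x : V => `|x|) @^-1` [set y | y <= r]) //.
  by apply: preimage_closed => [x _|]; [exact: norm_continuous|exact: closed_le].
have := continuous_compact (continuous_subspaceT fc) cA.
move=> /compact_bounded[M [Mr h]].
exists (`|M| + 1) => [|x xr]; first by rewrite addr_ge0.
apply: (h (`|M| + 1)); last by exists x.
by rewrite (le_lt_trans (ler_norm M)) // ltrDl.
Qed.

Lemma open_norm_gt (r : R) : open [set x : V | r < `|x|].
Proof.
rewrite (_ : [set x : V | _] = (fun x : V => `|x|) @^-1` [set y | r < y]) //.
by apply: open_comp => [y _|]; [exact: norm_continuous|exact: open_gt].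
Qed.

(** The classical mollifier profile [exp(-1 / (1 - |x|^2))] on the Euclidean unit ball. It is not
    equal to 1 near the origin: when the scale grows, the rescaled cutoff tends to the constant
    [cutoff 0], and its positivity is enough to preserve a sign. *)
Definition cutoff (x : V) : R := bump 0 (1 - sqnorm x).

Lemma smooth_cutoff : smooth cutoff.
Proof.
have st : smooth (fun x : V => 1 - sqnorm x).
  apply: gen_smooth; apply: genD; first exact: gen_cst.
  by apply: genN; apply: gen_base; exact: (tame_sqnorm R n).1.
pose B h := smooth h \/ exists m, h = fun x : V => bump m (1 - sqnorm x).
have dB m : diffable (fun x : V => bump m (1 - sqnorm x)).
  apply: diffable_comp; first exact: smooth_diffable.
  by move=> x; have [] := is_derive_bump m (1 - sqnorm x).
apply: (@gen_closed_smooth _ _ B); last by apply: gen_base; right; exists 0%N.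
  by move=> b [/smooth_diffable//|[m ->]].
move=> b [sb|[m ->]] i; first by apply: gen_base; left; exact: smooth_partial.
rewrite partial_comp; [|exact: smooth_diffable|]; last first.
  by move=> x; have [] := is_derive_bump m (1 - sqnorm x).
rewrite (_ : (fun x => _) = fun x : V => (bump m.+2 (1 - sqnorm x) +
  - m%:R * bump m.+1 (1 - sqnorm x)) * partial i (fun x : V => 1 - sqnorm x) x); last first.
  apply/funext => x; rewrite derive1E; have [_ ->] := is_derive_bump m (1 - sqnorm x).
  by rewrite mulNr.
apply: genM; last by apply: gen_base; left; exact: smooth_partial.
apply: genD; first by apply: gen_base; right; exists m.+2.
by apply: genM; [exact: gen_cst|apply: gen_base; right; exists m.+1].
Qed.

Lemma cutoff_ge0 x : 0 <= cutoff x.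
Proof. exact: bump_ge0. Qed.

Lemma cutoff_le1 x : cutoff x <= 1.
Proof.
rewrite /cutoff /bump; case: ifP => // t0; rewrite expr0 mul1r expR_le1 oppr_le0 invr_ge0.
exact: ltW.
Qed.

Lemma cutoff0_gt0 : 0 < cutoff 0.
Proof.
rewrite /cutoff /bump (_ : sqnorm 0 = 0) ?subr0 ?ltr01 ?expr0 ?mul1r ?expR_gt0 //.
by apply: big1 => i _; rewrite mxE expr0n.
Qed.

Lemma cutoff_eq0 x : 1 <= `|x| -> cutoff x = 0.
Proof.
move=> x1; rewrite /cutoff /bump ifF //; apply/negbTE; rewrite -leNgt subr_le0.
by apply: le_trans (sqnorm_ge x); rewrite -[leLHS](expr1n _ 2) lerXn2r ?nnegrE.
Qed.

Lemma dparts_cutoff_bounded s : exists2 M, 0 <= M & forall x, `|dparts s cutoff x| <= M.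
Proof.
have [M M0 h] := continuous_bounded_ball 1 (smooth_continuous (smooth_dparts s smooth_cutoff)).
exists M => // x; have [/h//|x1] := leP `|x| 1.
pose U := [set x : V | 1 < `|x|]; have oU : open U by exact: open_norm_gt.
suff -> : dparts s cutoff x = 0 by rewrite normr0.
have C h' : (forall y, U y -> h' y = 0) -> forall i, forall y, U y -> partial i h' y = 0.
  by move=> h0 i; exact: partial_eq0_open.
have C0 y : U y -> cutoff y = 0 by move=> /ltW; exact: cutoff_eq0.
exact: (dparts_class (C := fun h => forall y, U y -> h y = 0) C C0 s x x1).
Qed.

End cutoff.

(** * Logarithmic jets of products, powers and rescalings *)

Section jet_functions.
Variables (R : realType) (n : nat).
Notation V := 'rV[R]_n.
Implicit Types (f g h : V -> R) (i j k : 'I_n).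

Lemma diffable_scale f (a : R) : diffable f -> diffable (fun x => f (a *: x)).
Proof.
move=> df x; apply: (@differentiable_comp _ _ _ _ (fun x : V => a *: x) f); last exact: df.
exact: differentiableZ.
Qed.

Lemma dparts_scale s f (a : R) : smooth f ->
  dparts s (fun x => f (a *: x)) = fun x => a ^+ size s * dparts s f (a *: x).
Proof.
move=> sf; elim: s => [|i s IH] /=; first by apply/funext => x; rewrite expr0 mul1r.
have d := smooth_diffable (smooth_dparts s sf).
rewrite -/(dparts s _) IH partialZ; last exact: diffable_scale.
by rewrite partial_scale //; apply/funext => x; rewrite mulrA -exprSr.
Qed.

Lemma smooth_scale f (a : R) : smooth f -> smooth (fun x => f (a *: x)).
Proof.
move=> sf s; rewrite dparts_scale //; apply: diffableM; first exact: diffable_cst.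
exact/diffable_scale/smooth_diffable/smooth_dparts.
Qed.

(** The rational form of the fact that a logarithm turns products into sums; [P] and [Q] are given
    by the product rule. Positivity is replaced by nonvanishing at the point, so that a factor may
    vanish elsewhere. *)
Lemma hess_jetM (a b : R) p p' P q q' Q i j : a != 0 -> b != 0 ->
  (forall i, P i = a * p' i + b * p i) ->
  (forall i j, Q i j = (a * q' i j + p' j * p i) + (b * q i j + p j * p' i)) ->
  @hess_jet R n (a * b) P Q i j = hess_jet a p q i j + hess_jet b p' q' i j.
Proof.
by move=> a0 b0 EP EQ; rewrite /hess_jet !EQ !EP; field; rewrite a0 b0.
Qed.

Lemma grad_hess_jetM (a b : R) p p' P q q' Q r r' T i j k : a != 0 -> b != 0 ->
  (forall i, P i = a * p' i + b * p i) ->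
  (forall i j, Q i j = (a * q' i j + p' j * p i) + (b * q i j + p j * p' i)) ->
  (forall i j k, T i j k = ((a * r' i j k + q' i j * p k) + (p' j * q k i + p i * q' k j))
    + ((b * r i j k + q i j * p' k) + (p j * q' k i + p' i * q k j))) ->
  @grad_hess_jet R n (a * b) P Q T i j k =
  grad_hess_jet a p q r i j k + grad_hess_jet b p' q' r' i j k.
Proof.
by move=> a0 b0 EP EQ ET; rewrite /grad_hess_jet !ET !EQ !EP; field; rewrite a0 b0.
Qed.

Lemma hess_jet_scale (a c : R) p P q Q i j :
  (forall i, P i = c ^+ 1 * p i) -> (forall i j, Q i j = c ^+ 2 * q i j) ->
  @hess_jet R n a P Q i j = c ^+ 2 * hess_jet a p q i j.
Proof. by move=> EP EQ; rewrite /hess_jet !EQ !EP; ring. Qed.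

Lemma grad_hess_jet_scale (a c : R) p P q Q r T i j k :
  (forall i, P i = c ^+ 1 * p i) -> (forall i j, Q i j = c ^+ 2 * q i j) ->
  (forall i j k, T i j k = c ^+ 3 * r i j k) ->
  @grad_hess_jet R n a P Q T i j k = c ^+ 3 * grad_hess_jet a p q r i j k.
Proof. by move=> EP EQ ET; rewrite /grad_hess_jet !ET !EQ !EP; ring. Qed.

(* Rational in the partial derivatives of f, hence meaningful for a density that vanishes
   somewhere (with junk values where it does), unlike [hess] and [grad_hess]. *)
Definition hj f x i j : R :=
  hess_jet (f x) (fun i => partial i f x) (fun i j => partial i (partial j f) x) i j.

Definition kj f x i j k : R :=
  grad_hess_jet (f x) (fun i => partial i f x) (fun i j => partial i (partial j f) x)
    (fun i j k => partial k (partial i (partial j f)) x) i j k.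

Section product.
Variables f g : V -> R.
Hypotheses (sf : smooth f) (sg : smooth g).
Let df := smooth_diffable sf.
Let dg := smooth_diffable sg.
Let df1 i := smooth_diffable (smooth_partial i sf).
Let dg1 i := smooth_diffable (smooth_partial i sg).
Let df2 i j := smooth_diffable (smooth_partial i (smooth_partial j sf)).
Let dg2 i j := smooth_diffable (smooth_partial i (smooth_partial j sg)).

Lemma partialM_at k (u v : V -> R) x : diffable u -> diffable v ->
  partial k (fun x => u x * v x) x = u x * partial k v x + v x * partial k u x.
Proof. by move=> du dv; exact: (congr1 (@^~ x) (partialM k du dv)). Qed.

Lemma partialD_at k (u v : V -> R) x : diffable u -> diffable v ->
  partial k (fun x => u x + v x) x = partial k u x + partial k v x.
Proof. by move=> du dv; exact: (congr1 (@^~ x) (partialD k du dv)). Qed.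

Lemma partial2M i j : partial i (partial j (fun x => f x * g x)) =
  fun x => (f x * partial i (partial j g) x + partial j g x * partial i f x) +
           (g x * partial i (partial j f) x + partial j f x * partial i g x).
Proof.
have m1 : diffable (fun x => f x * partial j g x) by exact: diffableM.
have m2 : diffable (fun x => g x * partial j f x) by exact: diffableM.
apply: etrans (congr1 (partial i) (partialM j df dg)) _.
apply/funext => x; apply: etrans (partialD_at i x m1 m2) _.
exact: (congr2 +%R (partialM_at i x df (dg1 j)) (partialM_at i x dg (df1 j))).
Qed.

Lemma partial3M i j k : partial k (partial i (partial j (fun x => f x * g x))) =
  fun x => ((f x * partial k (partial i (partial j g)) x + partial i (partial j g) x * partial k f x)
     + (partial j g x * partial k (partial i f) x + partial i f x * partial k (partial j g) x))
  + ((g x * partial k (partial i (partial j f)) x + partial i (partial j f) x * partial k g x)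
     + (partial j f x * partial k (partial i g) x + partial i g x * partial k (partial j f) x)).
Proof.
have m1 : diffable (fun x => f x * partial i (partial j g) x) by exact: diffableM.
have m2 : diffable (fun x => partial j g x * partial i f x) by exact: diffableM.
have m3 : diffable (fun x => g x * partial i (partial j f) x) by exact: diffableM.
have m4 : diffable (fun x => partial j f x * partial i g x) by exact: diffableM.
apply: etrans (congr1 (partial k) (partial2M i j)) _.
apply/funext => x; apply: etrans (partialD_at k x (diffableD m1 m2) (diffableD m3 m4)) _.
apply: (congr2 +%R).
  apply: etrans (partialD_at k x m1 m2) _.
  exact: (congr2 +%R (partialM_at k x df (dg2 i j)) (partialM_at k x (dg1 j) (df1 i))).
apply: etrans (partialD_at k x m3 m4) _.
exact: (congr2 +%R (partialM_at k x dg (df2 i j)) (partialM_at k x (df1 j) (dg1 i))).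
Qed.

Variable x : V.
Hypotheses (fx : f x != 0) (gx : g x != 0).

Lemma hjM i j : hj (fun y => f y * g y) x i j = hj f x i j + hj g x i j.
Proof.
apply: hess_jetM => //.
- by move=> l; exact: partialM_at.
- by move=> l m; exact: (congr1 (@^~ x) (partial2M l m)).
Qed.

Lemma kjM i j k : kj (fun y => f y * g y) x i j k = kj f x i j k + kj g x i j k.
Proof.
apply: grad_hess_jetM => //.
- by move=> l; exact: partialM_at.
- by move=> l m; exact: (congr1 (@^~ x) (partial2M l m)).
- by move=> l m o; exact: (congr1 (@^~ x) (partial3M l m o)).
Qed.
End product.

Lemma smoothX f m : smooth f -> smooth (fun x => f x ^+ m).
Proof. by move=> sf; apply: gen_smooth; apply: genX; exact: gen_base. Qed.

Lemma jetsX f x m i j k : smooth f -> f x != 0 ->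
  hj (fun y => f y ^+ m) x i j = m%:R * hj f x i j /\
  kj (fun y => f y ^+ m) x i j k = m%:R * kj f x i j k.
Proof.
move=> sf fx; elim: m => [|m [IH1 IH2]].
  under eq_fun do rewrite expr0.
  rewrite !mul0r /hj /kj /hess_jet /grad_hess_jet !partial_cst.
  by split; ring.
under eq_fun do rewrite exprS.
have sm := smoothX m sf; have fm : f x ^+ m != 0 by rewrite expf_neq0.
rewrite (hjM sf sm fx fm) (kjM sf sm fx fm) IH1 IH2 -natr1.
move: (hj f x i j) (kj f x i j k) m%:R => a b c.
by split; ring.
Qed.

Lemma jets_scale f x (a : R) i j k : smooth f ->
  hj (fun y => f (a *: y)) x i j = a ^+ 2 * hj f (a *: x) i j /\
  kj (fun y => f (a *: y)) x i j k = a ^+ 3 * kj f (a *: x) i j k.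
Proof.
move=> sf.
have e1 l : partial l (fun y => f (a *: y)) = fun y => a ^+ 1 * partial l f (a *: y).
  exact: (dparts_scale [:: l] a sf).
have e2 l m : partial l (partial m (fun y => f (a *: y))) =
    fun y => a ^+ 2 * partial l (partial m f) (a *: y).
  exact: (dparts_scale [:: l; m] a sf).
have e3 l m o : partial l (partial m (partial o (fun y => f (a *: y)))) =
    fun y => a ^+ 3 * partial l (partial m (partial o f)) (a *: y).
  exact: (dparts_scale [:: l; m; o] a sf).
split.
  by apply: hess_jet_scale => *; [exact: (congr1 (@^~ x) (e1 _))|exact: (congr1 (@^~ x) (e2 _ _))].
apply: grad_hess_jet_scale => *; [exact: (congr1 (@^~ x) (e1 _))|
  exact: (congr1 (@^~ x) (e2 _ _))|exact: (congr1 (@^~ x) (e3 _ _ _))].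
Qed.

(** One index for the three integrands, 0 for I, 1 for Q and anything else for D, so that bounds and
    limits are proved once for all of them. *)
Definition jet_of (q : nat) (H : 'I_n -> 'I_n -> R) (K : 'I_n -> 'I_n -> 'I_n -> R) (a : R) : R :=
  match q with 0 => I_of H a | 1 => Q_of H a | _ => D_of H K a end.

Definition jetI q f x : R := jet_of q (hj f x) (kj f x) (f x).

Lemma hess_hj f x : smooth f -> (forall x, 0 < f x) -> forall i j, hess f x i j = hj f x i j.
Proof. by move=> sf f0 i j; exact: (congr1 (@^~ x) (hess_jetE sf f0 i j)). Qed.

Lemma grad_hess_kj f x : smooth f -> (forall x, 0 < f x) ->
  forall i j k, grad_hess f x i j k = kj f x i j k.
Proof. by move=> sf f0 i j k; exact: (grad_hess_jetE sf f0 x i j k). Qed.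

Lemma eq_jet_of q (H H' : 'I_n -> 'I_n -> R) (K K' : 'I_n -> 'I_n -> 'I_n -> R) a :
  (forall i j, H i j = H' i j) -> (forall i j k, K i j k = K' i j k) ->
  jet_of q H K a = jet_of q H' K' a.
Proof.
move=> E E'; have -> : H = H' by apply/funext => i; apply/funext => j.
by have -> : K = K' by apply/funext => i; apply/funext => j; apply/funext => k.
Qed.

Lemma jetIE f x : smooth f -> (forall x, 0 < f x) ->
  [/\ I_integrand f x = jetI 0 f x, Q_integrand f x = jetI 1 f x &
      D_integrand f x = jetI 2 f x].
Proof.
move=> sf f0; have h := hess_hj x sf f0; have k := grad_hess_kj x sf f0; split.
- exact: etrans (I_integrandE f x) (eq_jet_of 0 (f x) h k).
- exact: etrans (Q_integrandE f x) (eq_jet_of 1 (f x) h k).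
- exact: etrans (D_integrandE f x) (eq_jet_of 2 (f x) h k).
Qed.

Lemma jetI_eq0 q f x : f x = 0 -> jetI q f x = 0.
Proof.
by rewrite /jetI => ->; case: q => [|[|q]]; rewrite /jet_of /I_of /Q_of /D_of mulr0.
Qed.

Lemma compact_support_decays f r : continuous f -> (forall x, r <= `|x| -> f x = 0) -> decays f.
Proof.
move=> fc fr k; have [M M0 h] := continuous_bounded_ball r fc.
exists (`|r| ^+ k * M) => x.
have [xr|xr] := leP `|x| r.
  rewrite ler_pM ?exprn_ge0 ?h // lerXn2r ?nnegrE //.
  by rewrite (le_trans xr) // ler_norm.
have -> : f x = 0 by apply: fr; exact: ltW.
by rewrite normr0 mulr0; apply: mulr_ge0; rewrite ?exprn_ge0.
Qed.

End jet_functions.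

(** * Pointwise perturbation of the integrand of D *)

Section perturbation.
Variables (R : realType).

(** [p] is the value of the cutoff, and [X], [Y], [Z] have poles of order 2 in it, which [p ^+ 6]
    can cancel three at a time. Each of the 7 mixed terms of the product contains at least one
    perturbation, hence a factor [a], and at most two of [x], [y], [z], which their squares
    control. *)
Lemma triple_perturb (p c a x y z X Y Z : R) : 0 <= p -> p <= 1 -> 0 <= a -> a <= 1 -> 1 <= c ->
  `|p ^+ 2 * X| <= c * a -> `|p ^+ 2 * Y| <= c * a -> `|p ^+ 2 * Z| <= c * a ->
  p ^+ 6 * ((x + X) * (y + Y) * (z + Z)) <= p ^+ 6 * (x * y * z)
    + 7 * c ^+ 3 * a * (1 + x ^+ 2 + y ^+ 2 + z ^+ 2).
Proof.
move=> p0 p1 a0 a1 c1 hX hY hZ.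
set lX := p ^+ 2 * X in hX; set lY := p ^+ 2 * Y in hY; set lZ := p ^+ 2 * Z in hZ.
set N := 1 + x ^+ 2 + y ^+ 2 + z ^+ 2.
have c0 : 0 <= c := le_trans ler01 c1.
have ca0 : 0 <= c * a by rewrite mulr_ge0.
have px k : `|p ^+ k| <= 1 by rewrite normrX (ger0_norm p0) exprn_ile1.
have sq2 (s t : R) : `|s * t| <= s ^+ 2 + t ^+ 2.
  rewrite ler_norml; have := sqr_ge0 (s + t); have := sqr_ge0 (s - t).
  have := sqr_ge0 s; have := sqr_ge0 t; rewrite !expr2; nra.
have sq1 (s : R) : `|s| <= 1 + s ^+ 2.
  by have := sq2 1 s; rewrite mul1r expr1n.
have x0 := sqr_ge0 x; have y0 := sqr_ge0 y; have z0 := sqr_ge0 z.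
have cc1 : c * a <= c ^+ 3 * a.
  by rewrite ler_wpM2r // exprS ler_peMr // exprn_ege1.
have cc2 : (c * a) * (c * a) <= c ^+ 3 * a.
  rewrite (_ : (c * a) * (c * a) = c ^+ 2 * a * a); last by ring.
  rewrite (_ : c ^+ 3 * a = c ^+ 2 * a * c); last by ring.
  by rewrite ler_wpM2l ?mulr_ge0 ?exprn_ge0 // (le_trans a1).
have cc3 : (c * a) * (c * a) * (c * a) <= c ^+ 3 * a.
  rewrite (_ : (c * a) * (c * a) * (c * a) = c ^+ 3 * a * (a * a)); last by ring.
  by rewrite ler_piMr ?mulr_ge0 ?exprn_ge0 // mulr_ile1.
have k0 : 0 <= c ^+ 3 * a by rewrite mulr_ge0 // exprn_ge0.
have N1 : 1 <= N by rewrite /N; lra.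
have t1 l s t k : `|l| <= c * a -> `|s * t| <= N -> `|p ^+ k * (l * (s * t))| <= c ^+ 3 * a * N.
  move=> hl hst; rewrite normrM -[leRHS]mul1r ler_pM //.
  rewrite normrM ler_pM // (le_trans hl) //.
have t2 l l' s k : `|l| <= c * a -> `|l'| <= c * a -> `|s| <= N ->
    `|p ^+ k * (l * l' * s)| <= c ^+ 3 * a * N.
  move=> hl hl' hs; rewrite normrM -[leRHS]mul1r ler_pM //.
  rewrite normrM ler_pM // (le_trans _ cc2) // normrM ler_pM //.
have t3 : `|lX * lY * lZ| <= c ^+ 3 * a * N.
  apply: (@le_trans _ _ (c ^+ 3 * a)); last by rewrite ler_peMr.
  by rewrite (le_trans _ cc3) // normrM ler_pM // normrM ler_pM.
have Nyz : `|y * z| <= N by rewrite (le_trans (sq2 _ _)) // /N; lra.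
have Nxz : `|x * z| <= N by rewrite (le_trans (sq2 _ _)) // /N; lra.
have Nxy : `|x * y| <= N by rewrite (le_trans (sq2 _ _)) // /N; lra.
have Nx : `|x| <= N by rewrite (le_trans (sq1 _)) // /N; lra.
have Ny : `|y| <= N by rewrite (le_trans (sq1 _)) // /N; lra.
have Nz : `|z| <= N by rewrite (le_trans (sq1 _)) // /N; lra.
have b1 := ler_normlW (t1 lX y z 4 hX Nyz); have b2 := ler_normlW (t1 lY x z 4 hY Nxz).
have b3 := ler_normlW (t1 lZ x y 4 hZ Nxy); have b4 := ler_normlW (t2 lX lY z 2 hX hY Nz).
have b5 := ler_normlW (t2 lX lZ y 2 hX hZ Ny); have b6 := ler_normlW (t2 lY lZ x 2 hY hZ Nx).
have b7 := ler_normlW t3.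
rewrite (_ : p ^+ 6 * ((x + X) * (y + Y) * (z + Z)) = p ^+ 6 * (x * y * z) +
  (p ^+ 4 * (lX * (y * z)) + p ^+ 4 * (lY * (x * z)) + p ^+ 4 * (lZ * (x * y))
  + p ^+ 2 * (lX * lY * z) + p ^+ 2 * (lX * lZ * y) + p ^+ 2 * (lY * lZ * x) + lX * lY * lZ)).
  rewrite lerD2l (_ : 7 * c ^+ 3 * a * N = 7 * (c ^+ 3 * a * N)); last by ring.
  move: (c ^+ 3 * a * N) b1 b2 b3 b4 b5 b6 b7 => B.
  move: (_ * (lX * _)) (_ * (lY * _)) (_ * (lZ * _)) (_ * (lX * lY * _)) (_ * (lX * lZ * _))
    (_ * (lY * lZ * _)) (lX * lY * lZ) => s1 s2 s3 s4 s5 s6 s7.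
  by clear; lra.
rewrite /lX /lY /lZ; ring.
Qed.

(** The errors are small multiples of [1 + |H|^2], which is integrable against the density, with one
    exception: the term linear in [K], kept as it is for an integration by parts. The constant is 43
    = 1 + 2 * 7 * 3: 1 for the square of [P], 7 from [triple_perturb], 2 the coefficient of the
    cubic trace, 3 for the three squares. *)
Lemma D_of_perturb n (H L : 'I_n -> 'I_n -> R) (K P : 'I_n -> 'I_n -> 'I_n -> R) (ga p c a : R) :
  0 <= p -> p <= 1 -> 0 <= a -> a <= 1 -> 1 <= c -> 0 <= ga ->
  (forall i j, `|p ^+ 2 * L i j| <= c * a) ->
  (forall i j k, `|p ^+ 3 * P i j k| <= c * a) ->
  D_of (fun i j => H i j + L i j) (fun i j k => K i j k + P i j k) (ga * p ^+ 6) <=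
  p ^+ 6 * D_of H K ga + 2 * (\sum_i \sum_j \sum_k ga * (K i j k * (p ^+ 6 * P i j k)))
  + a * ((n%:R ^+ 3 * (43 * c ^+ 3)) * ((1 + \sum_i \sum_j H i j ^+ 2) * ga)).
Proof.
move=> p0 p1 a0 a1 c1 g0 hL hP.
set S := \sum_i \sum_j H i j ^+ 2.
have c0 : 0 <= c := le_trans ler01 c1.
have HS i j : H i j ^+ 2 <= S.
  rewrite /S (bigD1 i) //= (bigD1 j) //= -addrA lerDl addr_ge0 //.
    by apply: sumr_ge0 => l _; exact: sqr_ge0.
  by apply: sumr_ge0 => l _; apply: sumr_ge0 => m _; exact: sqr_ge0.
have S0 : 0 <= S by apply: sumr_ge0 => l _; apply: sumr_ge0 => m _; exact: sqr_ge0.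
have k0 : 0 <= c ^+ 3 * a by rewrite mulr_ge0 // exprn_ge0.
pose T i j k : R := (K i j k + P i j k) ^+ 2 +
   2 * ((H i j + L i j) * (H j k + L j k) * (H k i + L k i)).
pose T0 i j k : R := K i j k ^+ 2 + 2 * (H i j * H j k * H k i).
have key i j k : p ^+ 6 * T i j k <= p ^+ 6 * T0 i j k + 2 * (K i j k * (p ^+ 6 * P i j k))
    + 43 * (c ^+ 3 * a) * (1 + S).
  rewrite /T /T0.
  have h1 := triple_perturb (H i j) (H j k) (H k i) p0 p1 a0 a1 c1 (hL i j) (hL j k) (hL k i).
  have h2 : (p ^+ 3 * P i j k) ^+ 2 <= c ^+ 3 * a.
    rewrite -(real_normK (num_real _)); apply: (@le_trans _ _ ((c * a) ^+ 2)).
      by rewrite lerXn2r ?nnegrE ?mulr_ge0.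
    rewrite (_ : (c * a) ^+ 2 = c ^+ 2 * a * a); last by ring.
    rewrite (_ : c ^+ 3 * a = c ^+ 2 * a * c); last by ring.
    by rewrite ler_wpM2l ?mulr_ge0 ?exprn_ge0 // (le_trans a1).
  have h3 : c ^+ 3 * a * (1 + H i j ^+ 2 + H j k ^+ 2 + H k i ^+ 2) <= c ^+ 3 * a * (3 * (1 + S)).
    apply: ler_wpM2l => //; have := HS i j; have := HS j k; have := HS k i.
    by move: (H i j ^+ 2) (H j k ^+ 2) (H k i ^+ 2) => q1 q2 q3; lra.
  have h4 : c ^+ 3 * a <= c ^+ 3 * a * (1 + S) by rewrite ler_peMr // lerDl.
  have e1 : p ^+ 6 * ((K i j k + P i j k) ^+ 2 +
     2 * ((H i j + L i j) * (H j k + L j k) * (H k i + L k i))) =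
     p ^+ 6 * K i j k ^+ 2 + 2 * (K i j k * (p ^+ 6 * P i j k)) + (p ^+ 3 * P i j k) ^+ 2 +
     2 * (p ^+ 6 * ((H i j + L i j) * (H j k + L j k) * (H k i + L k i))) by ring.
  have e2 : p ^+ 6 * (K i j k ^+ 2 + 2 * (H i j * H j k * H k i)) =
     p ^+ 6 * K i j k ^+ 2 + 2 * (p ^+ 6 * (H i j * H j k * H k i)) by ring.
  rewrite e1 e2; move: h1 h2 h3 h4; rewrite -(mulrA 7) -(mulrA 7) -(mulrA 43).
  move: (c ^+ 3 * a) (p ^+ 6 * _ ^+ 2) (K i j k * _) (p ^+ 6 * _) (p ^+ 6 * _) => w s1 s2 s3 s4.
  move: ((p ^+ 3 * _) ^+ 2) => s5.
  rewrite (mulrCA w 3); move: (w * (1 + S)) (w * _) => s6 s7; clear; lra.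
have EL : D_of (fun i j => H i j + L i j) (fun i j k => K i j k + P i j k) (ga * p ^+ 6) =
    ga * \sum_i \sum_j \sum_k p ^+ 6 * T i j k.
  rewrite /D_of mulrC -mulrA; congr (_ * _); rewrite mulr_sumr -big_split /= mulr_sumr.
  apply: eq_bigr => i _; rewrite /= mulr_sumr -big_split mulr_sumr.
  apply: eq_bigr => j _; rewrite /= mulr_sumr -big_split mulr_sumr.
  by apply: eq_bigr => k _.
have ER : p ^+ 6 * D_of H K ga = ga * \sum_i \sum_j \sum_k p ^+ 6 * T0 i j k.
  rewrite /D_of mulrC mulrAC [RHS]mulrC; congr (_ * _); rewrite mulrC.
  rewrite mulr_sumr -big_split mulr_sumr.
  apply: eq_bigr => i _; rewrite /= mulr_sumr -big_split mulr_sumr.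
  apply: eq_bigr => j _; rewrite /= mulr_sumr -big_split mulr_sumr.
  by apply: eq_bigr => k _.
have EC : 2 * (\sum_i \sum_j \sum_k ga * (K i j k * (p ^+ 6 * P i j k))) =
    ga * \sum_i \sum_j \sum_k 2 * (K i j k * (p ^+ 6 * P i j k)).
  do 3 (rewrite !mulr_sumr; apply: eq_bigr => ? _).
  by rewrite mulrCA.
have E3 : a * ((n%:R ^+ 3 * (43 * c ^+ 3)) * ((1 + S) * ga)) =
    ga * \sum_(i < n) \sum_(j < n) \sum_(k < n) (43 * (c ^+ 3 * a) * (1 + S)).
  rewrite !(sumr_const, card_ord).
  rewrite -[_ *+ n *+ n *+ n]mulr_natr -[_ *+ n *+ n]mulr_natr -[(43 * _ * _) *+ n]mulr_natr.
  by ring.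
rewrite EL ER EC E3 -!mulrDr; apply: ler_wpM2l => //.
do 3 (rewrite -!big_split; apply: ler_sum => ? _); exact: key.
Qed.
End perturbation.

(** * Integration by parts in the cross term *)

Section cross_term.
Variables (R : realType) (n : nat).
Notation V := 'rV[R]_n.

Lemma cross_term_bound (g h d P P' b q s : R) : 0 < g -> `|P| <= b -> `|P'| <= b ->
  h ^+ 2 * g <= q -> d ^+ 2 * g^-1 <= s -> `|h * (P * d + g * P')| <= b * (2 * (g + q) + s).
Proof.
move=> g0 hP hP' hq hs.
have b0 : 0 <= b := le_trans (normr_ge0 _) hP.
have am (u v : R) : `|u * v| <= u ^+ 2 + v ^+ 2.
  rewrite ler_norml; have := sqr_ge0 (u + v); have := sqr_ge0 (u - v).
  have := sqr_ge0 u; have := sqr_ge0 v; rewrite !expr2; nra.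
have e1 : `|h * d| <= q + s.
  rewrite (_ : h * d = h * (d / g) * g); last by rewrite -mulrA divfK // gt_eqF.
  rewrite normrM (gtr0_norm g0); apply: le_trans (_ : (h ^+ 2 + (d / g) ^+ 2) * g <= _).
    by rewrite ler_pM2r.
  rewrite mulrDl lerD // (le_trans _ hs) // (_ : (d / g) ^+ 2 * g = d ^+ 2 * g^-1) //.
  by field; rewrite gt_eqF.
have e2 : `|h| * g <= g + q.
  have := am 1 h; rewrite mul1r expr1n => e.
  apply: le_trans (_ : (1 + h ^+ 2) * g <= _); first by rewrite ler_pM2r.
  by rewrite mulrDl mul1r lerD2l.
rewrite mulrDr; apply: le_trans (ler_normD _ _) _.
rewrite (mulrCA h P) normrM (mulrA h) (normrM (h * g)) (normrM h g) (gtr0_norm g0).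
have g0' := ltW g0; have q0 : 0 <= q by apply: le_trans hq; rewrite mulr_ge0 ?sqr_ge0.
apply: le_trans (_ : b * (q + s) + (g + q) * b <= _).
  by rewrite lerD // ler_pM // mulr_ge0.
by rewrite (mulrC (g + q)) -mulrDr ler_wpM2l //; lra.
Qed.

Variable g : V -> R.
Hypotheses (sg : smooth g) (g0 : forall x, 0 < g x) (rg : rapidly_decaying g).
Hypotheses (Lg : rV_L1 g) (LI : rV_L1 (I_integrand g)) (LQ : rV_L1 (Q_integrand g)).

(** An integrable majorant of [|H| (|grad g| + g)], up to a constant: by the inequality of the means
    the product splits into [g], [|H|^2 g], which is the integrand of Q, and [|grad g|^2 / g], which
    is the Fisher integrand. *)
Definition dominant (x : V) : R :=
  2 * (g x + Q_integrand g x) + \sum_i partial i g x ^+ 2 * (g x)^-1.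

Lemma dominant_L1 : rV_L1 dominant.
Proof.
apply: rV_L1D; first by apply: rV_L1Z; exact: rV_L1D.
exact: (fisher_information sg g0 rg LI).1.
Qed.

Lemma sum_hess_sqr x : (\sum_i \sum_j hess g x i j ^+ 2) * g x = Q_integrand g x.
Proof.
apply: esym; apply: etrans (Q_integrandE g x) _; rewrite /Q_of; congr (_ * _).
apply: eq_bigr => i _; apply: eq_bigr => j _.
by rewrite (hess_sym sg g0 x j i) expr2.
Qed.

Lemma hess_sqr_le x i j : hess g x i j ^+ 2 * g x <= Q_integrand g x.
Proof.
rewrite -sum_hess_sqr; apply: ler_wpM2r; first exact: ltW.
rewrite (bigD1 i) //= (bigD1 j) //= -addrA lerDl addr_ge0 //.
  by apply: sumr_ge0 => l _; exact: sqr_ge0.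
by apply: sumr_ge0 => l _; apply: sumr_ge0 => m _; exact: sqr_ge0.
Qed.

(* The third derivatives of [ln g] are not controlled by the hypotheses: integration by parts
   trades them for second ones. *)
Lemma cross_term i j k (phi : V -> R) b r : smooth phi ->
  (forall x, `|phi x| <= b) -> (forall x, `|partial k phi x| <= b) ->
  (forall x, r <= `|x| -> phi x = 0) ->
  rV_L1 (fun x => g x * (grad_hess g x i j k * phi x)) /\
  `|iint (fun x => g x * (grad_hess g x i j k * phi x))| <= b * iint dominant.
Proof.
move=> sp pb dpb pr.
have sh := smooth_hess sg g0 i j; have sk := smooth_grad_hess sg g0 i j k.
have dpr x : r + 1 <= `|x| -> partial k phi x = 0.
  move=> xr; apply: (@partial_eq0_open _ _ [set x : V | r < `|x|]).
  - exact: open_norm_gt.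
  - by move=> y /ltW; exact: pr.
  - by rewrite /= (lt_le_trans _ xr) // ltrDl.
have pr1 x : r + 1 <= `|x| -> phi x = 0.
  by move=> xr; apply: pr; rewrite (le_trans _ xr) // lerDl.
pose u x := phi x * g x; have su : smooth u by exact: smoothM.
(* A compactly supported function whose derivative in the direction [k] is the cross term [T] plus a
   term [B] containing only second derivatives of [ln g]. As that derivative has integral zero, the
   integral of [T] is minus that of [B]. *)
pose F x := hess g x i j * u x; have sF : smooth F by exact: smoothM.
pose T x := g x * (grad_hess g x i j k * phi x).
have sT : smooth T by apply: smoothM => //; exact: smoothM.
pose B x := hess g x i j * (phi x * partial k g x + g x * partial k phi x).
have sB : smooth B.
  apply: smoothM => //; apply: smoothD; apply: smoothM => //; exact: smooth_partial.
have Es x : partial k F x = B x + T x.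
  apply: etrans (partialM_at k x (smooth_diffable sh) (smooth_diffable su)) _.
  have -> := partialM_at k x (smooth_diffable sp) (smooth_diffable sg).
  have aux (a a' c : R) : a * a' * c = a' * (c * a) by ring.
  exact: (congr1 (+%R (B x)) (aux (phi x) (g x) (grad_hess g x i j k))).
have T0 x : r + 1 <= `|x| -> T x = 0 by move=> /pr1 E; rewrite /T E !mulr0.
have B0 x : r + 1 <= `|x| -> B x = 0.
  by move=> xr; rewrite /B pr1 // dpr // mul0r !mulr0 addr0 mulr0.
have F0 x : r + 1 <= `|x| -> F x = 0 by move=> /pr1 E; rewrite /F /u E mul0r mulr0.
have dT := compact_support_decays (smooth_continuous sT) T0.
have dB := compact_support_decays (smooth_continuous sB) B0.
have LT := decays_L1 (smooth_continuous sT) dT.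
have LB := decays_L1 (smooth_continuous sB) dB.
have dF := compact_support_decays (smooth_continuous sF) F0.
have Ep : partial k F = fun x => B x + T x by apply/funext.
have : iint (partial k F) = 0.
  apply: iint_partial_eq0 => //; first exact: smooth_continuous.
    by move=> x; exact: (@diffable_derivable _ _ F x _ (smooth_diffable sF)).
  by rewrite Ep; exact: decaysD.
rewrite Ep iintD // => /eqP; rewrite addrC addr_eq0 => /eqP ET.
split => //; apply: le_trans (_ : `|iint B| <= _); first by rewrite ET normrN.
rewrite -iintZ; last exact: dominant_L1.
apply: normr_iint_le => //; first by apply: rV_L1Z; exact: dominant_L1.
move=> x; apply: cross_term_bound => //; first exact: hess_sqr_le.
rewrite (bigD1 k) //= lerDl; apply: sumr_ge0 => l _.
by rewrite mulr_ge0 ?sqr_ge0 // invr_ge0 ltW.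
Qed.
End cross_term.

Section bounded_families.
Variables (R : realType).

Definition bounded_fun (T : Type) (f : T -> R) := exists M, forall x, `|f x| <= M.

Lemma finite_bounded (I : finType) (T : Type) (F : I -> T -> R) :
  (forall i, bounded_fun (F i)) -> exists2 M, 1 <= M & forall i x, `|F i x| <= M.
Proof.
move=> /choice[M hM]; exists (1 + \sum_i `|M i|) => [|i x].
  by rewrite lerDl; apply: sumr_ge0.
rewrite (le_trans (hM i x)) // (le_trans (ler_norm _)) // (bigD1 i) //= addrCA lerDl.
by rewrite addr_ge0 //; apply: sumr_ge0.
Qed.

Lemma gen_bounded n (B : ('rV[R]_n -> R) -> Prop) h :
  (forall b, B b -> bounded_fun b) -> gen B h -> bounded_fun h.
Proof.
move=> Bb; elim => [b /Bb//|c|f g _ [M hM] _ [N hN]|f g _ [M hM] _ [N hN]].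
- by exists `|c|.
- by exists (M + N) => x; exact: normr_add_le.
- by exists (M * N) => x; exact: normr_mul_le.
Qed.

Definition parts_of n (f : 'rV[R]_n -> R) (h : 'rV[R]_n -> R) := exists s, h = dparts s f.

Lemma gen_parts_partial n (f h : 'rV[R]_n -> R) i : smooth f ->
  gen (parts_of f) h -> gen (parts_of f) (partial i h).
Proof.
move=> sf gh; apply: gen_partial => // [b [s ->]|b [s ->] j].
  exact/smooth_diffable/smooth_dparts.
by apply: gen_base; exists (j :: s).
Qed.

Lemma gen_parts_smooth n (f h : 'rV[R]_n -> R) : smooth f ->
  gen (parts_of f) h -> smooth h.
Proof.
by move=> sf gh; apply: gen_smooth; apply: gen_sub gh => b [s ->]; apply: gen_base;
  exact: smooth_dparts.
Qed.
End bounded_families.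

(** * Logarithmic jets of the cutoff, cleared of denominators *)

Section cutoff_jets.
Variables (R : realType) (n : nat).
Notation V := 'rV[R]_n.
Notation th := (@cutoff R n).
Implicit Types i j k : 'I_n.

(** [cutoff2] and [cutoff3] are the square and the cube of the cutoff times the second and third
    logarithmic derivatives of the cutoff, with a minus sign. Being polynomials in its derivatives,
    they are bounded up to and beyond the edge of the support, where the quotients themselves blow
    up. *)
Definition cutoff2 i j (x : V) : R :=
  - (th x * partial i (partial j th) x + - (partial i th x * partial j th x)).

Definition cutoff3 i j k (x : V) : R :=
  - (th x ^+ 2 * partial k (partial i (partial j th)) x
   + - (th x * (partial i (partial j th) x * partial k th x + partial k (partial i th) x * partial j th x
   + partial k (partial j th) x * partial i th x))
   + 2 * (partial i th x * partial j th x * partial k th x)).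

Lemma gen_cutoff2 i j : gen (parts_of th) (cutoff2 i j).
Proof.
have g s : gen (parts_of th) (dparts s th) by apply: gen_base; exists s.
apply: genN; apply: genD; first by apply: genM; [exact: (g [::])|exact: (g [:: i; j])].
by apply: genN; apply: genM; [exact: (g [:: i])|exact: (g [:: j])].
Qed.

Lemma gen_cutoff3 i j k : gen (parts_of th) (cutoff3 i j k).
Proof.
have g s : gen (parts_of th) (dparts s th) by apply: gen_base; exists s.
have g0 : gen (parts_of th) th := g [::].
have g1 l : gen (parts_of th) (partial l th) := g [:: l].
have g2 l m : gen (parts_of th) (partial l (partial m th)) := g [:: l; m].
have g3 : gen (parts_of th) (partial k (partial i (partial j th))) := g [:: k; i; j].
have t1 := genM (genX 2 g0) g3.
have t2 := genN (genM g0 (genD (genD (genM (g2 i j) (g1 k)) (genM (g2 k i) (g1 j)))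
  (genM (g2 k j) (g1 i)))).
have t3 := genM (gen_cst _ 2) (genM (genM (g1 i) (g1 j)) (g1 k)).
exact: (genN (genD (genD t1 t2) t3)).
Qed.

Lemma gen_cutoff_bounded h : gen (parts_of th) h -> bounded_fun h.
Proof.
apply: gen_bounded => b [s ->]; have [M _ hM] := dparts_cutoff_bounded R s.
by exists M.
Qed.

Lemma hess_jetM2 (a : R) p q i j : a != 0 ->
  a ^+ 2 * @hess_jet R n a p q i j = - (a * q i j + - (p i * p j)).
Proof. by move=> a0; rewrite /hess_jet; field. Qed.

Lemma grad_hess_jetM3 (a : R) p q r i j k : a != 0 ->
  a ^+ 3 * @grad_hess_jet R n a p q r i j k =
  - (a ^+ 2 * r i j k + - (a * (q i j * p k + q k i * p j + q k j * p i))
    + 2 * (p i * p j * p k)).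
Proof. by move=> a0; rewrite /grad_hess_jet; field. Qed.

Lemma hj_cutoff x i j : th x != 0 -> th x ^+ 2 * hj th x i j = cutoff2 i j x.
Proof. exact: hess_jetM2. Qed.

Lemma kj_cutoff x i j k : th x != 0 -> th x ^+ 3 * kj th x i j k = cutoff3 i j k x.
Proof. exact: grad_hess_jetM3. Qed.

(* The factor [cutoff ^+ 6] cancels the poles of the third derivatives of [- ln (cutoff ^+ 6)]. *)
Definition cutoff_phi i j k (x : V) : R := 6 * (th x ^+ 3 * cutoff3 i j k x).

Lemma gen_cutoff_phi i j k : gen (parts_of th) (cutoff_phi i j k).
Proof.
apply: genM; first exact: gen_cst.
apply: genM; last exact: gen_cutoff3.
by apply: genX; apply: gen_base; exists [::].
Qed.

Lemma cutoff_phi_bounds : exists2 M, 1 <= M & forall i j k x,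
  `|cutoff2 i j x| <= M /\ `|cutoff3 i j k x| <= M /\
  `|cutoff_phi i j k x| <= M /\ `|partial k (cutoff_phi i j k) x| <= M.
Proof.
have st := @smooth_cutoff R n.
have [M1 M11 h1] := @finite_bounded R ('I_n * 'I_n)%type V (fun p => cutoff2 p.1 p.2)
  (fun p => gen_cutoff_bounded (gen_cutoff2 p.1 p.2)).
have [M2 M21 h2] := @finite_bounded R ('I_n * 'I_n * 'I_n)%type V
  (fun p => cutoff3 p.1.1 p.1.2 p.2)
  (fun p => gen_cutoff_bounded (gen_cutoff3 p.1.1 p.1.2 p.2)).
have [M3 M31 h3] := @finite_bounded R ('I_n * 'I_n * 'I_n)%type V
  (fun p => cutoff_phi p.1.1 p.1.2 p.2)
  (fun p => gen_cutoff_bounded (gen_cutoff_phi p.1.1 p.1.2 p.2)).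
have [M4 M41 h4] := @finite_bounded R ('I_n * 'I_n * 'I_n)%type V
  (fun p => partial p.2 (cutoff_phi p.1.1 p.1.2 p.2))
  (fun p => gen_cutoff_bounded (gen_parts_partial p.2 st (gen_cutoff_phi p.1.1 p.1.2 p.2))).
exists (M1 + M2 + M3 + M4) => [|i j k x]; first by lra.
have := h1 (i, j) x; have := h2 (i, j, k) x; have := h3 (i, j, k) x; have := h4 (i, j, k) x.
by move=> /= *; split; [|split; [|split]]; lra.
Qed.
End cutoff_jets.

Local Opaque cutoff cutoff2 cutoff3.

(** * Negativity of D after truncation *)

Section truncation.
Variables (R : realType) (n : nat).
Notation V := 'rV[R]_n.
Notation th := (@cutoff R n).
Implicit Types i j k : 'I_n.

Variable g : V -> R.
Hypotheses (sg : smooth g) (g0 : forall x, 0 < g x).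

Definition truncate (a : R) (x : V) : R := g x * th (a *: x) ^+ 6.

Lemma smooth_truncate a : smooth (truncate a).
Proof.
apply: smoothM => //; apply: smoothX.
exact: (smooth_scale a (@smooth_cutoff R n)).
Qed.

Lemma truncate_jets a x i j k : th (a *: x) != 0 ->
  hj (truncate a) x i j = hess g x i j + 6 * (a ^+ 2 * hj th (a *: x) i j) /\
  kj (truncate a) x i j k = grad_hess g x i j k + 6 * (a ^+ 3 * kj th (a *: x) i j k).
Proof.
move=> t0; have st := @smooth_cutoff R n.
have sa := smooth_scale a st; have s6 := smoothX 6 sa.
have gx : g x != 0 by rewrite gt_eqF.
have t6 : th (a *: x) ^+ 6 != 0 by rewrite expf_neq0.
have [e1 e2] := jetsX 6 i j k sa t0.
have [e3 e4] := jets_scale x a i j k st.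
split.
  apply: etrans (hjM sg s6 gx t6 i j) _; rewrite (hess_hj x sg g0 i j).
  by apply: (congr1 (+%R _)); apply: etrans e1 _; rewrite e3.
apply: etrans (kjM sg s6 gx t6 i j k) _; rewrite (grad_hess_kj x sg g0 i j k).
by apply: (congr1 (+%R _)); apply: etrans e2 _; rewrite e4.
Qed.

Definition phi_scaled (a : R) i j k (x : V) : R := a ^+ 3 * cutoff_phi i j k (a *: x).

(** The logarithmic jets of the truncation are those of [g] plus 6 times those of the rescaled
    cutoff, and rescaling brings the factors [a ^+ 2] and [a ^+ 3], both at most [a]. Where the
    cutoff vanishes the left-hand side is 0 by convention and the right-hand side is nonnegative. *)
Lemma jet_truncate_le M a x : 0 < a -> a <= 1 -> 1 <= M ->
  (forall i j x, `|cutoff2 i j x : R| <= M) -> (forall i j k x, `|cutoff3 i j k x : R| <= M) ->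
  jetI 2 (truncate a) x <= th (a *: x) ^+ 6 * D_integrand g x
    + 2 * (\sum_i \sum_j \sum_k g x * (grad_hess g x i j k * phi_scaled a i j k x))
    + a * ((n%:R ^+ 3 * (43 * (6 * M) ^+ 3)) * (g x + Q_integrand g x)).
Proof.
move=> a0 a1 M1 h2 h3; have [t0|t0] := eqVneq (th (a *: x)) 0.
  rewrite jetI_eq0; last by rewrite /truncate t0 expr0n mulr0.
  rewrite t0 expr0n mul0r add0r big1 ?mulr0 ?add0r.
    rewrite mulr_ge0 ?(ltW a0) // mulr_ge0 //; last by rewrite addr_ge0 ?Q_integrand_ge0 // ltW.
    by rewrite !mulr_ge0 ?exprn_ge0 ?mulr_ge0 // (le_trans ler01).
  move=> i _; rewrite big1 // => j _; rewrite big1 // => k _.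
  by rewrite /phi_scaled /cutoff_phi t0 expr0n !(mul0r, mulr0).
have a2 : a ^+ 2 <= a by rewrite expr2 ler_piMl // ltW.
have a3 : a ^+ 3 <= a by rewrite exprS ler_piMr ?exprn_ile1 // ltW.
pose L i j := 6 * (a ^+ 2 * hj th (a *: x) i j).
pose P i j k := 6 * (a ^+ 3 * kj th (a *: x) i j k).
have hL i j : `|th (a *: x) ^+ 2 * L i j| <= 6 * M * a.
  rewrite (_ : _ * L i j = 6 * (a ^+ 2 * (th (a *: x) ^+ 2 * hj th (a *: x) i j))).
    rewrite (hj_cutoff i j t0) normrM ger0_norm // -mulrA ler_wpM2l // normrM mulrC.
    by rewrite ler_pM // ger0_norm // exprn_ge0 // ltW.
  by rewrite /L; move: (hj _ _ _ _) (th _) => u v; ring.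
have hP i j k : `|th (a *: x) ^+ 3 * P i j k| <= 6 * M * a.
  rewrite (_ : _ * P i j k = 6 * (a ^+ 3 * (th (a *: x) ^+ 3 * kj th (a *: x) i j k))).
    rewrite (kj_cutoff i j k t0) normrM ger0_norm // -mulrA ler_wpM2l // normrM mulrC.
    by rewrite ler_pM // ger0_norm // exprn_ge0 // ltW.
  by rewrite /P; move: (kj _ _ _ _ _) (th _) => u v; ring.
have c1 : 1 <= 6 * M by lra.
have := @D_of_perturb R n (hess g x) L (grad_hess g x) P (g x) (th (a *: x)) (6 * M) a
  (cutoff_ge0 _) (cutoff_le1 _) (ltW a0) a1 c1 (ltW (g0 x)) hL hP.
have eS : (1 + \sum_i \sum_j hess g x i j ^+ 2) * g x = g x + Q_integrand g x.
  by rewrite mulrDl mul1r (sum_hess_sqr sg g0).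
rewrite -D_integrandE eS.
have -> : D_of (fun i j => hess g x i j + L i j) (fun i j k => grad_hess g x i j k + P i j k)
   (g x * th (a *: x) ^+ 6) = jetI 2 (truncate a) x.
  apply: (@eq_jet_of _ _ 2) => [i j|i j k].
    exact: esym (truncate_jets i j i t0).1.
  exact: esym (truncate_jets i j k t0).2.
move=> h; apply: le_trans h _; rewrite !lerD2r lerD2l ler_wpM2l //.
have eP i j k : th (a *: x) ^+ 6 * P i j k = phi_scaled a i j k x.
  rewrite /phi_scaled /cutoff_phi /P -(kj_cutoff _ _ _ t0).
  by move: (kj _ _ _ _ _) (th _) => u v; ring.
by do 3 (apply: ler_sum => ? _); rewrite eP.
Qed.

Variables (rg : rapidly_decaying g) (Lg : rV_L1 g).
Hypotheses (LI : rV_L1 (I_integrand g)) (LQ : rV_L1 (Q_integrand g)).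
Hypotheses (LD : rV_L1 (D_integrand g)) (Dg : Dfun g < 0).

Lemma truncated_D_limit :
  (forall a, rV_L1 (fun x => th (a *: x) ^+ 6 * D_integrand g x)) /\
  ((fun m => iint (fun x => th (harmonic m *: x) ^+ 6 * D_integrand g x)) @ \oo -->
    th 0 ^+ 6 * Dfun g).
Proof.
have st := @smooth_cutoff R n.
have mt a : rV_measurable (fun x => th (a *: x) ^+ 6 * D_integrand g x).
  apply/continuous_rV_measurable/smooth_continuous/smoothM.
    exact/smoothX/(smooth_scale a st).
  exact: smooth_D_integrand.
have bt a x : `|th (a *: x) ^+ 6 * D_integrand g x| <= `|D_integrand g x|.
  rewrite normrM ler_piMl // normrX exprn_ile1 // ger0_norm ?cutoff_ge0 //.
  exact: cutoff_le1.
have LnD : rV_L1 (fun x => `|D_integrand g x|) by exact: (integrable_norm LD).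
split=> [a|]; first exact: le_rV_L1 (bt a) LnD.
have s6 : smooth (fun y : V => th y ^+ 6) by exact: smoothX.
have lim x : (fun m => th (harmonic m *: x) ^+ 6 * D_integrand g x) @ \oo -->
    th 0 ^+ 6 * D_integrand g x.
  apply: cvgM; last exact: cvg_cst.
  apply: (@cvg_comp _ _ _ (fun m => harmonic m *: x) (fun y : V => th y ^+ 6) _ (nbhs (0 : V))).
    by rewrite -(scale0r x); apply: cvgZr_tmp; exact: cvg_harmonic.
  exact: (@smooth_continuous _ _ _ s6 0).
have [_] := @iint_dominated_cvg R n
  (fun m x => th (harmonic m *: x) ^+ 6 * D_integrand g x)
  (fun x => th 0 ^+ 6 * D_integrand g x) (fun x => `|D_integrand g x|)
  (fun m => mt _) LnD (fun m => bt _) lim.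
by rewrite iintZ.
Qed.

(** For a small scale factor [a] the integral is at most that of [D_integrand g] weighted by the
    cutoff, which tends to [cutoff 0 ^+ 6 * Dfun g], plus a constant times [a]. Integrability of the
    truncated integrand is left as a premise: at the edge of the support it has to wait for the
    bounds on sixth powers, and [mixture_limit] supplies it. *)
Lemma truncate_negative : exists a, [/\ 0 < a, a <= 1 &
  rV_L1 (jetI 2 (truncate a)) -> iint (jetI 2 (truncate a)) < 0].
Proof.
have st := @smooth_cutoff R n.
have [M M1 hM] := cutoff_phi_bounds R n.
have [Lt lim_t] := truncated_D_limit.
pose C0 := n%:R ^+ 3 * (43 * (6 * M) ^+ 3).
pose W x := g x + Q_integrand g x; have LW : rV_L1 W by exact: rV_L1D.
pose C1 := 2 * (\sum_(i < n) \sum_(j < n) \sum_(k < n) M * iint (dominant g)) + C0 * iint W.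
have cross a i j k : 0 < a -> a <= 1 ->
    rV_L1 (fun x => g x * (grad_hess g x i j k * phi_scaled a i j k x)) /\ `|iint (fun x => g x * (grad_hess g x i j k * phi_scaled a i j k x))| <=
      a * (M * iint (dominant g)).
  move=> a0 a1; rewrite mulrA.
  have sp := gen_parts_smooth st (gen_cutoff_phi R i j k).
  have sps := smooth_scale a sp.
  have a3 : a ^+ 3 <= a by rewrite exprS ler_piMr ?exprn_ile1 // ltW.
  have na p : `|a ^+ p| = a ^+ p by rewrite ger0_norm // exprn_ge0 // ltW.
  have a4 : a ^+ 4 <= a by rewrite exprS ler_piMr ?exprn_ile1 // ltW.
  apply: (@cross_term _ _ g sg g0 rg Lg LI LQ i j k _ _ a^-1).
  - by apply: smoothM => //; exact: smooth_cst.
  - move=> x; rewrite /phi_scaled normrM na; apply: ler_pM => //; first exact/exprn_ge0/ltW.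
    by have [_ [_ []]] := hM i j k (a *: x).
  - move=> x; have -> : partial k (phi_scaled a i j k) x = a ^+ 4 * partial k (cutoff_phi i j k) (a *: x).
      have e := partialZ k (a ^+ 3) (smooth_diffable sps).
      apply: etrans (congr1 (@^~ x) e) _.
      have e' := congr1 (@^~ x) (partial_scale k a (smooth_diffable sp)).
      by apply: etrans (congr1 ( *%R (a ^+ 3)) e') _; rewrite /= mulrA -exprSr.
    rewrite normrM na; apply: ler_pM => //; first exact/exprn_ge0/ltW.
    by have [_ [_ []]] := hM i j k (a *: x).
  - move=> x xr; rewrite /phi_scaled /cutoff_phi cutoff_eq0 ?expr0n ?(mul0r, mulr0) //.
    by rewrite normrZ (gtr0_norm a0) -ler_pdivrMl ?mulr1.
have bound a : 0 < a -> a <= 1 -> rV_L1 (jetI 2 (truncate a)) ->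
    iint (jetI 2 (truncate a)) <= iint (fun x => th (a *: x) ^+ 6 * D_integrand g x) + a * C1.
  move=> a0 a1 LJ.
  have Lk i j : rV_L1 (fun x => \sum_k g x * (grad_hess g x i j k * phi_scaled a i j k x)).
    by apply: rV_L1_sum => k _; exact: (cross a i j k a0 a1).1.
  have Lj i : rV_L1 (fun x => \sum_j \sum_k g x * (grad_hess g x i j k * phi_scaled a i j k x)).
    by apply: rV_L1_sum => j _; exact: Lk.
  have Li : rV_L1 (fun x => \sum_i \sum_j \sum_k g x * (grad_hess g x i j k * phi_scaled a i j k x)).
    by apply: rV_L1_sum => i _; exact: Lj.
  have L2 := rV_L1Z 2 Li; have L3 := rV_L1Z a (rV_L1Z C0 LW).
  apply: le_trans (le_iint LJ (rV_L1D (rV_L1D (Lt a) L2) L3) _) _.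
    by move=> x; apply: jet_truncate_le => // [i j y|i j k y];
      [have [] := hM i j i y|have [_ []] := hM i j k y].
  rewrite iintD //; last exact: rV_L1D.
  rewrite iintD // -addrA lerD2l !iintZ //; last exact: rV_L1Z.
  rewrite /C1 mulrDr lerD2r mulrCA ler_wpM2l //.
  rewrite iint_sum // mulr_sumr; apply: ler_sum => i _.
  rewrite iint_sum // mulr_sumr; apply: ler_sum => j _.
  rewrite iint_sum => [|k _]; last exact: (cross a i j k a0 a1).1.
  rewrite mulr_sumr; apply: ler_sum => k _.
  exact: le_trans (ler_norm _) (cross a i j k a0 a1).2.
have lim0 : (fun m => iint (fun x => th (harmonic m *: x) ^+ 6 * D_integrand g x)
    + harmonic m * C1) @ \oo --> th 0 ^+ 6 * Dfun g + 0 * C1.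
  by apply: cvgD => //; apply: cvgMl; exact: cvg_harmonic.
have neg : th 0 ^+ 6 * Dfun g + 0 * C1 < 0.
  by rewrite mul0r addr0 pmulr_rlt0 // exprn_gt0 // cutoff0_gt0.
have [m _ hm] := cvgr_lt _ lim0 0 neg.
have m0 : 0 < harmonic m :> R by exact: harmonic_gt0.
have m1 : harmonic m <= 1 :> R by rewrite /harmonic /= invf_le1 // ler1n.
exists (harmonic m); split => // LJ; apply: le_lt_trans (bound _ m0 m1 LJ) _.
by apply: hm => /=.
Qed.
End truncation.

(** * Mixture with a distant Gaussian *)

Section normalized_jets.
Variables (R : realType) (n : nat).
Implicit Types (p : 'I_n -> R) (q H : 'I_n -> 'I_n -> R) (r K : 'I_n -> 'I_n -> 'I_n -> R).
Implicit Types i j k : 'I_n.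

(** Give [s] the weight 1. The value has weight 6 and H has weight -2, so I, Q and D, of degrees 1,
    2 and 3 in H, keep the weights 4, 2 and 0. None is negative, hence no integrand blows up as [s]
    tends to 0. *)
Lemma jet_of_scale (l : nat) H K (a s : R) : s != 0 ->
  jet_of l (fun i j => s ^- 2 * H i j) (fun i j k => s ^- 3 * K i j k) (s ^+ 6 * a) =
  s ^+ (match l with 0 => 4 | 1 => 2 | _ => 0 end) * jet_of l H K a.
Proof.
move=> s0; case: l => [|[|l]] /=.
- rewrite /I_of -mulr_sumr; move: (\sum_i _) => u; by field.
- rewrite /Q_of (_ : \sum_i \sum_j _ = s ^- 4 * \sum_i \sum_j H i j * H j i).
    by move: (\sum_i _) => u; field.
  rewrite mulr_sumr; apply: eq_bigr => i _; rewrite mulr_sumr; apply: eq_bigr => j _.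
  by move: (H i j) (H j i) => u v; field.
- rewrite /D_of mul1r (_ : \sum_i _ = s ^- 6 * \sum_i \sum_j \sum_k K i j k ^+ 2); last first.
    do 3 (rewrite mulr_sumr; apply: eq_bigr => ? _).
    by move: (K _ _ _) => u; field.
  rewrite (_ : \sum_i \sum_j \sum_k (_ * _ * _) =
     s ^- 6 * \sum_i \sum_j \sum_k H i j * H j k * H k i); last first.
    do 3 (rewrite mulr_sumr; apply: eq_bigr => ? _).
    by move: (H _ _) (H _ _) (H _ _) => u v w; field.
  by move: (\sum_i _) (\sum_i _) => u v; field.
Qed.

Lemma sum_ord_bound (F : 'I_n -> R) B : (forall i, `|F i| <= B) ->
  `|\sum_i F i| <= n%:R * B.
Proof.
move=> h; apply: le_trans (ler_norm_sum _ _ _) _.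
by apply: le_trans (ler_sum _ (fun i _ => h i)) _; rewrite sumr_const card_ord mulr_natl.
Qed.

(** [c2] and [c3] bound the entries of H and of its gradient when the value is at least [c] and the
    jet at most [M]; the three resulting bounds are added so as to serve any of the integrands. What
    matters is the dependence on [c], [M] and the dimension alone. *)
Definition jet_bound (c M : R) : R :=
  let c2 := c^-1 * M + c^-1 * c^-1 * (M * M) in
  let c3 := c^-1 * M + c^-1 * c^-1 * (M * M + M * M + M * M) +
            2 * (c^-1 * c^-1 * c^-1 * (M * M * M)) in
  n%:R * c2 * M + n%:R * (n%:R * (c2 * c2)) * M +
  (n%:R * (n%:R * (n%:R * (c3 * c3))) + 2 * (n%:R * (n%:R * (n%:R * (c2 * c2 * c2))))) * M.

Lemma jet_of_bounded (l : nat) c M a p q r : 0 < c -> c <= a -> `|a| <= M ->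
  (forall i, `|p i| <= M) -> (forall i j, `|q i j| <= M) -> (forall i j k, `|r i j k| <= M) ->
  `|jet_of l (hess_jet a p q) (grad_hess_jet a p q r) a| <= jet_bound c M.
Proof.
move=> c0 ca aM hp hq hr.
have M0 : 0 <= M := le_trans (normr_ge0 _) aM.
have ia : `|a^-1| <= c^-1.
  by rewrite gtr0_norm ?invr_gt0 ?(lt_le_trans c0) // lef_pV2 ?posrE // (lt_le_trans c0).
have ic : 0 <= c^-1 by rewrite invr_ge0 ltW.
set c2 := c^-1 * M + c^-1 * c^-1 * (M * M).
set c3 := c^-1 * M + c^-1 * c^-1 * (M * M + M * M + M * M) +
            2 * (c^-1 * c^-1 * c^-1 * (M * M * M)).
have hH i j : `|hess_jet a p q i j| <= c2.
  rewrite /hess_jet normrN; apply: normr_add_le; first exact: normr_mul_le.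
  by rewrite normrN; do ?[exact: ia|exact: hp|apply: normr_mul_le].
have hK i j k : `|grad_hess_jet a p q r i j k| <= c3.
  rewrite /grad_hess_jet normrN; apply: normr_add_le; first apply: normr_add_le.
  - exact: normr_mul_le.
  - rewrite normrN; apply: normr_mul_le; first exact: normr_mul_le.
    by do 2 ?[apply: normr_add_le]; exact: normr_mul_le.
  - apply: normr_mul_le; first by rewrite normr_nat.
    by do ?[exact: ia|exact: hp|apply: normr_mul_le].
have c20 : 0 <= c2 by rewrite addr_ge0 // mulr_ge0 // mulr_ge0.
have c30 : 0 <= c3.
  by rewrite !addr_ge0 //; do ?[apply: mulr_ge0 => //|apply: addr_ge0 => //].
have b1 : `|I_of (hess_jet a p q) a| <= n%:R * c2 * M by apply: normr_mul_le => //; exact: sum_ord_bound.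
have b2 : `|Q_of (hess_jet a p q) a| <= n%:R * (n%:R * (c2 * c2)) * M.
  by apply: normr_mul_le => //; do 2 (apply: sum_ord_bound => ?); exact: normr_mul_le.
have b3 : `|D_of (hess_jet a p q) (grad_hess_jet a p q r) a| <=
   (n%:R * (n%:R * (n%:R * (c3 * c3))) + 2 * (n%:R * (n%:R * (n%:R * (c2 * c2 * c2))))) * M.
  apply: normr_mul_le => //; apply: normr_add_le.
    by do 3 (apply: sum_ord_bound => ?); rewrite expr2; exact: normr_mul_le.
  apply: normr_mul_le; first by rewrite normr_nat.
  do 3 (apply: sum_ord_bound => ?); apply: normr_mul_le => //; exact: normr_mul_le.
rewrite /jet_bound -/c2 -/c3.
move: (le_trans (normr_ge0 _) b1) (le_trans (normr_ge0 _) b2) (le_trans (normr_ge0 _) b3).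
move: b1 b2 b3; case: l => [|[|l]] /=.
all: move: (n%:R * c2 * M) (n%:R * (n%:R * (c2 * c2)) * M) (_ * M) => u v w; clear; lra.
Qed.

(* By homogeneity, dividing the m-th derivatives by [s ^+ (6 - m)] reduces to [s = 1]. *)
Lemma jet_of_weighted_bounded (l : nat) c M s a p q r : 0 < s -> s <= 2 -> 0 < c ->
  c * s ^+ 6 <= a -> `|a| <= M * s ^+ 6 -> (forall i, `|p i| <= M * s ^+ 5) ->
  (forall i j, `|q i j| <= M * s ^+ 4) -> (forall i j k, `|r i j k| <= M * s ^+ 3) ->
  `|jet_of l (hess_jet a p q) (grad_hess_jet a p q r) a| <= 16 * jet_bound c M.
Proof.
move=> s0 s2 c0 ca aM hp hq hr.
have sn : s != 0 by rewrite gt_eqF.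
have a0 : a != 0 by rewrite gt_eqF // (lt_le_trans _ ca) // mulr_gt0 // exprn_gt0.
have div (u : R) m : `|u| <= M * s ^+ m -> `|s ^- m * u| <= M.
  by move=> h; rewrite mulrC normrM normfV (ger0_norm (exprn_ge0 _ (ltW s0))) ler_pdivrMr ?exprn_gt0.
have a6 : s ^- 6 * a != 0 by rewrite mulf_neq0 // invr_neq0 // expf_neq0.
have E : jet_of l (hess_jet a p q) (grad_hess_jet a p q r) a =
  s ^+ (match l with 0 => 4 | 1 => 2 | _ => 0 end) *
  jet_of l (hess_jet (s ^- 6 * a) (fun i => s ^- 5 * p i) (fun i j => s ^- 4 * q i j))
    (grad_hess_jet (s ^- 6 * a) (fun i => s ^- 5 * p i) (fun i j => s ^- 4 * q i j)
    (fun i j k => s ^- 3 * r i j k)) (s ^- 6 * a).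
  rewrite -jet_of_scale // mulVKf ?expf_neq0 //; apply: eq_jet_of => [i j|i j k].
    rewrite /hess_jet; move: (p i) (p j) (q i j) => u v w; by field; rewrite sn a0.
  rewrite /grad_hess_jet; move: (p _) (p _) (p _) (q _ _) (q _ _) (q _ _) (r _ _ _) => *.
  by field; rewrite sn a0.
(* The factor 16 is [2 ^+ 4], the largest value of the powers 4, 2, 0 of [s] for [s <= 2]. *)
rewrite E; apply: normr_mul_le.
  rewrite ger0_norm ?exprn_ge0 ?(ltW s0) //.
  have e m : s ^+ m <= 2 ^+ m by rewrite lerXn2r ?nnegrE // ltW.
  by case: (l) => [|[|?]]; [have := e 4|have := e 2|have := e 0]; rewrite ?expr0 ?expr2 ?exprS; lra.
apply: jet_of_bounded => // *; try exact: div.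
by rewrite mulrC ler_pdivlMr // exprn_gt0.
Qed.
End normalized_jets.

(** * Functions that behave like sixth powers *)

Section weighted_jets.
Variables (R : realType) (n : nat).
Notation V := 'rV[R]_n.
Implicit Types (f g w v A : V -> R) (i j k : 'I_n).

Lemma finite_weighted (I : finType) (T : Type) (F : I -> T -> R) (w : T -> R) :
  (forall x, 0 <= w x) -> (forall a, exists M, forall x, `|F a x| <= M * w x) ->
  exists2 M, 0 <= M & forall a x, `|F a x| <= M * w x.
Proof.
move=> w0 /choice[M hM]; exists (\sum_a `|M a|) => [|i x]; first exact: sumr_ge0.
rewrite (le_trans (hM i x)) // ler_wpM2r // (le_trans (ler_norm _)) // (bigD1 i) //= lerDl.
exact: sumr_ge0.
Qed.

(** Each derivative may cost one factor of the weight [w], as happens for a bounded smooth function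
    times [w ^+ 6]. Unlike such a product, the condition is stable under sums, the weights being
    added. *)
Definition weighted_jets f w M := forall x,
  [/\ `|f x| <= M * w x ^+ 6, forall i, `|partial i f x| <= M * w x ^+ 5,
      forall i j, `|partial i (partial j f) x| <= M * w x ^+ 4 &
      forall i j k, `|partial k (partial i (partial j f)) x| <= M * w x ^+ 3].

Lemma partialX i w m : diffable w ->
  partial i (fun x => w x ^+ m.+1) = fun x => m.+1%:R * (w x ^+ m * partial i w x).
Proof.
move=> dw; have dX m' : diffable (fun x => w x ^+ m').
  elim: m' => [|m' IH]; first by under eq_fun do rewrite expr0; exact: diffable_cst.
  by under eq_fun do rewrite exprS; exact: diffableM.
elim: m => [|m IH].
  under eq_fun do rewrite expr1.
  by apply/funext => x; rewrite expr0 !mul1r.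
apply/funext => x; under eq_fun do rewrite exprS.
apply: etrans (partialM_at i x dw (dX _)) _; rewrite IH.
rewrite -(natr1 m.+1) (exprS _ m).
by move: (partial i w x) (w x) m.+1%:R => a b c; ring.
Qed.

Section sixth_power.
Variables A w : V -> R.
Hypotheses (sA : smooth A) (sw : smooth w).
Let B h := parts_of A h \/ parts_of w h.
Let W m h := exists2 P, gen B P & h = fun x => P x * w x ^+ m.

Let Bs h : gen B h -> smooth h.
Proof.
move=> gh; apply: gen_smooth; apply: gen_sub gh => b [] [s ->]; apply: gen_base;
  exact: smooth_dparts.
Qed.

Let W_partial m h i : W m.+1 h -> W m (partial i h).
Proof.
move=> [P gP ->]; have sP := Bs gP.
have gdP : gen B (partial i P).
  apply: gen_partial gP i => [b Bb|b [] [s ->] i].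
  - by apply: smooth_diffable; apply: Bs; exact: gen_base.
  - by apply: gen_base; left; exists (i :: s).
  - by apply: gen_base; right; exists (i :: s).
have gw : gen B w by apply: gen_base; right; exists [::].
have gdw : gen B (partial i w) by apply: gen_base; right; exists [:: i].
exists (fun x => w x * partial i P x + m.+1%:R * (P x * partial i w x)).
  exact: (genD (genM gw gdP) (genM (gen_cst _ m.+1%:R) (genM gP gdw))).
apply/funext => x.
apply: etrans (partialM_at i x (smooth_diffable sP) (smooth_diffable (smoothX m.+1 sw))) _.
have -> := congr1 (@^~ x) (partialX i m (smooth_diffable sw)).
move: (partial i w x) (partial i P x) (P x) (w x) m.+1%:R => a b c d e.
by rewrite exprS; ring.
Qed.

Hypotheses (bA : forall s, bounded_fun (dparts s A)) (bw : forall s, bounded_fun (dparts s w)).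
Hypothesis w0 : forall x, 0 <= w x.

Let W_bounded m h : W m h -> exists M, forall x, `|h x| <= M * w x ^+ m.
Proof.
move=> [P gP ->]; have [M hM] : bounded_fun P.
  by apply: gen_bounded gP => b [] [s ->].
exists M => x; rewrite normrM ler_pM // ger0_norm // exprn_ge0 //.
Qed.

(** The derivative of [P * w ^+ m.+1] is again of the form [P' * w ^+ m], where [P'] is a polynomial
    in the derivatives of [A] and [w] and therefore bounded. Three derivatives lead from the
    exponent 6 to 3. *)
Lemma sixth_power_weighted : exists2 M, 0 <= M & weighted_jets (fun x => A x * w x ^+ 6) w M.
Proof.
set h := fun x => A x * w x ^+ 6.
have gA : gen B A by apply: gen_base; left; exists [::].
have W6 : W 6 h := ex_intro2 _ _ A gA erefl.
have W5 i : W 5 (partial i h) := W_partial i W6.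
have W4 i j : W 4 (partial i (partial j h)) := W_partial i (W5 j).
have W3 i j k : W 3 (partial k (partial i (partial j h))) := W_partial k (W4 i j).
have p m x : 0 <= w x ^+ m by exact: exprn_ge0.
have [M6 h6] := W_bounded W6.
have [M5 M50 h5] := @finite_weighted 'I_n V (fun i => partial i h) _ (p 5) (fun i => W_bounded (W5 i)).
have [M4 M40 h4] := @finite_weighted ('I_n * 'I_n)%type V (fun l => partial l.1 (partial l.2 h)) _
  (p 4) (fun l => W_bounded (W4 l.1 l.2)).
have [M3 M30 h3] := @finite_weighted ('I_n * 'I_n * 'I_n)%type V
  (fun l => partial l.2 (partial l.1.1 (partial l.1.2 h))) _
  (p 3) (fun l => W_bounded (W3 l.1.1 l.1.2 l.2)).
have le (M N y : R) m x : M <= N -> y <= M * w x ^+ m -> y <= N * w x ^+ m.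
  by move=> MN hy; apply: le_trans hy _; rewrite ler_wpM2r.
have M6' : M6 <= `|M6| := ler_norm _; have M60 := normr_ge0 M6.
exists (`|M6| + M5 + M4 + M3) => [|x]; first by lra.
have l6 : M6 <= `|M6| + M5 + M4 + M3 by lra.
have l5 : M5 <= `|M6| + M5 + M4 + M3 by lra.
have l4 : M4 <= `|M6| + M5 + M4 + M3 by lra.
have l3 : M3 <= `|M6| + M5 + M4 + M3 by lra.
split=> [|i|i j|i j k].
- exact: le l6 (h6 x).
- exact: le l5 (h5 i x).
- exact: le l4 (h4 (i, j) x).
- exact: le l3 (h3 (i, j, k) x).
Qed.
End sixth_power.

Lemma weighted_jets_shift f w M c : weighted_jets f w M ->
  weighted_jets (fun x => f (x + c)) (fun x => w (x + c)) M.
Proof.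
move=> h x; have [h6 h5 h4 h3] := h (x + c).
have e1 i := partial_shift i f c.
have e2 i j := etrans (congr1 (partial i) (e1 j)) (partial_shift i (partial j f) c).
have e3 i j k := etrans (congr1 (partial k) (e2 i j))
  (partial_shift k (partial i (partial j f)) c).
split=> [|i|i j|i j k].
- exact: h6.
- by rewrite (congr1 (@^~ x) (e1 i)); exact: h5.
- by rewrite (congr1 (@^~ x) (e2 i j)); exact: h4.
- by rewrite (congr1 (@^~ x) (e3 i j k)); exact: h3.
Qed.

Lemma weighted_jetsD f g w v M N : smooth f -> smooth g ->
  (forall x, 0 <= w x) -> (forall x, 0 <= v x) -> 0 <= M -> 0 <= N ->
  weighted_jets f w M -> weighted_jets g v N ->
  weighted_jets (fun x => f x + g x) (fun x => w x + v x) (M + N).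
Proof.
move=> sf sg w0 v0 M0 N0 hf hg x.
have [f6 f5 f4 f3] := hf x; have [g6 g5 g4 g3] := hg x.
have key (y z : R) m : `|y| <= M * w x ^+ m -> `|z| <= N * v x ^+ m ->
    `|y + z| <= (M + N) * (w x + v x) ^+ m.
  move=> hy hz; rewrite mulrDl; apply: normr_add_le.
    by rewrite (le_trans hy) // ler_wpM2l // lerXn2r ?nnegrE ?addr_ge0 ?lerDl.
  by rewrite (le_trans hz) // ler_wpM2l // lerXn2r ?nnegrE ?addr_ge0 ?lerDr.
have e1 i : partial i (fun x => f x + g x) = fun x => partial i f x + partial i g x.
  exact: (partialD i (smooth_diffable sf) (smooth_diffable sg)).
have e2 i j : partial i (partial j (fun x => f x + g x)) =
    fun x => partial i (partial j f) x + partial i (partial j g) x.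
  rewrite e1; exact: (partialD i (smooth_diffable (smooth_partial j sf))
    (smooth_diffable (smooth_partial j sg))).
have e3 i j k : partial k (partial i (partial j (fun x => f x + g x))) =
    fun x => partial k (partial i (partial j f)) x + partial k (partial i (partial j g)) x.
  rewrite e2; exact: (partialD k (smooth_diffable (smooth_partial i (smooth_partial j sf)))
    (smooth_diffable (smooth_partial i (smooth_partial j sg)))).
split=> [|i|i j|i j k].
- exact: key.
- by rewrite (congr1 (@^~ x) (e1 i)); exact: key.
- by rewrite (congr1 (@^~ x) (e2 i j)); exact: key.
- by rewrite (congr1 (@^~ x) (e3 i j k)); exact: key.
Qed.

Lemma sixth_powerD_le (s t : R) : 0 <= s -> 0 <= t -> (s + t) ^+ 6 <= 64 * (s ^+ 6 + t ^+ 6).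
Proof.
wlog st : s t / s <= t.
  by move=> h s0 t0; have [st|/ltW ts] := leP s t; [|rewrite addrC (addrC (s ^+ 6))]; exact: h.
move=> s0 t0; apply: (@le_trans _ _ ((2 * t) ^+ 6)).
  by rewrite lerXn2r ?nnegrE ?addr_ge0 ?mulr_ge0 //; lra.
rewrite exprMn (_ : 2 ^+ 6 = 64) ?ler_wpM2l ?lerDr ?exprn_ge0 //.
by ring.
Qed.

Lemma jetI_weighted_bounded l f w M c x : 0 < w x -> w x <= 2 -> 0 < c ->
  weighted_jets f w M -> c * w x ^+ 6 <= f x -> `|jetI l f x| <= 16 * jet_bound n c M.
Proof.
by move=> w0 w2 c0 h cf; have [h6 h5 h4 h3] := h x; exact: (jet_of_weighted_bounded l w0).
Qed.
End weighted_jets.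

(** * Continuity of the integrands in the jet *)

Section jet_limits.
Variables (R : realType) (n : nat).
Local Notation cv u l := ((u : nat -> R) @ \oo --> (l : R)).

Lemma seq_cvgD (u v : nat -> R) (a b : R) : cv u a -> cv v b -> cv (fun m => u m + v m) (a + b).
Proof. exact: cvgD. Qed.

Lemma seq_cvgM (u v : nat -> R) (a b : R) : cv u a -> cv v b -> cv (fun m => u m * v m) (a * b).
Proof. exact: cvgM. Qed.

Lemma seq_cvgN (u : nat -> R) (a : R) : cv u a -> cv (fun m => - u m) (- a).
Proof. exact: cvgN. Qed.

Lemma seq_cvgV (u : nat -> R) (a : R) : a != 0 -> cv u a -> cv (fun m => (u m)^-1) (a^-1).
Proof. exact: cvgV. Qed.

Lemma seq_cvg_sum (I : Type) (r : seq I) (F : I -> nat -> R) (l : I -> R) :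
  (forall a, cv (F a) (l a)) -> cv (fun m => \sum_(a <- r) F a m) (\sum_(a <- r) l a).
Proof.
move=> h; elim: r => [|a r IH].
  by rewrite big_nil; under eq_fun do rewrite big_nil; exact: cvg_cst.
by rewrite big_cons; under eq_fun do rewrite big_cons; exact: seq_cvgD.
Qed.

Lemma jet_of_cvg (l : nat) (a : nat -> R) (p : nat -> 'I_n -> R) (q : nat -> 'I_n -> 'I_n -> R)
    (r : nat -> 'I_n -> 'I_n -> 'I_n -> R) a' p' q' r' :
  a' != 0 -> cv a a' -> (forall i, cv (p ^~ i) (p' i)) ->
  (forall i j, cv (fun m => q m i j) (q' i j)) ->
  (forall i j k, cv (fun m => r m i j k) (r' i j k)) ->
  cv (fun m => jet_of l (hess_jet (a m) (p m) (q m)) (grad_hess_jet (a m) (p m) (q m) (r m)) (a m))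
     (jet_of l (hess_jet a' p' q') (grad_hess_jet a' p' q' r') a').
Proof.
move=> a0 ca cp cq cr; have cV := seq_cvgV a0 ca.
have cH i j : cv (fun m => hess_jet (a m) (p m) (q m) i j) (hess_jet a' p' q' i j).
  apply: seq_cvgN; apply: seq_cvgD; first exact: seq_cvgM (cq i j).
  by apply: seq_cvgN; apply: seq_cvgM; apply: seq_cvgM.
have cK i j k : cv (fun m => grad_hess_jet (a m) (p m) (q m) (r m) i j k)
    (grad_hess_jet a' p' q' r' i j k).
  apply: seq_cvgN; apply: seq_cvgD; first apply: seq_cvgD.
  - exact: seq_cvgM (cr i j k).
  - apply: seq_cvgN; apply: seq_cvgM; first exact: seq_cvgM.
    by apply: seq_cvgD; first apply: seq_cvgD; apply: seq_cvgM; (exact: cq || exact: cp).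
  - apply: seq_cvgM; first exact: cvg_cst.
    by apply: seq_cvgM; apply: seq_cvgM => //; apply: seq_cvgM.
case: l => [|[|l]]; rewrite /jet_of.
- by apply: seq_cvgM => //; apply: seq_cvg_sum => i; exact: cH.
- apply: seq_cvgM => //; do 2 (apply: seq_cvg_sum => ?).
  by apply: seq_cvgM; exact: cH.
- apply: seq_cvgM => //; apply: seq_cvgD.
    by do 3 (apply: seq_cvg_sum => ?); rewrite expr2; apply: seq_cvgM; exact: cK.
  apply: seq_cvgM; first exact: cvg_cst.
  by do 3 (apply: seq_cvg_sum => ?); apply: seq_cvgM; first apply: seq_cvgM; exact: cH.
Qed.

End jet_limits.

Section decaying_functions.
Variables (R : realType) (n : nat).
Notation V := 'rV[R]_n.
Implicit Types (f g : V -> R).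

Lemma dpartsD s f g : smooth f -> smooth g ->
  dparts s (fun x => f x + g x) = fun x => dparts s f x + dparts s g x.
Proof.
move=> sf sg; elim: s => [|i s IH] //.
rewrite /= -!/(dparts _ _) IH.
exact: (partialD i (smooth_diffable (smooth_dparts s sf)) (smooth_diffable (smooth_dparts s sg))).
Qed.

Lemma rapidly_decayingD f g : smooth f -> smooth g ->
  rapidly_decaying f -> rapidly_decaying g -> rapidly_decaying (fun x => f x + g x).
Proof. by move=> sf sg rf rg s; rewrite dpartsD //; apply: decaysD => k; [exact: rf|exact: rg]. Qed.

Lemma dparts_shift s f c : dparts s (fun x => f (x + c)) = fun x => dparts s f (x + c).
Proof.
elim: s => [|i s IH] //; rewrite /= -!/(dparts _ _) IH.
exact: (partial_shift i (dparts s f) c).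
Qed.

Lemma smooth_shift f c : smooth f -> smooth (fun x => f (x + c)).
Proof.
move=> sf s; rewrite dparts_shift.
exact: (diffable_shift c (smooth_diffable (smooth_dparts s sf))).
Qed.

Lemma decays_shift f c : decays f -> decays (fun x => f (x + c)).
Proof.
move=> df k; have [C hC] := df k; have [D hD] := df 0%N.
exists (2 ^+ k * (C + `|c| ^+ k * D)) => x.
have hx : `|x| <= `|x + c| + `|c|.
  by rewrite -[in leLHS](addrK c x) (le_trans (ler_normB _ _)).
have e : `|x| ^+ k <= 2 ^+ k * (`|x + c| ^+ k + `|c| ^+ k).
  apply: (@le_trans _ _ ((2 * Num.max `|x + c| `|c|) ^+ k)).
    rewrite lerXn2r ?nnegrE ?mulr_ge0 ?le_max ?normr_ge0 // (le_trans hx) //.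
    by rewrite mulr_natl mulr2n lerD // le_max lexx ?orbT.
  rewrite exprMn ler_wpM2l ?exprn_ge0 //.
  by case: (leP `|x + c| `|c|) => _; rewrite ?lerDl ?lerDr exprn_ge0.
apply: (le_trans (ler_wpM2r (normr_ge0 _) e)); rewrite -mulrA ler_wpM2l ?exprn_ge0 //.
rewrite mulrDl lerD // ler_wpM2l ?exprn_ge0 //.
by have := hD (x + c); rewrite expr0 mul1r.
Qed.

Lemma rapidly_decaying_shift f c : rapidly_decaying f -> rapidly_decaying (fun x => f (x + c)).
Proof. by move=> rf s; rewrite dparts_shift; apply: decays_shift => k; exact: rf. Qed.

Lemma compact_support_rapid f r : smooth f -> (forall x, r <= `|x| -> f x = 0) ->
  rapidly_decaying f.
Proof.
move=> sf fr s; apply: (@compact_support_decays _ _ _ (r + 1)).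
  exact: smooth_continuous (smooth_dparts s sf).
move=> x xr; pose U := [set x : V | r < `|x|]; have oU : open U by exact: open_norm_gt.
have C h' : (forall y, U y -> h' y = 0) -> forall i, forall y, U y -> partial i h' y = 0.
  by move=> h0 i; exact: partial_eq0_open.
have C0 y : U y -> f y = 0 by move=> /ltW; exact: fr.
apply: (dparts_class (C := fun h => forall y, U y -> h y = 0) C C0 s x).
by rewrite /U /= (lt_le_trans _ xr) // ltrDl.
Qed.

Lemma rapid_parts_bounded f s : rapidly_decaying f -> bounded_fun (dparts s f).
Proof. by move=> rf; have [C h] := rf s 0%N; exists C => x; have := h x; rewrite expr0 mul1r. Qed.

Lemma eq_hess_jet (a : R) p p' q q' : (forall i : 'I_n, p i = p' i :> R) ->
  (forall i j, q i j = q' i j) -> forall i j, hess_jet a p q i j = hess_jet a p' q' i j.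
Proof. by move=> E E' i j; rewrite /hess_jet !E !E'. Qed.

Lemma eq_grad_hess_jet (a : R) p p' q q' r r' : (forall i : 'I_n, p i = p' i :> R) ->
  (forall i j, q i j = q' i j) -> (forall i j k, r i j k = r' i j k) ->
  forall i j k, grad_hess_jet a p q r i j k = grad_hess_jet a p' q' r' i j k.
Proof. by move=> E E' E'' i j k; rewrite /grad_hess_jet !E !E' !E''. Qed.

Lemma jetI_shift l f c x : jetI l (fun x => f (x + c)) x = jetI l f (x + c).
Proof.
have e1 i := partial_shift i f c.
have e2 i j := etrans (congr1 (partial i) (e1 j)) (partial_shift i (partial j f) c).
have e3 i j k := etrans (congr1 (partial k) (e2 i j))
  (partial_shift k (partial i (partial j f)) c).
apply: eq_jet_of => [i j|i j k].
  apply: eq_hess_jet => [i'|i' j']; first exact: (congr1 (@^~ x) (e1 i')).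
  exact: (congr1 (@^~ x) (e2 i' j')).
apply: eq_grad_hess_jet => [i'|i' j'|i' j' k'].
- exact: (congr1 (@^~ x) (e1 i')).
- exact: (congr1 (@^~ x) (e2 i' j')).
- exact: (congr1 (@^~ x) (e3 i' j' k')).
Qed.
End decaying_functions.

(** * The sixth power of a Gaussian *)

Section gaussian_jets.
Variables (R : realType) (n : nat).
Notation V := 'rV[R]_n.
Variables (kappa mu : R).
Hypotheses (k0 : 0 < kappa) (mu0 : 0 < mu).
Notation z := (@gauss R n kappa).

Lemma smooth_gauss : smooth z.
Proof. exact: smooth_expR (tame_gauss_log n kappa).1. Qed.

Lemma gauss_gt0 x : 0 < z x.
Proof. exact: expR_gt0. Qed.

Lemma gauss_le1 x : z x <= 1.
Proof.
rewrite /gauss expR_le1 /gauss_log mulNr oppr_le0 mulr_ge0 //; first by rewrite divr_ge0 ?sqr_ge0.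
by apply: sumr_ge0 => i _; exact: sqr_ge0.
Qed.

Lemma rapidly_decaying_gauss : rapidly_decaying z.
Proof. apply: rapidly_decaying_expR; [exact: tame_gauss_log|exact: decays_gauss_log]. Qed.

Definition gauss6 (x : V) : R := mu * z x ^+ 6.

Lemma smooth_gauss6 : smooth gauss6.
Proof. by apply: smoothM; [exact: smooth_cst|exact/smoothX/smooth_gauss]. Qed.

Lemma gauss6_gt0 x : 0 < gauss6 x.
Proof. by rewrite mulr_gt0 // exprn_gt0 // gauss_gt0. Qed.

Lemma gauss6_le x : gauss6 x <= mu.
Proof. by rewrite /gauss6 ler_piMr ?(ltW mu0) // exprn_ile1 ?gauss_le1 // ltW // gauss_gt0. Qed.

Lemma rapidly_decaying_gauss6 : rapidly_decaying gauss6.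
Proof.
apply: rapidly_decayingZ; first exact/smoothX/smooth_gauss.
rewrite (_ : (fun x => _) = fun x : V => expR (6 * gauss_log kappa x)); last first.
  by apply/funext => x; rewrite expRM_natl.
apply: rapidly_decaying_expR.
  apply: gen_tame; apply: genM; first exact: gen_cst.
  by apply: gen_base; exact: tame_gauss_log.
apply: (@decays_gauss _ _ 0 (3 * kappa ^+ 2)); first by rewrite mulr_gt0 // exprn_gt0.
move=> x; rewrite /gauss_log sub0r; move: (sqnorm x) => s.
by rewrite le_eqVlt; apply/orP; left; apply/eqP; field.
Qed.

Lemma gauss6_L1 : rV_L1 gauss6.
Proof.
apply: decays_L1; first exact: smooth_continuous smooth_gauss6.
by move=> k; exact: (rapidly_decaying_gauss6 [::]).
Qed.

(** [b] is the precision of [gauss6], six times that of the Gaussian raised to the power 6. Its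
    matrix H is [b] times the identity and has no gradient, so each integrand is one of these
    constants times the density. *)
Definition gauss_coef (l : nat) : R :=
  let b := 6 * kappa ^+ 2 in
  match l with 0 => n%:R * b | 1 => n%:R * b ^+ 2 | _ => 2 * (n%:R * b ^+ 3) end.

Lemma gauss6_jets x i j k :
  hj gauss6 x i j = 6 * kappa ^+ 2 * (i == j)%:R /\ kj gauss6 x i j k = 0.
Proof.
have sz := smooth_gauss; have zp := gauss_gt0.
have zx : z x != 0 by rewrite gt_eqF.
have z6 : z x ^+ 6 != 0 by rewrite expf_neq0.
have d2 i' j' : partial i' (partial j' (gauss_log kappa)) = fun x : V => - kappa ^+ 2 * (i' == j')%:R.
  rewrite partial_gauss_log; apply: etrans (partialZ i' _ (@diffable_coord R n j')) _.
  by rewrite partial_coord.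
have hz : hj z x i j = kappa ^+ 2 * (i == j)%:R.
  apply: etrans (esym (hess_hj x sz zp i j)) _; apply: etrans (hess_expR _ x i j) _.
  by rewrite d2 mulNr opprK.
have kz : kj z x i j k = 0.
  apply: etrans (esym (grad_hess_kj x sz zp i j k)) _.
  apply: etrans (grad_hess_expR x i j k (tame_gauss_log n kappa).1) _.
  by rewrite d2 partial_cst oppr0.
have [e1 e2] := jetsX 6 i j k sz zx.
have mn : (fun _ : V => mu) x != 0 by rewrite gt_eqF.
have sc : smooth (fun _ : V => mu) by exact: smooth_cst.
have c1 : hj (fun _ : V => mu) x i j = 0.
  by rewrite /hj /hess_jet !partial_cst !mulr0 subr0 oppr0.
have c2 : kj (fun _ : V => mu) x i j k = 0.
  by rewrite /kj /grad_hess_jet !partial_cst !(mulr0, addr0, subr0, oppr0).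
split.
  apply: etrans (hjM sc (smoothX 6 sz) mn z6 i j) _.
  by rewrite c1 add0r e1 hz mulrA.
apply: etrans (kjM sc (smoothX 6 sz) mn z6 i j k) _.
by rewrite c2 add0r e2 kz mulr0.
Qed.

Lemma jetI_gauss6 l x : jetI l gauss6 x = gauss_coef l * gauss6 x.
Proof.
set b := 6 * kappa ^+ 2.
have e1 i j := (gauss6_jets x i j i).1; have e2 i j k := (gauss6_jets x i j k).2.
apply: etrans (eq_jet_of l (gauss6 x) e1 e2) _.
have d1 i (c : R) (F : 'I_n -> R) : \sum_j (c * (i == j)%:R * F j) = c * F i.
  rewrite (bigD1 i) //= big1 ?eqxx ?mulr1 ?addr0 // => j /negbTE; rewrite eq_sym => ->.
  by rewrite mulr0 mul0r.
case: l => [|[|l]]; rewrite /jet_of /I_of /Q_of /D_of /gauss_coef -/b; congr (_ * _).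
- rewrite (eq_bigr (fun _ => b)) => [|i _]; last by rewrite eqxx mulr1.
  by rewrite sumr_const card_ord mulr_natl.
- rewrite (eq_bigr (fun _ => b ^+ 2)) => [|i _]; last by rewrite d1 eqxx mulr1 expr2.
  by rewrite sumr_const card_ord mulr_natl.
- rewrite big1 ?add0r => [|i _]; last first.
    by rewrite big1 // => j _; rewrite big1 // => k _; rewrite expr0n.
  congr (2 * _); rewrite (eq_bigr (fun _ => b ^+ 3)) => [|i _].
    by rewrite sumr_const card_ord mulr_natl.
  under eq_bigr => j _ do under eq_bigr => k _ do rewrite -mulrA.
  under eq_bigr => j _ do rewrite -mulr_sumr d1.
  by rewrite d1 eqxx mulr1; ring.
Qed.

End gaussian_jets.

(** * The mixture and its limit as the centre goes to infinity *)

Section mixture.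
Variables (R : realType) (n : nat).
Notation V := 'rV[R]_n.
Variable g : V -> R.
Hypotheses (sg : smooth g) (g0 : forall x, 0 < g x) (rg : rapidly_decaying g).
Variables (a : R) (kappa mu : R) (i0 : 'I_n).
Hypotheses (a0 : 0 < a) (k0 : 0 < kappa) (mu0 : 0 < mu).
Notation G := (truncate g a).
Let alpha (x : V) : R := cutoff (a *: x).
Let z := @gauss R n kappa.
Let h := @gauss6 R n kappa mu.
Let far (m : nat) : V := - m%:R *: delta_mx 0 i0.
Let hm m (x : V) : R := h (x + far m).

Definition mixture m (x : V) : R := G x + gauss6 kappa mu (x - m%:R *: delta_mx 0 i0).

Let mixtureE m : mixture m = fun x => G x + hm m x.
Proof. by apply/funext => x; rewrite /mixture /hm /far scaleNr. Qed.

Let alpha0 x : 0 <= alpha x. Proof. exact: cutoff_ge0. Qed.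
Let alpha1 x : alpha x <= 1. Proof. exact: cutoff_le1. Qed.
Let salpha : smooth alpha. Proof. exact: (smooth_scale a (@smooth_cutoff R n)). Qed.
Let sG : smooth G. Proof. exact: smooth_truncate. Qed.
Let sh : smooth h. Proof. exact: smooth_gauss6. Qed.
Let shm m : smooth (hm m). Proof. exact: smooth_shift. Qed.
Let z0 x : 0 < z x. Proof. exact: gauss_gt0. Qed.

Let alpha_out x : a^-1 <= `|x| -> alpha x = 0.
Proof. by move=> xr; apply: cutoff_eq0; rewrite normrZ (gtr0_norm a0) -ler_pdivrMl ?mulr1. Qed.

Let G0 x : 0 <= G x.
Proof. by apply: mulr_ge0; [exact/ltW/g0|exact/exprn_ge0/alpha0]. Qed.

Let hm0 m x : 0 < hm m x. Proof. exact: gauss6_gt0. Qed.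

Lemma smooth_mixture m : smooth (mixture m).
Proof. by rewrite mixtureE; exact: smoothD. Qed.

Lemma mixture_gt0 m x : 0 < mixture m x.
Proof. by rewrite mixtureE; exact: (ltr_wpDl (G0 x) (hm0 m x)). Qed.

Lemma rapidly_decaying_mixture m : rapidly_decaying (mixture m).
Proof.
rewrite mixtureE; apply: (rapidly_decayingD sG (shm m)).
  apply: (@compact_support_rapid _ _ _ a^-1 sG) => x /alpha_out E.
  exact: etrans (congr1 (fun t => g x * t ^+ 6) E) (etrans (congr1 _ (expr0n _ 6)) (mulr0 _)).
exact: (rapidly_decaying_shift (far m) (@rapidly_decaying_gauss6 R n kappa mu k0)).
Qed.

Let weighted_G : exists2 M, 0 <= M & weighted_jets G alpha M.
Proof.
apply: sixth_power_weighted => //.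
- by move=> s; exact: rapid_parts_bounded.
- move=> s; have [M _ hM] := dparts_cutoff_bounded R s.
  exists (`|a ^+ size s| * M) => x.
  rewrite /alpha (congr1 (@^~ x) (dparts_scale s a (@smooth_cutoff R n))).
  by apply: normr_mul_le.
Qed.

Let weighted_h : exists2 M, 0 <= M & weighted_jets h z M.
Proof.
apply: (@sixth_power_weighted R n (fun _ => mu) z) => //.
- exact: smooth_cst.
- exact: smooth_gauss.
(* The derivatives of a constant stay in the algebra generated by the empty set, whose members are
   bounded. *)
- move=> s; apply: gen_bounded (_ : gen (fun _ => False) _) => //.
  elim: s => [|i s IH]; first exact: gen_cst.
  by apply: gen_partial => //.
- by move=> s; apply: rapid_parts_bounded; exact: rapidly_decaying_gauss.
- by move=> x; exact/ltW.
Qed.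

Let zfar x : (fun m => z (x + far m)) @ \oo --> (0 : R).
Proof.
have [C hC] := @rapidly_decaying_gauss R n kappa k0 [::] 1%N.
have C0 : 0 <= C by apply: le_trans (hC 0); rewrite mulr_ge0.
apply/cvgr0Pnorm_le => e e0; near=> m.
have far_m : m%:R <= `|far m|.
  apply: le_trans (coord_le_norm (far m) i0).
  by rewrite /far !mxE !eqxx mulr1 normrN normr_nat.
have y_m : C / e + 1 <= `|x + far m|.
  have t : `|far m| <= `|x + far m| + `|x|.
    by have := ler_normB (x + far m) x; rewrite addrAC subrr add0r.
  have mm : `|x| + (C / e + 1) <= m%:R by near: m; exact: nbhs_infty_ger.
  rewrite -(lerD2l `|x|) (le_trans mm) // (le_trans far_m) // addrC (le_trans t) //.
have y0 : 0 < `|x + far m|.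
  by apply: lt_le_trans y_m; rewrite ltr_wpDl // divr_ge0 // ltW.
have := hC (x + far m); rewrite expr1 mulrC -ler_pdivlMr //= => hz.
apply: le_trans hz _; rewrite ler_pdivrMr // mulrC -ler_pdivrMr //.
by apply: le_trans y_m; rewrite lerDl.
Unshelve. all: by end_near. Qed.

Let whm : exists2 M, 0 <= M & forall m, weighted_jets (hm m) (fun x => z (x + far m)) M.
Proof. by have [M M0 hM] := weighted_h; exists M => // m; exact: weighted_jets_shift. Qed.

Let parts_mixture m s x : dparts s (mixture m) x = dparts s G x + dparts s (hm m) x.
Proof. by rewrite mixtureE; exact: (congr1 (@^~ x) (dpartsD s sG (shm m))). Qed.

Let weighted_mixture : exists2 M, 0 <= M &
  forall m, weighted_jets (mixture m) (fun x => alpha x + z (x + far m)) M.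
Proof.
have [M M0 hM] := weighted_G; have [N N0 hN] := whm; exists (M + N); first exact: addr_ge0.
move=> m; rewrite mixtureE; apply: weighted_jetsD => // x.
exact/ltW/z0.
Qed.

(** On the ball that contains the support of the truncation, [g] is bounded below by compactness, so
    both summands are at least a constant times the sixth power of their own weight; [64 = 2 ^+ 6]
    passes from the sum of the powers to the power of the sum. The constant does not depend on
    [m]. *)
Let mixture_lower : exists2 c, 0 < c & forall m x, `|x| <= a^-1 ->
  c * (alpha x + z (x + far m)) ^+ 6 <= mixture m x.
Proof.
have gV : continuous (fun x => (g x)^-1).
  by apply/smooth_continuous/smoothV => // x; rewrite gt_eqF.
have [M M0 hM] := continuous_bounded_ball a^-1 gV.
have M1 : 0 < (M + 1)^-1 by rewrite invr_gt0 ltr_wpDl.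
pose c := Num.min (M + 1)^-1 mu; have c0 : 0 < c by rewrite lt_min M1.
exists (c / 64) => [|m x xr]; first by rewrite divr_gt0.
have gc : c <= g x.
  rewrite ge_min; apply/orP; left; rewrite -[leRHS]invrK lef_pV2 ?posrE ?invr_gt0 ?ltr_wpDl //.
  by rewrite (le_trans (ler_norm _)) // (le_trans (hM x xr)) // lerDl.
have cmu : c <= mu by rewrite ge_min lexx orbT.
have al6 : 0 <= alpha x ^+ 6 by exact: exprn_ge0.
have z6 : 0 <= z (x + far m) ^+ 6 by exact/exprn_ge0/ltW.
have sp := sixth_powerD_le (alpha0 x) (ltW (z0 (x + far m))).
apply: (@le_trans _ _ (c * alpha x ^+ 6 + c * z (x + far m) ^+ 6)).
  rewrite -mulrDr -mulrA ler_pM2l // mulrC ler_pdivrMr // mulrC //.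
rewrite mixtureE; apply: lerD; first exact: ler_wpM2r.
exact: ler_wpM2r.
Qed.

Let hm_jet l m x : jetI l (hm m) x = gauss_coef n kappa l * hm m x.
Proof. by apply: etrans (jetI_shift l h (far m) x) _; exact: jetI_gauss6. Qed.

(** Up to order three the derivatives of the truncation are bounded by positive powers of [alpha],
    hence vanish together with it, also on the edge of the support. *)
Let jet_out l m x : alpha x = 0 -> jetI l (mixture m) x = jetI l (hm m) x.
Proof.
move=> ax; have [M M0 hM] := weighted_G; have [h6 h5 h4 h3] := hM x.
have e0 (y : R) k : `|y| <= M * alpha x ^+ k.+1 -> y = 0.
  by rewrite ax expr0n mulr0 normr_le0 => /eqP.
have zl (u v w : R) : w = u + v -> u = 0 -> w = v by move=> -> ->; rewrite add0r.
have E0 : mixture m x = hm m x.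
  exact: (zl _ _ _ (parts_mixture m [::] x) (e0 _ _ h6)).
have E1 i : partial i (mixture m) x = partial i (hm m) x.
  exact: (zl _ _ _ (parts_mixture m [:: i] x) (e0 _ _ (h5 i))).
have E2 i j : partial i (partial j (mixture m)) x = partial i (partial j (hm m)) x.
  exact: (zl _ _ _ (parts_mixture m [:: i; j] x) (e0 _ _ (h4 i j))).
have E3 i j k : partial k (partial i (partial j (mixture m))) x =
    partial k (partial i (partial j (hm m))) x.
  exact: (zl _ _ _ (parts_mixture m [:: k; i; j] x) (e0 _ _ (h3 i j k))).
rewrite /jetI E0; apply: eq_jet_of => [i j|i j k].
  by rewrite /hj E0; exact: eq_hess_jet.
by rewrite /kj E0; exact: eq_grad_hess_jet.
Qed.

(** The Gaussian part escapes to infinity and has no integrable majorant common to all [m].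
    Subtracted exactly, it leaves a function supported in a fixed ball and bounded uniformly in [m],
    to which dominated convergence applies. *)
Let excess l m x : R := jetI l (mixture m) x - gauss_coef n kappa l * hm m x.

Let hm_le m x : `|hm m x| <= mu.
Proof. by rewrite gtr0_norm //; exact: gauss6_le. Qed.

Let excess_bound l : exists C, forall m x, `|excess l m x| <= C * cauchy_weight x.
Proof.
have [c c0 hc] := mixture_lower; have [M M0 hM] := weighted_mixture.
pose C0 := 16 * jet_bound n c M + `|gauss_coef n kappa l| * mu.
pose C1 := 2 ^+ n * (1 + a^-1 ^+ n.*2).
have ball m x : `|x| <= a^-1 -> `|excess l m x| <= C0.
  move=> xr; apply: normr_add_le; last by rewrite normrN normrM ler_wpM2l.
  have az : 0 < alpha x + z (x + far m) by rewrite ltr_wpDl.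
  apply: (jetI_weighted_bounded l az _ c0 (hM m) (hc m x xr)).
  have := alpha1 x; have := @gauss_le1 R n kappa (x + far m); rewrite -/z.
  by move: (z _) (alpha x) => *; lra.
have C00 : 0 <= C0.
  by apply: le_trans (normr_ge0 _) (ball 0%N 0 _); rewrite normr0 invr_ge0 ltW.
exists (C0 * C1) => m x; have cw := cauchy_weight_gt0 x.
have [xr|xr] := leP `|x| a^-1.
  apply: (le_trans (ball m x xr)); rewrite -mulrA ler_peMr // -ler_pdivrMr // div1r.
  apply: (le_trans (cauchy_weightV_le x)); rewrite ler_wpM2l ?exprn_ge0 // lerD2l.
  by rewrite lerXn2r ?nnegrE ?invr_ge0 ?(ltW a0).
rewrite /excess jet_out ?hm_jet ?subrr ?normr0; last exact/alpha_out/ltW.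
rewrite mulr_ge0 ?(ltW cw) // mulr_ge0 // mulr_ge0 ?exprn_ge0 // addr_ge0 //.
by rewrite exprn_ge0 // invr_ge0 ltW.
Qed.

Let far0 x (u : nat -> R) M k : 0 <= M -> (forall m, `|u m| <= M * z (x + far m) ^+ k.+1) ->
  u @ \oo --> (0 : R).
Proof.
move=> M0 hu; apply: norm_cvg0.
apply: (@squeeze_cvgr _ _ _ _ (fun _ => 0) (fun m => M * z (x + far m))).
- near=> m; rewrite normr_ge0 (le_trans (hu m)) // ler_wpM2l // exprS ler_piMr ?(ltW (z0 _)) //.
  by rewrite exprn_ile1 ?(ltW (z0 _)) // gauss_le1.
- exact: cvg_cst.
- by rewrite -[X in _ --> X](mulr0 M); apply: seq_cvgM; [exact: cvg_cst|exact: zfar].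
Unshelve. all: by end_near. Qed.

Let excess_lim l x : excess l ^~ x @ \oo --> jetI l G x.
Proof.
have [M M0 hM] := whm.
have l6 : (fun m => hm m x) @ \oo --> (0 : R).
  by apply: (@far0 x _ M 5 M0) => m; have [] := hM m x.
have [ax|ax] := eqVneq (alpha x) 0.
  rewrite jetI_eq0; last first.
    exact: etrans (congr1 (fun t => g x * t ^+ 6) ax) (etrans (congr1 _ (expr0n _ 6)) (mulr0 _)).
  rewrite (_ : excess l ^~ x = fun _ => 0); first exact: cvg_cst.
  by apply/funext => m; rewrite /excess jet_out // hm_jet subrr.
have Gx : G x != 0 by apply: mulf_neq0; [rewrite gt_eqF|rewrite expf_neq0].
have lim s k : (forall m, `|dparts s (hm m) x| <= M * z (x + far m) ^+ k.+1) ->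
    (fun m => dparts s (mixture m) x) @ \oo --> dparts s G x.
  move=> hs; rewrite (_ : (fun m => _) = fun m => dparts s G x + dparts s (hm m) x); last first.
    by apply/funext => m; exact: parts_mixture.
  rewrite -[X in _ --> X]addr0; apply: seq_cvgD; first exact: cvg_cst.
  exact: far0 M0 hs.
rewrite -[X in _ --> X]subr0 -[X in _ - X](mulr0 (gauss_coef n kappa l)).
apply: seq_cvgD; last first.
  by apply: seq_cvgN; apply: seq_cvgM => //; exact: cvg_cst.
apply: jet_of_cvg => //.
- by apply: (lim [::] 5) => m; have [] := hM m x.
- by move=> i; apply: (lim [:: i] 4) => m; have [_ + _ _] := hM m x; exact.
- by move=> i j; apply: (lim [:: i; j] 3) => m; have [_ _ + _] := hM m x; exact.
- by move=> i j k; apply: (lim [:: k; i; j] 2) => m; have [_ _ _ +] := hM m x; exact.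
Qed.

Lemma jetI_continuous l f : smooth f -> (forall x : V, 0 < f x) -> continuous (jetI l f).
Proof.
move=> sf f0; case: l => [|[|l]].
- rewrite (_ : jetI 0 f = I_integrand f); first exact/smooth_continuous/smooth_I_integrand.
  by apply/funext => x; have [] := jetIE x sf f0.
- rewrite (_ : jetI 1 f = Q_integrand f); first exact/smooth_continuous/smooth_Q_integrand.
  by apply/funext => x; have [] := jetIE x sf f0.
- rewrite (_ : jetI l.+2 f = D_integrand f); first exact/smooth_continuous/smooth_D_integrand.
  by apply/funext => x; have [] := jetIE x sf f0.
Qed.

(** The excess tends pointwise to the integrand of the truncation, so dominated convergence also
    yields the integrability of the latter. The subtracted Gaussian part has an integral independent
    of [m] by translation invariance. *)
Lemma mixture_limit l : [/\ rV_L1 (jetI l G), forall m, rV_L1 (jetI l (mixture m)) &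
  (fun m => iint (jetI l (mixture m))) @ \oo -->
    iint (jetI l G) + gauss_coef n kappa l * iint (@gauss6 R n kappa mu)].
Proof.
have [C hC] := excess_bound l.
have Lc : rV_L1 (fun x : V => C * cauchy_weight x) := rV_L1Z C (rV_L1_cauchy_weight R n).
have ch m : continuous (fun x => gauss_coef n kappa l * hm m x).
  by apply/smooth_continuous/smoothM => //; exact: smooth_cst.
have cE m : continuous (excess l m).
  move=> x; have cj := @jetI_continuous l _ (smooth_mixture m) (mixture_gt0 m) x.
  exact: cvgB cj (ch m x).
have mE m : rV_measurable (excess l m) by exact: continuous_rV_measurable.
have LE m : rV_L1 (excess l m) by exact: le_rV_L1 (mE m) (hC m) Lc.
have [LG lim] := iint_dominated_cvg mE Lc hC (@excess_lim l).
have Lh m : rV_L1 (hm m).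
  apply: decays_L1; first exact: smooth_continuous.
  by move=> k; exact: (rapidly_decaying_shift (far m) (@rapidly_decaying_gauss6 R n kappa mu k0) [::]).
have Lch m := rV_L1Z (gauss_coef n kappa l) (Lh m).
have Ej m : jetI l (mixture m) = fun x => excess l m x + gauss_coef n kappa l * hm m x.
  by apply/funext => x; rewrite /excess subrK.
split=> // [m|]; first by rewrite Ej; exact: rV_L1D.
have ih m : iint (hm m) = iint h.
  rewrite -(iint_shift (far m) (continuous_rV_measurable (smooth_continuous sh))).
  by congr iint; apply/funext => x; rewrite /hm addrC.
rewrite (_ : (fun m => iint (jetI l (mixture m))) =
  fun m => iint (excess l m) + gauss_coef n kappa l * iint h).
  by apply: seq_cvgD => //; exact: cvg_cst.
by apply/funext => m; rewrite Ej iintD // iintZ // ih.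
Qed.

End mixture.

(** * Ratios tending to minus infinity *)

Section unbounded_ratio.
Variables (R : realType) (n : nat).
Notation V := 'rV[R]_n.

Lemma ratio_unbounded (I Q D L : R) : D < 0 -> 0 <= Q ->
  exists2 b, 0 < b & (I + b^-1) * (D + 2 * b) / (Q + 1) ^+ 2 < L.
Proof.
move=> D0 Q0; have Q1 : 0 < (Q + 1) ^+ 2 by rewrite exprn_gt0 // ltr_wpDl.
(* With [b <= - D / 4] the second factor is at most [D / 2], and with [|I| + M <= b^-1] the first is
   at least [M]. This [M] makes [M * (- D / 2)] equal to [(|L| + 1) * (Q + 1) ^+ 2]. *)
pose M := 2 * (`|L| + 1) * (Q + 1) ^+ 2 / - D.
have d0 : 0 < - D by rewrite oppr_gt0.
have M0 : 0 < M by rewrite divr_gt0 // mulr_gt0 // mulr_gt0 // ltr_wpDl.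
have IM : 0 < `|I| + M by rewrite ltr_wpDl.
pose b := Num.min (- D / 4) (`|I| + M)^-1.
have b0 : 0 < b by rewrite lt_min divr_gt0 // invr_gt0.
have b1 : b <= - D / 4 by rewrite ge_min lexx.
have b2 : `|I| + M <= b^-1.
  by rewrite -[leLHS]invrK lef_pV2 ?posrE ?invr_gt0 // ge_min lexx orbT.
exists b => //; rewrite ltr_pdivrMr //.
have i1 : M <= I + b^-1 by have := ler_norm (- I); rewrite normrN; lra.
have i2 : - D / 2 <= - (D + 2 * b) by lra.
have i3 : M * (- D / 2) <= (I + b^-1) * - (D + 2 * b).
  by rewrite ler_pM ?(ltW M0) // divr_ge0 // ltW.
have e : M * (- D / 2) = (`|L| + 1) * (Q + 1) ^+ 2.
  by rewrite /M; field; rewrite lt_eqF.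
have i4 : - L <= `|L| by rewrite -normrN ler_norm.
have i5 : - L * (Q + 1) ^+ 2 < (`|L| + 1) * (Q + 1) ^+ 2 by rewrite ltr_pM2r //; lra.
move: i3 i5; rewrite e mulrN mulNr.
move: ((I + _) * _) (L * _) (_ * (Q + 1) ^+ 2) => u v w; lra.
Qed.

Lemma jetI1_ge0 (f : V -> R) x : smooth f -> 0 <= f x -> 0 <= jetI 1 f x.
Proof.
move=> sf f0; rewrite /jetI /jet_of /Q_of mulr_ge0 //.
apply: sumr_ge0 => i _; apply: sumr_ge0 => j _.
have -> : hj f x j i = hj f x i j.
  by rewrite /hj /hess_jet (partialC j i x sf) (mulrC (partial j f x)).
by rewrite -expr2 sqr_ge0.
Qed.

Lemma theta_star_eqNy (i0 : 'I_n) (g : V -> R) : admissible g -> Dfun g < 0 ->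
  theta_star R n = -oo%E.
Proof.
move=> [[sg g0] rg [Lg _] [LI LQ LD] _] Dg.
have gL : rV_L1 g by apply/continuous_L1P => //; exact: smooth_continuous.
have {}LI : rV_L1 (I_integrand g).
  by apply/continuous_L1P => //; exact/smooth_continuous/smooth_I_integrand.
have {}LQ : rV_L1 (Q_integrand g).
  by apply/continuous_L1P => //; exact/smooth_continuous/smooth_Q_integrand.
have {}LD : rV_L1 (D_integrand g).
  by apply/continuous_L1P => //; exact/smooth_continuous/smooth_D_integrand.
have [a [a0 _ neg]] := truncate_negative sg g0 rg gL LI LQ LD Dg.
pose G := truncate g a.
have lims kappa mu (k0 : 0 < kappa) (mu0 : 0 < mu) l :=
  mixture_limit sg g0 rg i0 a0 k0 mu0 l.
(* The Gaussian is arbitrary here: only the integrability for the truncated density is extracted,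
   the premise left open in [truncate_negative]. *)
have [LG _ _] := lims 1 1 ltr01 ltr01 2%N.
have D0 : iint (jetI 2 G) < 0 := neg LG.
have Q0 : 0 <= iint (jetI 1 G).
  apply: iint_ge0 => x; apply: jetI1_ge0; first exact: smooth_truncate.
  by apply: mulr_ge0; [exact/ltW/g0|exact/exprn_ge0/cutoff_ge0].
suff H L : (theta_star R n < L%:E)%E.
  case E : (theta_star R n) => [r| |] //; last by have := H 0; rewrite E.
  by have := H r; rewrite E ltxx.
have [b b0 hb] := ratio_unbounded (iint (jetI 0 G)) L D0 Q0.
(* The sixth power multiplies the precision by 6, so that [gauss6] has precision [b]. *)
pose kappa := Num.sqrt (b / 6).
have b6 : 0 < b / 6 by rewrite divr_gt0.
have k0 : 0 < kappa by rewrite sqrtr_gt0.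
have kb : 6 * kappa ^+ 2 = b by rewrite sqr_sqrtr ?(ltW b6) //; field.
pose w := iint (@gauss6 R n kappa 1).
have w0 : 0 < w.
  apply: iint_gt0; first exact/smooth_continuous/smooth_gauss6.
  - exact: gauss6_L1.
  - by move=> x; apply/ltW/gauss6_gt0.
  - exact: gauss6_gt0.
have n0 : 0 < n%:R :> R by rewrite ltr0n (leq_ltn_trans _ (ltn_ord i0)).
(* This mass makes the contributions of the Gaussian to I, Q and D equal to [b^-1], 1, [2 * b]. *)
pose mu := (n%:R * b ^+ 2 * w)^-1.
have mu0 : 0 < mu by rewrite invr_gt0 mulr_gt0 // mulr_gt0 // exprn_gt0.
have wmu : iint (@gauss6 R n kappa mu) = mu * w.
  rewrite /w -iintZ; last exact: gauss6_L1.
  by congr iint; apply/funext => x; rewrite /gauss6 mul1r.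
have [_ L0 lim0] := lims kappa mu k0 mu0 0%N.
have [_ L1 lim1] := lims kappa mu k0 mu0 1%N.
have [_ L2 lim2] := lims kappa mu k0 mu0 2%N.
have wn : w != 0 by rewrite gt_eqF.
have bn : b != 0 by rewrite gt_eqF.
have nn : n%:R != 0 :> R by rewrite gt_eqF.
have c0 : gauss_coef n kappa 0 * (mu * w) = b^-1.
  by rewrite /gauss_coef kb /mu; field; rewrite wn bn nn.
have c1 : gauss_coef n kappa 1 * (mu * w) = 1.
  by rewrite /gauss_coef kb /mu; field; rewrite wn bn nn.
have c2 : gauss_coef n kappa 2 * (mu * w) = 2 * b.
  by rewrite /gauss_coef kb /mu; field; rewrite wn bn nn.
move: lim0 lim1 lim2; rewrite wmu c0 c1 c2 -/G.
set f := mixture g a kappa mu i0.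
move=> lim0 lim1 lim2.
have Qn : iint (jetI 1 G) + 1 != 0 by rewrite gt_eqF // ltr_wpDl.
have limr : (fun m => iint (jetI 0 (f m)) * iint (jetI 2 (f m)) *
    (iint (jetI 1 (f m)) * iint (jetI 1 (f m)))^-1) @ \oo -->
  (iint (jetI 0 G) + b^-1) * (iint (jetI 2 G) + 2 * b) *
    ((iint (jetI 1 G) + 1) * (iint (jetI 1 G) + 1))^-1.
  apply: seq_cvgM; first exact: seq_cvgM.
  by apply: seq_cvgV; [rewrite mulf_neq0|exact: seq_cvgM].
(* The centre is taken far enough for the ratio to fall below [L] and also for Q to be positive,
   which admissibility demands. *)
have [m [rm qm]] : exists m, iint (jetI 0 (f m)) * iint (jetI 2 (f m)) *
    (iint (jetI 1 (f m)) * iint (jetI 1 (f m)))^-1 < L /\ 0 < iint (jetI 1 (f m)).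
  have Qp : 0 < iint (jetI 1 G) + 1 by rewrite ltr_wpDl.
  rewrite expr2 in hb.
  have [N1 _ h1] := cvgr_lt _ limr L hb; have [N2 _ h2] := cvgr_gt _ lim1 0 Qp.
  by exists (maxn N1 N2); split; [exact: h1 (leq_maxl _ _)|exact: h2 (leq_maxr _ _)].
have sf : smooth (f m) := smooth_mixture sg a kappa mu i0 m.
have f0 x : 0 < f m x by exact: mixture_gt0.
have eI : I_integrand (f m) = jetI 0 (f m) by apply/funext => x; have [] := jetIE x sf f0.
have eQ : Q_integrand (f m) = jetI 1 (f m) by apply/funext => x; have [] := jetIE x sf f0.
have eD : D_integrand (f m) = jetI 2 (f m) by apply/funext => x; have [] := jetIE x sf f0.
have [c cp [ac Ic Qc Dc]] : exists2 c, 0 < c & [/\ admissible (fun x => c * f m x),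
    Ifun (fun x => c * f m x) = c * Ifun (f m),
    Qfun (fun x => c * f m x) = c * Qfun (f m) &
    Dfun (fun x => c * f m x) = c * Dfun (f m)].
  apply: normalize_admissible => //.
  - exact: rapidly_decaying_mixture.
  - by rewrite eI; exact: L0.
  - by rewrite eQ; exact: L1.
  - by rewrite eD; exact: L2.
  - by rewrite /Qfun eQ.
apply: (@le_lt_trans _ _ ((iint (jetI 0 (f m)) * iint (jetI 2 (f m)) *
    (iint (jetI 1 (f m)) * iint (jetI 1 (f m)))^-1)%:E)); last by rewrite lte_fin.
apply: ereal_inf_lbound; exists (fun x => c * f m x) => //.
rewrite Ic Qc Dc /Ifun /Qfun /Dfun eI eQ eD; congr EFin.
have cn : c != 0 by rewrite gt_eqF.
have qn : iint (jetI 1 (f m)) != 0 by rewrite gt_eqF.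
move: (iint (jetI 0 _)) (iint (jetI 1 _)) (iint (jetI 2 _)) qn => u v y vn.
by field; rewrite vn cn.
Qed.
End unbounded_ratio.

Unset Implicit Arguments. Set Strict Implicit. Set Printing Implicit Defensive.

Theorem theorem7p3 (R : realType) :
  ((forall (d : nat), (2 <= d)%N ->
      forall f : 'rV[R]_d -> R, admissible f -> 0 <= Dfun f) ->
     (0 <= theta_infty R)%E /\ (theta_infty R < 1)%E)
  /\
  (forall (d0 : nat) (g : 'rV[R]_d0 -> R),
      (1 <= d0)%N -> admissible g -> Dfun g < 0 ->
      (forall d : nat, (d0 <= d)%N -> theta_star R d = -oo%E)
      /\ theta_infty R = -oo%E).
Proof.
split=> [D0|d0 g d1 ag Dg].
  split.
    apply: le_ereal_inf_tmp => _ [d /= d2 <-]; apply: le_ereal_inf_tmp => _ [f /= af <-].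
    have Df := D0 d d2 f af; move: af => [[sf f0] rf _ [LI _ _] _].
    have If : 0 <= Ifun f.
      apply: Ifun_ge0 => //; apply/continuous_L1P => //.
      exact/smooth_continuous/smooth_I_integrand.
    by rewrite lee_fin; apply: divr_ge0; [exact: mulr_ge0|exact: sqr_ge0].
  have [f af J] := log_convexity_counterexample R.
  have Df := D0 2%N isT f af.
  have Q0 : 0 < Qfun f by have [_ _ _ _] := af.
  have lt1 : Ifun f * Dfun f / Qfun f ^+ 2 < 1.
    (* [64 * I * D <= (16 * I + D) ^+ 2 < (8 * Q) ^+ 2] *)
    rewrite ltr_pdivrMr ?exprn_gt0 // mul1r expr2.
    move: J Df Q0; move: (Ifun f) (Qfun f) (Dfun f) => i q d J d0 q0.
    have := sqr_ge0 (16 * i - d); rewrite expr2 => sq.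
    have [i0|i0] := leP 0 i; first by nra.
    by apply: le_lt_trans (_ : 0 < _); [nra|rewrite mulr_gt0].
  apply: le_lt_trans (_ : ((Ifun f * Dfun f / Qfun f ^+ 2)%:E < 1)%E); last by rewrite lte_fin.
  apply: le_trans (ereal_inf_lbound _) (ereal_inf_lbound _); first by exists 2%N.
  by exists f.
have neg d : (d0 <= d)%N -> exists2 h : 'rV[R]_d -> R, admissible h & Dfun h < 0.
  elim: d => [|d IH]; first by case: d0 g d1 ag Dg.
  rewrite leq_eqVlt => /orP[/eqP <-|]; first by exists g.
  by rewrite ltnS => /IH[h ah Dh]; exact: admissible_dim_succ ah Dh.
have theta d : (d0 <= d)%N -> theta_star R d = -oo%E.
  move=> dd; have [h ah Dh] := neg d dd.
  exact: theta_star_eqNy (Ordinal (leq_trans d1 dd)) h ah Dh.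
(* [d0] may be 1, whereas the infimum over dimensions starts at 2. *)
split=> //; apply/eqP; rewrite -leeNy_eq -(theta (maxn d0 2) (leq_maxl _ _)).
by apply: ereal_inf_lbound; exists (maxn d0 2) => //=; exact: leq_maxr.
Qed.
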